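(* Assume that either (i) $\omega_b\subset\omega$ and $\omega_b$ satisfies the Geometric Control Condition (GCC), or (ii) $0\le b(x)\le b_+$ for all $x\in\Omega$ with $b_+\in(0,b^*]$, there is $b_->0$ with $b>b_-$ a.e. in $\omega_b$, and both $\omega_b$ and $\omega$ satisfy the Piecewise Multipliers Geometric Condition (PMGC). Assume moreover that $f_1,f_2$ satisfy Hypothesis (N) of the context (with Lipschitz function $L$), and that $$e^{\alpha\tau}\|a_2\|_{L^\infty(\Omega)}<\frac{\alpha}{M},$$ where $M>0$ and $\alpha>0$ are constants with $\|S(t)\|_{\mathcal L(\mathcal H)}\le Me^{-\alpha t}$ for all $t\ge 0$. Then for every sufficiently small constant $\rho>0$ there is a constant $C_\rho>0$ with $$L(C_\rho)<\frac{\alpha-M\|a_2\|_{L^\infty(\Omega)}e^{\alpha\tau}}{M}$$ such that the following holds. For all initial data $U_0\in\mathcal H$ and $\Psi=(0,0,0,a_2g)\in C([-\tau,0];\mathcal H)$ with $$\|U_0\|_{\mathcal H}^2+\int_0^\tau\big\|\sqrt{|a_2|}\,g(s-\tau)\big\|_{L^2(\Omega)}^2\,ds<\rho^2,$$ the problem $$\dot U(t)=\mathcal A U(t)-\mathcal B U(t-\tau)+\mathcal F(U(t)),\ t>0,\qquad U(0)=U_0,\qquad \mathcal B U(s)=\Psi(s),\ s\in[-\tau,0],$$ has a unique global solution $U\in C([0,\infty);\mathcal H)$, and for every $t\ge0$ $$\|U(t)\|_{\mathcal H}\le M\left(\|U_0\|_{\mathcal H}+\int_0^\tau e^{\alpha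 s}\|\Psi(s-\tau)\|_{\mathcal H}\,ds\right)e^{-\left(\alpha-M\|a_2\|_{L^\infty(\Omega)}e^{\alpha\tau}-ML(C_\rho)\right)t}.$$
   Context: **Setting.** $\Omega\subset\mathbb R^n$ is a bounded open domain with boundary of class $C^2$; $\tau>0$ is a constant delay; $a_1,b\in C^0(\overline\Omega,\mathbb R)$, $a_2\in L^\infty(\Omega)$ (real valued, no sign condition); $a_1\ge 0$ a.e. in $\Omega$ and $a_1>a_0>0$ a.e. in a given open subset $\omega\subset\Omega$, for some constant $a_0$; $\omega_b$ is a non-empty open set with $\overline{\omega_b}\subset\{x\in\Omega: b(x)\ne 0\}$. The system considered is $$u_{tt}-\Delta u+b\,y_t+a_1u_t=f_1(u),\qquad y_{tt}-\Delta y-b\,u_t+a_2\,y_t(\cdot,t-\tau)=f_2(y)\quad\text{in }\Omega\times(0,\infty),$$ with $u=y=0$ on $\partial\Omega\times(0,\infty)$, $u(0)=u_0$, $u_t(0)=u_1$, $y(0)=y_0$, $y_t(0)=y_1$, and $y_t=g$ on $\Omega\times[-\tau,0]$. **Abstract form.** $\mathcal H=(H_0^1(\Omega)\times L^2(\Omega))^2$ with norm $\|(u_1,u_2,y_1,y_2)\|_{\mathcal H}^2=\|\nabla u_1\|_{L^2}^2+\|u_2\|_{L^2}^2+\|\nabla y_1\|_{L^2}^2+\|y_2\|_{L^2}^2$. With $U=(u,u_t,y,y_t)$, $U_0=(u_0,u_1,y_0,y_1)\in\mathcal H$: $\mathcal A(u_1,u_2,y_1,y_2)=(u_2,\ \Delta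 u_1-by_2-a_1u_2,\ y_2,\ \Delta y_1+bu_2)$ with domain $D(\mathcal A)=((H^2(\Omega)\cap H_0^1(\Omega))\times H_0^1(\Omega))^2$; $\mathcal B(u_1,u_2,y_1,y_2)=(0,0,0,a_2y_2)$; $\mathcal F(u_1,u_2,y_1,y_2)=(0,f_1(u_1),0,f_2(y_1))$; $\Psi(s)=(0,0,0,a_2g(s))$. $\mathcal A$ generates a contraction semigroup $(S(t))_{t\ge0}$ on $\mathcal H$. A solution is a mild solution, i.e. a continuous $\mathcal H$-valued function satisfying $$U(t)=S(t)U_0-\int_0^tS(t-s)\mathcal BU(s-\tau)\,ds+\int_0^tS(t-s)\mathcal F(U(s))\,ds,$$ where $\mathcal BU(s-\tau)$ is understood as $\Psi(s-\tau)$ when $s-\tau<0$. **Geometric assumptions.** A subset $\omega\subset\Omega$ satisfies the Geometric Control Condition (GCC) if there is $T>0$ such that every ray of geometrical optics starting at any point $x\in\Omega$ at $t=0$ enters $\omega$ within time $T$. A subset $\omega\subset\Omega$ satisfies the Piecewise Multipliers Geometric Condition (PMGC) if there exist subsets $\Omega_j\subset\Omega$ with Lipschitz boundaries and points $x_j\in\mathbb R^n$, $j=1,\dots,J$, such that $\Omega_i\cap\Omega_j=\emptyset$ for $i\neq j$ and $\omega$ contains a neighborhood in $\Omega$ of $\bigcup_{j}\gamma_j(x_j)\cup(\Omega\setminus\bigcup_j\Omega_j)$, where $\gamma_j(x_j)=\{x\in\partial\Omega_j:(x-x_j)\cdot\nu_j(x)\ge0\}$ and $\nu_j$ is the outward unit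 normal to $\partial\Omega_j$. (G1): $\omega_b\subset\omega$ and $\omega_b$ satisfies the GCC. (G2): $0\le b(x)\le b_+$ for all $x\in\Omega$ with $b_+\in(0,b^*]$, there is $b_->0$ with $b>b_-$ a.e. in $\omega_b$, and both $\omega_b$ and $\omega$ satisfy the PMGC. Here $b^*>0$ is a constant depending on the domain and the control region, namely the threshold in the known result of Alabau-Boussouira, Wang and Yu giving exponential stability of $S(t)$. It is known that under (G1) or (G2) there exist $M,\alpha>0$ with $\|S(t)\|_{\mathcal L(\mathcal H)}\le Me^{-\alpha t}$ for all $t\ge0$; $M,\alpha$ denote such constants. **Hypothesis (N).** $f_1,f_2:\mathbb R\to\mathbb R$ are continuous and: (1) $f_1(0)=f_2(0)=0$; (2) for every $r>0$ there is $L(r)>0$ such that for $i=1,2$, $\|f_i(u)-f_i(v)\|_{L^2(\Omega)}\le L(r)\|\nabla u-\nabla v\|_{L^2(\Omega)}$ for all $u,v\in H_0^1(\Omega)$ with $\|\nabla u\|_{L^2}\le r$, $\|\nabla v\|_{L^2}\le r$, and $L(r)\to0$ as $r\to0$; (3) there are strictly increasing continuous $h_1,h_2:\mathbb R_+\to\mathbb R_+$ with $h_i(0)=0$ and $\left|\int_\Omega f_i(u)u\,dx\right|\le h_i(\|\nabla u\|_{L^2})\|\nabla u\|_{L^2}^2$ for all $u\in H_0^1(\Omega)$, $i=1,2$. *)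

(* Defs.v *)
From HB Require Import structures.
From mathcomp Require Import all_boot all_order all_algebra.
From mathcomp Require Import all_classical all_reals all_analysis.
Import Order.TTheory GRing.Theory Num.Theory.
Import numFieldNormedType.Exports.
Set Implicit Arguments. Unset Strict Implicit. Unset Printing Implicit Defensive.
Local Open Scope classical_set_scope.
Local Open Scope ring_scope.

Definition measure_rV_display : measure_display. Proof. exact: default_measure_display. Qed.

(* The sigma-algebra on 'rV[R]_n is generated by the coordinates; it is the
   Borel sigma-algebra. *)
Section measurable_rV.
Context (R : realType) (n : nat).
Let coord (i : 'I_n) (x : 'rV[R]_n) : measurableTypeR R := x 0 i.

HB.instance Definition _ := @isMeasurable.Build measure_rV_display 'rV[R]_n
  (g_sigma_preimage coord) (@sigma_algebra0 _ _ _) (@sigma_algebraC _ _)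
  (@sigma_algebra_bigcup _ _ _).

Lemma measurable_coord (i : 'I_n) :
  measurable_fun setT (fun x : 'rV[R]_n => x 0 i : measurableTypeR R).
Proof.
move=> _ Y mY; rewrite setTI; apply: sub_sigma_algebra => /=.
rewrite -bigcup_seq/=; exists i => /=; first by rewrite mem_index_enum.
by exists Y => //; rewrite setTI.
Qed.

Lemma measurable_fun_rV d (T : measurableType d) (f : T -> 'rV[R]_n) :
  (forall i, measurable_fun setT (fun t => f t 0 i : measurableTypeR R)) ->
  measurable_fun setT f.
Proof.
move=> mf _ A mA.
suff : preimage_set_system [set: T] f (g_sigma_preimage coord) `<=` measurable.
  by apply; exists A.
rewrite -g_sigma_preimage_comp.
apply: smallest_sub; first exact: sigma_algebra_measurable.
move=> B; rewrite -bigcup_seq => -[i _ [C mC <-]].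
exact: mf.
Qed.
End measurable_rV.
(* Lebesgue measure on R^n, by recursion on n: image of the product measure
   lebesgue_measure \x lebesgue_rV n under (a, v) |-> (a, v_0, ..., v_{n-1}). *)
Section lebesgue_rV.
Context (R : realType).

Definition cons_rV n (p : measurableTypeR R * 'rV[R]_n) : 'rV[R]_n.+1 :=
  \row_i oapp (p.2 0) (p.1 : R) (unlift ord0 i).

Lemma cons_rV0 n p : @cons_rV n p 0 ord0 = p.1.
Proof. by rewrite mxE unlift_none. Qed.

Lemma cons_rVS n p (i : 'I_n) : @cons_rV n p 0 (lift ord0 i) = p.2 0 i.
Proof. by rewrite mxE liftK. Qed.

Lemma measurable_cons_rV n : measurable_fun setT (@cons_rV n).
Proof.
apply: measurable_fun_rV => i; case: (unliftP ord0 i) => [j|] ->.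
- under eq_fun do rewrite cons_rVS.
  exact: (measurableT_comp (@measurable_coord R n j) measurable_snd).
- under eq_fun do rewrite cons_rV0.
  exact: measurable_fst.
Qed.

Section step.
Context (n : nat) (mu : {sigma_finite_measure set 'rV[R]_n -> \bar R}).

Let step := pushforward (lebesgue_measure \x mu)%E (@cons_rV n).

Let step0 : step set0 = 0%E.
Proof. by rewrite /step /pushforward preimage_set0 measure0. Qed.

Let step_ge0 A : (0 <= step A)%E.
Proof. by rewrite /step /pushforward measure_ge0. Qed.

Let step_sigma_additive : semi_sigma_additive step.
Proof.
have mc := @measurable_cons_rV n.
move=> F mF tF mUF; rewrite /step /pushforward preimage_bigcup.
apply: measure_semi_sigma_additive.
- by move=> k; rewrite -[X in measurable X]setTI; exact: mc.
- apply/trivIsetP => /= i j _ _ ij; rewrite -preimage_setI.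
  by move/trivIsetP : tF => /(_ _ _ _ _ ij) ->//; rewrite preimage_set0.
- by rewrite -preimage_bigcup -[X in measurable X]setTI; exact: mc.
Qed.

HB.instance Definition _ := isMeasure.Build _ _ _ step step0 step_ge0
  step_sigma_additive.

Let step_sigma_finite : sigma_finite setT step.
Proof.
have /sigma_finiteP[F [TF ndF Foo]] := sigma_finiteT (@lebesgue_measure R).
have /sigma_finiteP[G [TG ndG Goo]] := sigma_finiteT mu.
pose u (x : 'rV[R]_n.+1) : measurableTypeR R * 'rV[R]_n :=
  (x 0 ord0, \row_i x 0 (lift ord0 i)).
have mu_ : measurable_fun setT u.
  apply/measurable_fun_pairP; split; first exact: measurable_coord.
  apply: measurable_fun_rV => i /=; under eq_fun do rewrite mxE.
  exact: measurable_coord.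
have uK : cancel (@cons_rV n) u.
  move=> [a v]; rewrite /u cons_rV0; congr pair.
  by apply/rowP => i; rewrite mxE cons_rVS.
exists (fun k => u @^-1` (F k `*` G k)).
  rewrite -preimage_bigcup (_ : \bigcup_k (F k `*` G k) = setT) ?preimage_setT//.
  apply/seteqP; split=> // -[x y] _.
  have [k _ Fkx] : (\bigcup_k F k) x by rewrite -TF.
  have [l _ Gly] : (\bigcup_k G k) y by rewrite -TG.
  exists (maxn k l) => //; split.
  - by move: x Fkx; exact/subsetPset/ndF/leq_maxl.
  - by move: y Gly; exact/subsetPset/ndG/leq_maxr.
move=> k; have [mF Fkoo] := Foo k; have [mG Gkoo] := Goo k; split.
  by rewrite -[X in measurable X]setTI; apply: mu_ => //; exact: measurableX.
rewrite /step /pushforward -comp_preimage (_ : u \o _ = id); last first.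
  by apply/funext => p; exact: uK.
by rewrite preimage_id product_measure1E// lte_mul_pinfty// ge0_fin_numE.
Qed.

HB.instance Definition _ := Measure_isSigmaFinite.Build _ _ _ step
  step_sigma_finite.

Definition lebesgue_rV_step : {sigma_finite_measure set 'rV[R]_n.+1 -> \bar R} :=
  step.
End step.

Fixpoint lebesgue_rV n : {sigma_finite_measure set 'rV[R]_n -> \bar R} :=
  match n with
  | 0 => dirac (0 : 'rV[R]_0)
  | n'.+1 => lebesgue_rV_step (lebesgue_rV n')
  end.

Lemma lebesgue_rV_box n (a b : 'I_n -> R) : (forall i, a i <= b i) ->
  lebesgue_rV n [set x | forall i, x 0 i \in `]a i, b i]] =
  (\prod_i (b i - a i))%:E.
Proof.
elim: n a b => [|n IH] a b ab.
  by rewrite big_ord0 /= diracE mem_set// => -[].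
rewrite big_ord_recl.
pose B : set 'rV[R]_n :=
  [set x | forall i, x 0 i \in `]a (lift ord0 i), b (lift ord0 i)]].
change ((lebesgue_measure \x lebesgue_rV n)%E
  (@cons_rV n @^-1` [set x | forall i, x 0 i \in `]a i, b i]]) =
  ((b ord0 - a ord0) * \prod_i (b (lift ord0 i) - a (lift ord0 i)))%:E).
rewrite (_ : _ @^-1` _ = `]a ord0, b ord0]%classic `*` B).
  rewrite product_measure1E//; last first.
    rewrite (_ : B = \bigcap_(i in [set: 'I_n])
      ((fun x : 'rV[R]_n => x 0 i : measurableTypeR R) @^-1`
         `]a (lift ord0 i), b (lift ord0 i)]%classic)).
      apply: fin_bigcap_measurable => // i _.
      by rewrite -[X in measurable X]setTI; exact: measurable_coord.
    by apply/seteqP; split=> x /= xab i; [move=> _|]; [exact: xab|exact: (xab i I)].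
  rewrite IH; last by move=> i; exact: ab.
  have leb0 : lebesgue_measure (`]a ord0, b ord0]%classic : set R) =
      (b ord0 - a ord0)%:E.
    rewrite lebesgue_measure_itv/= lte_fin; have := ab ord0.
    by rewrite le_eqVlt => /predU1P[->|->]; rewrite ?ltxx ?subrr.
  by rewrite EFinM -leb0.
apply/seteqP; split=> -[x v] /=.
  move=> xv; split=> [|i].
    by have := xv ord0; rewrite cons_rV0.
  by have := xv (lift ord0 i); rewrite cons_rVS.
move=> [xab vab] i; case: (unliftP ord0 i) => [j|] ->.
  by rewrite cons_rVS; exact: vab.
by rewrite cons_rV0.
Qed.
End lebesgue_rV.
Arguments lebesgue_rV {R} n.

Section euclid.
Context {R : realType} {n : nat}.
Local Notation X := 'rV[R]_n.+1.

(* The library norm of 'rV[R]_n.+1 is the sup norm; it gives the usual topology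
   but lengths and angles need the Euclidean structure. *)
Definition dot (u v : X) : R := \sum_i u 0 i * v 0 i.
Definition enorm (u : X) : R := Num.sqrt (dot u u).

Definition partial (i : 'I_n.+1) (f : X -> R) : X -> R := 'D_(delta_mx 0 i) f.
Definition grad (f : X -> R) (x : X) : X := \row_i partial i f x.

Fixpoint Ck (k : nat) (f : X -> R) : Prop :=
  continuous f /\
  if k is k'.+1 then
    forall i, (forall x, derivable f x (delta_mx 0 i)) /\ Ck k' (partial i f)
  else True.

Definition boundary (A : set X) : set X := closure A `\` interior A.

End euclid.

Section domains.
Context {R : realType} {n : nat}.
Local Notation X := 'rV[R]_n.+1.

Definition C2_defining (Omega : set X) (x : X) (rho : X -> R) :=
  [/\ Ck 2 rho, grad rho x != 0 & \forall y \near x, Omega y <-> 0 < rho y].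

Definition C2_boundary (Omega : set X) :=
  forall x, boundary Omega x -> exists rho, C2_defining Omega x rho.

(* Near each boundary point E is the strict subgraph of a Lipschitz function phi
   of the variables orthogonal to a unit vector e. *)
Definition lipschitz_boundary (E : set X) :=
  forall x, boundary E x -> exists (e : X) (phi : X -> R),
    [/\ dot e e = 1,
        [lipschitz phi y | y in setT],
        forall y (s : R), phi (y + s *: e) = phi y &
        \forall y \near x, E y <-> dot y e < phi y].

(* nu is the outward unit normal to E at x: to first order at x, E is the
   half-space (y - x) . nu < 0.  It exists exactly at the points of
   differentiability of a Lipschitz boundary. *)
Definition outward_normal (E : set X) (x nu : X) :=
  dot nu nu = 1 /\
  forall e : R, 0 < e -> \forall y \near x,
    (dot (y - x) nu < - (e * enorm (y - x)) -> E y) /\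
    (e * enorm (y - x) < dot (y - x) nu -> ~ E y).

Definition multiplier_boundary (E : set X) (x0 : X) : set X :=
  [set x | boundary E x /\
     exists nu, outward_normal E x nu /\ 0 <= dot (x - x0) nu].

Definition PMGC (Omega omega : set X) :=
  exists (J : nat) (O : 'I_J -> set X) (p : 'I_J -> X),
  [/\ forall j, [/\ open (O j), O j `<=` Omega & lipschitz_boundary (O j)],
      forall i j, i != j -> O i `&` O j = set0 &
      exists V : set X,
        [/\ open V,
            \bigcup_j multiplier_boundary (O j) (p j) `<=` V,
            Omega `\` \bigcup_j O j `<=` V &
            V `&` Omega `<=` omega]].

(* Unit speed rays of geometrical optics in Omega (generalized bicharacteristics
   of Melrose and Sjostrand, projected to space): x is the position, v the
   velocity, B the set of times of transversal reflection.  With rho a local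
   defining function of Omega (Omega = {rho > 0}):
   - off B the ray has velocity v and, inside Omega, no acceleration;
   - off B, at a boundary point, the ray is tangent to the boundary; it is not
     accelerated where the boundary is diffractive ('D_v ('D_v rho) > 0), and
     otherwise it has the normal acceleration of a geodesic of the boundary;
   - at times in B, which are isolated, the velocity is reflected. *)
Definition optical_ray (Omega : set X) (x v : R -> X) :=
  exists B : set R,
  [/\ B `<=` `[0, +oo[,
      {within `[0, +oo[, continuous x} /\
        (forall t : R, 0 <= t -> closure Omega (x t)),
      forall t : R, 0 <= t -> ~ B t ->
        [/\ dot (v t) (v t) = 1,
            (t' - t)^-1 *: (x t' - x t) @[t' --> within `[0, +oo[ t^'] --> v t,
            Omega (x t) ->
              (t' - t)^-1 *: (v t' - v t)
                @[t' --> within (`[0, +oo[ `\` B) t^'] --> (0 : X) &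
            forall rho, boundary Omega (x t) -> C2_defining Omega (x t) rho ->
              dot (v t) (grad rho (x t)) = 0 /\
              (t' - t)^-1 *: (v t' - v t)
                @[t' --> within (`[0, +oo[ `\` B) t^'] -->
              - (Num.min 0 ('D_(v t) ('D_(v t) rho) (x t))
                  / dot (grad rho (x t)) (grad rho (x t))) *: grad rho (x t)] &
      forall t, B t ->
        [/\ boundary Omega (x t),
            \forall t' \near t^', 0 <= t' -> ~ B t' /\ Omega (x t') &
            forall rho, C2_defining Omega (x t) rho ->
            exists vi vr : X,
              [/\ v @ t^'- --> vi, v @ t^'+ --> vr,
                  dot vi (grad rho (x t)) < 0 &
                  vr = vi - (2 * dot vi (grad rho (x t))
                         / dot (grad rho (x t)) (grad rho (x t)))
                         *: grad rho (x t)]]].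

Definition GCC (Omega omega : set X) :=
  exists2 T : R, 0 < T & forall x v, optical_ray Omega x v -> Omega (x 0) ->
    exists2 t, 0 <= t <= T & omega (x t).

End domains.

(* Functions on Omega are total functions on R^n whose values outside Omega are
   irrelevant (u \_ Omega is the extension by 0); elements of L^2(Omega) and of
   the Sobolev spaces are represented by functions, and two representatives are
   identified when they agree a.e. in Omega. *)
Section function_spaces.
Context {R : realType} {n : nat}.
Local Notation X := 'rV[R]_n.+1.
Local Notation leb := (@lebesgue_rV R n.+1).
Context (Omega : set X).

Definition L2norme (u : X -> R) : \bar R := 'N[leb]_2%:E[EFin \o (u \_ Omega)].
Definition L2norm (u : X -> R) : R := fine (L2norme u).
Definition L2 : set (X -> R) := [set u | u \_ Omega \in Lfun leb 2%:E].

Definition Linfty : set (X -> R) := [set u | u \_ Omega \in Lfun leb +oo%E].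
Definition Linftynorm (u : X -> R) : R :=
  fine 'N[leb]_+oo%E[EFin \o (u \_ Omega)].

Definition test_fun : set (X -> R) :=
  [set phi | (forall k, Ck k phi) /\
     let supp := closure [set x | phi x != 0] in
     compact supp /\ supp `<=` Omega].

Definition weak_partial (i : 'I_n.+1) (u v : X -> R) :=
  [/\ L2 u, L2 v & forall phi, test_fun phi ->
    \int[leb]_(x in Omega) (u x * partial i phi x) =
    - \int[leb]_(x in Omega) (v x * phi x)].

(* a representative of the weak derivative when there is one, 0 otherwise *)
Definition wpartial (i : 'I_n.+1) (u : X -> R) : X -> R :=
  xget (cst 0) [set v | weak_partial i u v].

Definition gradnorm (u : X -> R) : R :=
  Num.sqrt (\sum_i L2norm (wpartial i u) ^+ 2).

Definition H1 : set (X -> R) :=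
  [set u | L2 u /\ forall i, exists v, weak_partial i u v].
Definition H1norm (u : X -> R) : R :=
  Num.sqrt (L2norm u ^+ 2 + gradnorm u ^+ 2).

Definition H10 : set (X -> R) :=
  [set u | H1 u /\ forall e : R, 0 < e ->
     exists2 phi, test_fun phi & H1norm (u \- phi) < e].

Definition H2 : set (X -> R) := [set u | H1 u /\ forall i, H1 (wpartial i u)].
Definition laplacian (u : X -> R) : X -> R :=
  fun x => \sum_i wpartial i (wpartial i u) x.

End function_spaces.

(* State space H = (H_0^1 x L^2)^2: ((u1, u2), (y1, y2)). *)
Section energy_space.
Context {R : realType} {n : nat}.
Local Notation X := 'rV[R]_n.+1.

Definition state : Type := ((X -> R) * (X -> R)) * ((X -> R) * (X -> R)).
HB.instance Definition _ := GRing.Lmodule.on state.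

Context (Omega : set X).
Local Notation leb := (@lebesgue_rV R n.+1).

Definition energy_space : set state :=
  [set U | [/\ H10 Omega U.1.1, L2 Omega U.1.2, H10 Omega U.2.1
             & L2 Omega U.2.2]].

Definition energy_norm (U : state) : R :=
  Num.sqrt (gradnorm Omega U.1.1 ^+ 2 + L2norm Omega U.1.2 ^+ 2
          + gradnorm Omega U.2.1 ^+ 2 + L2norm Omega U.2.2 ^+ 2).

Definition state_eq (U V : state) :=
  [/\ ae_eq leb Omega U.1.1 V.1.1, ae_eq leb Omega U.1.2 V.1.2,
      ae_eq leb Omega U.2.1 V.2.1 & ae_eq leb Omega U.2.2 V.2.2].

(* U is in C(I; H) *)
Definition energy_continuous (I : set R) (U : R -> state) :=
  (forall t, I t -> energy_space (U t)) /\
  forall t, I t ->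
    energy_norm (U s - U t) @[s --> within I (nbhs t)] --> (0 : R).

(* v is the Bochner integral over D of the H-valued function f: the j-th simple
   function \sum_(k < N j) 1_(E j k) w j k approximates f in L^1(D; H), and v is
   the limit in H of the integrals of these simple functions. *)
Definition bochner_integral (D : set R) (f : R -> state) (v : state) :=
  [/\ forall s, D s -> energy_space (f s), energy_space v &
  exists (N : nat -> nat) (E : nat -> nat -> set R) (w : nat -> nat -> state),
  let err j s := energy_norm (f s - \sum_(k < N j) \1_(E j k) s *: w j k) in
  [/\ forall j k, [/\ measurable (E j k), E j k `<=` D,
          (lebesgue_measure (E j k) < +oo)%E & energy_space (w j k)],
      forall j, measurable_fun D (err j),
      (\int[lebesgue_measure]_(s in D) (err j s)%:E)%E @[j --> \oo] --> 0%E &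
      energy_norm (v - \sum_(k < N j) fine (lebesgue_measure (E j k)) *: w j k)
        @[j --> \oo] --> (0 : R)]].

End energy_space.

Arguments state : clear implicits.

Section wave_system.
Context {R : realType} {n : nat}.
Local Notation X := 'rV[R]_n.+1.
Local Notation leb := (@lebesgue_rV R n.+1).
Context (Omega : set X).

Definition opA_dom : set (state R n) :=
  [set U | [/\ H2 Omega U.1.1 /\ H10 Omega U.1.1, H10 Omega U.1.2,
               H2 Omega U.2.1 /\ H10 Omega U.2.1 & H10 Omega U.2.2]].

Definition opA (a1 b : X -> R) (U : state R n) : state R n :=
  ((U.1.2, fun x => laplacian Omega U.1.1 x - b x * U.2.2 x - a1 x * U.1.2 x),
   (U.2.2, fun x => laplacian Omega U.2.1 x + b x * U.1.2 x)).

Definition opB (a2 : X -> R) (U : state R n) : state R n :=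
  ((cst 0, cst 0), (cst 0, fun x => a2 x * U.2.2 x)).

Definition opF (f1 f2 : R -> R) (U : state R n) : state R n :=
  ((cst 0, f1 \o U.1.1), (cst 0, f2 \o U.2.1)).

Definition history (a2 : X -> R) (g : R -> X -> R) (s : R) : state R n :=
  ((cst 0, cst 0), (cst 0, fun x => a2 x * g s x)).

Local Notation HH := (energy_space Omega).
Local Notation hnorm := (energy_norm Omega).
Local Notation "U =H V" := (state_eq Omega U V) (at level 70).

(* S is the contraction semigroup on H generated by A (with domain D(A)). *)
Definition contraction_semigroup_of (a1 b : X -> R)
    (S : R -> state R n -> state R n) :=
  [/\ [/\ forall (t : R) U, 0 <= t -> HH U -> HH (S t U),
          forall (t : R) U V, 0 <= t -> HH U -> HH V -> U =H V -> S t U =H S t V,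
          forall (t a : R) U V, 0 <= t -> HH U -> HH V ->
            S t (a *: U + V) =H a *: S t U + S t V &
          forall (t : R) U, 0 <= t -> HH U -> hnorm (S t U) <= hnorm U],
      forall U, HH U -> S 0 U =H U,
      forall (s t : R) U, 0 <= s -> 0 <= t -> HH U -> S (s + t) U =H S s (S t U),
      forall U, HH U -> hnorm (S t U - U) @[t --> 0^'+] --> (0 : R) &
      forall U V, HH U -> HH V ->
        (hnorm (h^-1 *: (S h U - U) - V) @[h --> 0^'+] --> (0 : R)) <->
        (opA_dom U /\ V =H opA a1 b U)].

Definition exponential_bound (S : R -> state R n -> state R n) (M alpha : R) :=
  [/\ 0 < M, 0 < alpha & forall (t : R) U, 0 <= t -> HH U ->
    hnorm (S t U) <= M * expR (- alpha * t) * hnorm U].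

Definition mild_solution (S : R -> state R n -> state R n) (a2 : X -> R)
    (f1 f2 : R -> R) (tau : R) (U0 : state R n) (g : R -> X -> R)
    (U : R -> state R n) :=
  let delayed s := if s < tau then history a2 g (s - tau)
                   else opB a2 (U (s - tau)) in
  energy_continuous Omega `[0, +oo[ U /\
  forall t : R, 0 <= t -> exists Idelay Isource : state R n,
    [/\ bochner_integral Omega `[0, t] (fun s => S (t - s) (delayed s)) Idelay,
        bochner_integral Omega `[0, t]
          (fun s => S (t - s) (opF f1 f2 (U s))) Isource &
        U t =H S t U0 - Idelay + Isource].

Definition damping_coefficient (omega : set X) (a1 : X -> R) :=
  [/\ {within closure Omega, continuous a1},
      {ae leb, forall x, Omega x -> 0 <= a1 x} &
      exists2 a0 : R, 0 < a0 & {ae leb, forall x, omega x -> a0 < a1 x}].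

Definition coupling_coefficient (omegab : set X) (b : X -> R) :=
  {within closure Omega, continuous b} /\
  closure omegab `<=` [set x | Omega x /\ b x != 0].

Definition condition_GCC (omega omegab : set X) :=
  omegab `<=` omega /\ GCC Omega omegab.

Definition condition_PMGC (omega omegab : set X) (b : X -> R) (bstar : R) :=
  [/\ exists2 bp : R, 0 < bp <= bstar & forall x, Omega x -> 0 <= b x <= bp,
      exists2 bm : R, 0 < bm & {ae leb, forall x, omegab x -> bm < b x},
      PMGC Omega omegab & PMGC Omega omega].

(* bstar is a threshold for the stability theorem of Alabau-Boussouira, Wang and
   Yu; it depends on the sets only, not on the coefficients a1 and b. *)
Definition stability_threshold (omega omegab : set X) (bstar : R) :=
  0 < bstar /\
  forall a1 b S, damping_coefficient omega a1 -> coupling_coefficient omegab b ->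
    condition_PMGC omega omegab b bstar -> contraction_semigroup_of a1 b S ->
    exists M alpha, exponential_bound S M alpha.

Definition local_lipschitz_source (L : R -> R) (f : R -> R) :=
  forall (r : R) u v, 0 < r -> H10 Omega u -> H10 Omega v ->
    gradnorm Omega u <= r -> gradnorm Omega v <= r ->
    (L2norme Omega (fun x => f (u x) - f (v x))%R
       <= (L r * gradnorm Omega (u \- v))%:E)%E.

Definition controlled_source (f : R -> R) :=
  exists h : R -> R,
  [/\ h 0 = 0, {in `[0, +oo[ &, {homo h : x y / x < y}},
      {within `[0, +oo[, continuous h} &
      forall u, H10 Omega u ->
        `|\int[leb]_(x in Omega) (f (u x) * u x)|
          <= h (gradnorm Omega u) * gradnorm Omega u ^+ 2].

Definition hypothesis_N (f1 f2 L : R -> R) :=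
  [/\ continuous f1 /\ continuous f2,
      f1 0 = 0 /\ f2 0 = 0,
      (forall r : R, 0 < r -> 0 < L r) /\ L @ 0^'+ --> (0 : R),
      local_lipschitz_source L f1 /\ local_lipschitz_source L f2 &
      controlled_source f1 /\ controlled_source f2].

End wave_system.

(* Main.v *)
(* The weight e^(alpha t) turns the Duhamel formula into a self-reproducing bound: with
   k = M |a2| e^(alpha tau) + M L(C) and c = M (|U0| + int_0^tau e^(alpha s) |Psi (s - tau)| ds),
   if |U t| <= c e^(-(alpha - k) t) <= C on the half-line, then the right-hand side of the
   mild formula for U obeys the same bound, because int_0^t k c e^(k s) ds = c e^(k t) - c.
   Since L(r) -> 0 as r -> 0, C can be chosen with k < alpha, and then every Picard iterate
   started from 0 stays in the ball of radius C, on which the source is L(C)-Lipschitz; in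
   the norm sup_t e^(-l t) |U t| with l = 4 M (|a2| + L(C)) the iteration contracts by 1/4.
   No a priori estimate on a maximal solution is needed, and the decay is inherited by the
   limit.  Small data give c <= C by |Psi| <= (rho + |Psi|^2 / rho) / 2.

   The integrals are Bochner integrals of functions valued in representatives, so one also
   needs that H is complete and that energy_norm separates classes: for the weak derivatives
   this is the fundamental lemma of the calculus of variations and the Poincare inequality. *)

Require Import Defs.
From HB Require Import structures.
From mathcomp Require Import all_boot all_order all_algebra.
From mathcomp Require Import all_classical all_reals all_analysis.
From mathcomp Require Import measurable_realfun ess_sup_inf ring lra.
Import Order.TTheory GRing.Theory Num.Theory.
Import numFieldNormedType.Exports.
Set Implicit Arguments.
Unset Strict Implicit.
Unset Printing Implicit Defensive.
Local Open Scope classical_set_scope.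
Local Open Scope ring_scope.

(** * Square-integrable functions *)

(** The semigroup and the Bochner integral act on representatives, so linearity, the semigroup law
    and uniqueness hold only up to a.e. equality. The fixed-point argument is therefore carried out
    in an abstract module with a complete seminorm, where equality reads [p (U - W) = 0] and one
    Picard step is a relation rather than a map. Two weights play different roles: the decaying
    bound is merely reproduced by a step, while the contraction is measured in a growing exponential
    whose large exponent replaces any smallness. The same contraction estimate hence gives
    uniqueness among all solutions, large ones included. Completeness is asked of sequences whose
    increments are at most c 4^-k, with limit within 2 c 4^-k: this is what a factor 1/4 produces,
    and its square decays fast enough for pointwise a.e. convergence in L2. Integration by parts
    rests on the translation invariance of Lebesgue measure instead of iterated integrals. *)

Lemma cvg4 (R : realType) (c : R) : (fun k => c * 4^-1 ^+ k) @ \oo --> (0 : R).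
Proof.
have : (geometric c (4^-1 : R)) @ \oo --> (0 : R).
  by apply: cvg_geometric; rewrite gtr0_norm ?invr_gt0// invf_lt1// ltr1n.
by [].
Qed.

Lemma near_small (R : realType) (a : nat -> R) (e : R) : a @ \oo --> (0 : R) -> 0 < e -> \forall j \near \oo, a j < e.
Proof.
move=> a0 e0; have /cvgrPdist_lt/(_ _ e0) := a0.
by apply: filterS => j; rewrite sub0r normrN => /(le_lt_trans (ler_norm _)).
Qed.

(** Here [d k l] stands for the distance between the k-th and l-th terms of a sequence, in L2 or in
    the energy space; the second hypothesis is what the triangle inequality gives. *)
Lemma geometric_telescope (R : realType) (d : nat -> nat -> R) (c : R) :
  0 <= c -> (forall k, d k k <= 0) ->
  (forall k l, (k <= l)%N -> d k l.+1 <= d k l + c * 4^-1 ^+ l) ->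
  forall k l, (k <= l)%N -> d k l <= 2 * c * 4^-1 ^+ k.
Proof.
move=> c0 d0 dS k l kl.
(* The stronger bound by a difference of powers closes the induction, because 2 (4^-l - 4^-(l+1)) =
   (3/2) 4^-l exceeds the increment 4^-l. *)
suff H m : d k (k + m)%N <= 2 * c * (4^-1 ^+ k - 4^-1 ^+ (k + m)).
  rewrite -(subnKC kl); apply: le_trans (H _) _.
  by rewrite ler_wpM2l ?mulr_ge0// gerBl exprn_ge0.
elim: m => [|m IH]; first by rewrite addn0 subrr mulr0.
rewrite addnS; apply: le_trans (dS _ _ (leq_addr _ _)) _.
apply: le_trans (lerD IH (lexx _)) _.
rewrite exprS; have : 0 <= c * 4^-1 ^+ (k + m) by rewrite mulr_ge0// exprn_ge0.
lra.
Qed.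

Lemma cvg_geometric_increments (R : realType) (a : nat -> R) (H : R) :
  (forall k, `|a k.+1 - a k| <= H * 2^-1 ^+ k) -> cvgn a.
Proof.
move=> aH.
have -> : a = (fun n => a 0%N + series (fun k => a k.+1 - a k) n).
  apply/funext => n; rewrite /series/= telescope_sumr//.
  by rewrite addrC subrK.
apply: is_cvgD; first exact: is_cvg_cst.
apply: normed_cvg.
apply: (@series_le_cvg _ _ (geometric H 2^-1)) => //.
- by move=> n; exact: normr_ge0.
- by move=> n; exact: le_trans (normr_ge0 _) (aH n).
- by apply: is_cvg_geometric_series; rewrite gtr0_norm ?invr_gt0// invf_lt1// ltr1n.
Qed.

Lemma limn_einf_ge0 (R : realType) (u : nat -> \bar R) :
  (forall n, 0 <= u n)%E -> (0 <= limn_einf u)%E.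
Proof.
move=> u0; rewrite limn_einf_lim; apply: lime_ge; first exact: is_cvg_einfs.
by apply: nearW => n; apply: le_ereal_inf_tmp => _ [k /= _ <-].
Qed.

Lemma limn_einf_le (R : realType) (u : nat -> \bar R) (c : \bar R) k :
  (forall n, (k <= n)%N -> u n <= c)%E -> (limn_einf u <= c)%E.
Proof.
move=> uc; rewrite limn_einf_lim; apply: lime_le; first exact: is_cvg_einfs.
apply: nearW => n; apply: (@le_trans _ _ (u (maxn k n))); last by rewrite uc// leq_maxl.
by apply: ereal_inf_lbound; exists (maxn k n) => //=; rewrite leq_maxr.
Qed.

Section square_integrable.
Context d (T : measurableType d) (R : realType) (mu : {measure set T -> \bar R}).
Implicit Types f g : T -> R.
Local Notation N2 f := ('N[mu]_2%:E[EFin \o f])%E.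
Local Notation L2 := (Lfun mu 2%:E).

Definition nrm2 f : R := fine (N2 f).

(* No measurability: the integral of a nonnegative function is the supremum over the simple
   functions below it. *)
Lemma ge0_le_integral_nomeas (D : set T) (f g : T -> \bar R) :
  (forall x, D x -> 0 <= f x)%E -> (forall x, D x -> f x <= g x)%E ->
  (\int[mu]_(x in D) f x <= \int[mu]_(x in D) g x)%E.
Proof.
move=> f0 fg.
rewrite !ge0_integralE//; last by move=> x Dx; exact: le_trans (f0 _ Dx) (fg _ Dx).
apply: le_ereal_sup => _ /= [h hf <-]; exists h => // x; apply: le_trans (hf x) _.
by rewrite /patch; case: ifPn => // /set_mem /fg.
Qed.

(** Kept in the extended reals because it is also applied to the weighted history, which is not
    known to be measurable or of finite norm. *)
Lemma Lnorm2_sqr f : (N2 f ^+ 2 = \int[mu]_x ((f x) ^+ 2)%:E)%E.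
Proof.
have -> : (N2 f ^+ 2 = N2 f `^ 2)%E.
  case: (N2 f) (Lnorm_ge0 mu 2%:E (EFin \o f)) => [r| |]//= r0.
    by rewrite powR_mulrn// EFin_expe.
  by rewrite ?mulyy; case: eqVneq => // /eqP; rewrite pnatr_eq0.
rewrite poweR_Lnorm//; by apply: eq_integral => x _ /=; rewrite powR_mulrn ?normr_ge0// real_normK ?num_real.
Qed.

Lemma L2_mfun f : f \in L2 -> measurable_fun setT f.
Proof. by rewrite inE => /andP[/[!inE]]. Qed.

Lemma L2_fin f : f \in L2 -> N2 f \is a fin_num.
Proof. by rewrite inE => /andP[_ /[!inE]/= h]; rewrite ge0_fin_numE// Lnorm_ge0. Qed.

Lemma nrm2_ge0 f : 0 <= nrm2 f.
Proof. by rewrite fine_ge0// Lnorm_ge0. Qed.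

Lemma nrm2_sqrE f : f \in L2 -> ((nrm2 f ^+ 2)%:E = \int[mu]_x ((f x) ^+ 2)%:E)%E.
Proof. by move=> /L2_fin h; rewrite -Lnorm2_sqr EFin_expe fineK. Qed.

Lemma nrm2_le f (c : R) : 0 <= c -> measurable_fun setT f ->
  (\int[mu]_x ((f x) ^+ 2)%:E <= (c ^+ 2)%:E)%E -> f \in L2 /\ nrm2 f <= c.
Proof.
move=> c0 mf; rewrite -Lnorm2_sqr => h.
have hc : (N2 f <= c%:E)%E.
  move: h; case: (N2 f) (Lnorm_ge0 mu 2%:E (EFin \o f)) => [r| |]//=.
    by rewrite !lee_fin => r0; rewrite -expr2 ler_pXn2r// nnegrE.
have fL : f \in L2.
  rewrite inE; apply/andP; split; rewrite inE//=.
  exact: le_lt_trans hc (ltry _).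
by split=> //; rewrite -lee_fin fineK// L2_fin.
Qed.

Lemma L2_mfunP f : f \in L2 <->
  measurable_fun setT f /\ (\int[mu]_x ((f x) ^+ 2)%:E < +oo)%E.
Proof.
split=> [fL|[mf fo]].
  by split; [exact: L2_mfun|rewrite -nrm2_sqrE// ltry].
have f0 : (0 <= \int[mu]_x ((f x) ^+ 2)%:E)%E.
  by apply: integral_ge0 => x _; rewrite lee_fin sqr_ge0.
have [] := @nrm2_le f (Num.sqrt (fine (\int[mu]_x ((f x) ^+ 2)%:E)%E)) _ mf _ => //.
by rewrite sqr_sqrtr ?fine_ge0// fineK// ge0_fin_numE.
Qed.

Lemma L2_0 : (0 : T -> R) \in L2.
Proof.
apply/L2_mfunP; split; first exact: measurable_cst.
by under eq_integral do rewrite /= expr0n; rewrite integral0.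
Qed.

Lemma nrm2D f g : f \in L2 -> g \in L2 -> f + g \in L2 /\ nrm2 (f + g) <= nrm2 f + nrm2 g.
Proof.
move=> fL gL.
have h : (N2 (f + g)%R <= N2 f + N2 g)%E.
  by apply: minkowski_EFin; [exact: L2_mfun|exact: L2_mfun|exact: ler1n].
have fgL : f + g \in L2.
  rewrite inE; apply/andP; split; rewrite inE//=.
    by apply: measurable_funD; exact: L2_mfun.
  by apply: le_lt_trans h _; rewrite lte_add_pinfty// -ge0_fin_numE ?Lnorm_ge0 ?L2_fin.
split=> //; rewrite -lee_fin EFinD !fineK ?L2_fin//.
Qed.

Lemma nrm2Z (a : R) f : f \in L2 -> a *: f \in L2 /\ nrm2 (a *: f) = `|a| * nrm2 f.
Proof.
move=> fL; have mf := L2_mfun fL.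
have h : (\int[mu]_x (((a *: f) x) ^+ 2)%:E = ((`|a| * nrm2 f) ^+ 2)%:E)%E.
  under eq_integral do rewrite /= /GRing.scale/= exprMn EFinM.
  rewrite ge0_integralZl_EFin ?sqr_ge0//; last 2 first.
  - by move=> x _; rewrite lee_fin sqr_ge0.
  - by apply/measurable_EFinP; exact: measurable_funX.
  by rewrite -nrm2_sqrE// -EFinM exprMn real_normK ?num_real.
have maf : measurable_fun setT (a *: f) by apply: measurable_funM => //; exact: measurable_cst.
have c0 : 0 <= `|a| * nrm2 f by rewrite mulr_ge0// nrm2_ge0.
have [aL _] : a *: f \in L2 /\ nrm2 (a *: f) <= `|a| * nrm2 f.
  by apply: nrm2_le => //; rewrite h.
split=> //; apply/eqP; rewrite -(@eqrXn2 _ 2)// ?nrm2_ge0//; apply/eqP.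
by apply: EFin_inj; rewrite nrm2_sqrE.
Qed.

Lemma L2Z (a : R) f : f \in L2 -> a *: f \in L2.
Proof. by move=> /(nrm2Z a)[]. Qed.

Lemma L2D f g : f \in L2 -> g \in L2 -> f + g \in L2.
Proof. by move=> /nrm2D h /h[]. Qed.

Lemma L2N f : f \in L2 -> - f \in L2.
Proof. by move=> /(L2Z (-1)); rewrite scaleN1r. Qed.

Lemma L2B f g : f \in L2 -> g \in L2 -> f - g \in L2.
Proof. by move=> hf hg; apply: L2D => //; exact: L2N. Qed.

Lemma nrm2_0 : nrm2 0 = 0.
Proof. by rewrite -[X in nrm2 X](scale0r 0) (nrm2Z 0 L2_0).2 normr0 mul0r. Qed.

Lemma nrm2_eq0 f : f \in L2 -> nrm2 f = 0 -> {ae mu, forall x, f x = 0}.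
Proof.
move=> fL f0.
have [] := @Lnorm_eq0_eq0 _ _ _ mu (EFin \o f) 2%:E.
- by apply/measurable_EFinP; exact: L2_mfun.
- by rewrite lte_fin.
- by rewrite -(fineK (L2_fin fL)) -/(nrm2 f) f0.
move=> A [mA muA sA]; exists A; split => // x /= nx; apply: sA => /= h.
by apply: nx; case: (h I).
Qed.

Lemma L2_ae f g : f \in L2 -> measurable_fun setT g -> {ae mu, forall x, f x = g x} ->
  g \in L2 /\ nrm2 g = nrm2 f.
Proof.
move=> fL mg fg; have mf := L2_mfun fL.
have E : (\int[mu]_x ((g x) ^+ 2)%:E = \int[mu]_x ((f x) ^+ 2)%:E)%E.
  apply: ge0_ae_eq_integral => //.
  - by apply/measurable_EFinP; exact: measurable_funX.
  - by apply/measurable_EFinP; exact: measurable_funX.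
  - by move=> x _; rewrite lee_fin sqr_ge0.
  - by move=> x _; rewrite lee_fin sqr_ge0.
  by apply: filterS fg => x /= -> _.
have gL : g \in L2 by apply/L2_mfunP; split=> //; rewrite E -nrm2_sqrE// ltry.
split=> //; apply/eqP; rewrite -(@eqrXn2 _ 2)// ?nrm2_ge0//; apply/eqP.
by apply: EFin_inj; rewrite !nrm2_sqrE.
Qed.

Lemma L2_mulr_integrable f g : f \in L2 -> g \in L2 ->
  mu.-integrable setT (EFin \o (fun x => f x * g x)).
Proof. by move=> fL gL; apply/Lfun1_integrable; exact: Lfun2_mul_Lfun1. Qed.

Lemma cauchy_schwarz f g : f \in L2 -> g \in L2 ->
  `|\int[mu]_x (f x * g x)| <= nrm2 f * nrm2 g.
Proof.
move=> fL gL; have iFG := L2_mulr_integrable fL gL.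
apply: le_trans (le_normr_Rintegral _ iFG) _ => //.
have : ('N[mu]_1[EFin \o (f \* g)%R] <= N2 f * N2 g)%E.
  by apply: hoelder => //; [exact: L2_mfun|exact: L2_mfun|rewrite [RHS]splitr !div1r].
have h : (\int[mu]_x `|f x * g x|%:E)%E \is a fin_num.
  by move/integrableP : iFG => [_ h]; rewrite ge0_fin_numE// integral_ge0.
by rewrite Lnorm1 -lee_fin EFinM !fineK ?L2_fin.
Qed.

(** The series [S] with weights 4^k has integral at most the sum of 4^k (c 4^-k)^2 = c^2 4^-k, so it
    is finite a.e. Where it is finite, the k-th increment is at most sqrt(S) 2^-k and the sequence
    converges; Fatou's lemma then bounds the distance to the pointwise limit. *)
Lemma L2_complete (u : nat -> T -> R) (c : R) : 0 <= c -> (forall k, u k \in L2) ->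
  (forall k, nrm2 (u k.+1 - u k) <= c * 4^-1 ^+ k) ->
  exists2 v, v \in L2 & forall k, nrm2 (v - u k) <= 2 * c * 4^-1 ^+ k.
Proof.
move=> c0 uL uc.
have dL k l : u k - u l \in L2 by exact: L2B.
have ukl k l : (k <= l)%N -> nrm2 (u l - u k) <= 2 * c * 4^-1 ^+ k.
  apply: (@geometric_telescope _ (fun k l => nrm2 (u l - u k))) => //.
    by move=> j; rewrite subrr nrm2_0.
  move=> i j ij; have -> : u j.+1 - u i = (u j - u i) + (u j.+1 - u j).
    by rewrite [RHS]addrC addrA subrK.
  by have [_ h] := nrm2D (dL j i) (dL j.+1 j); apply: le_trans h _; rewrite lerD2l.
pose S x := (\sum_(0 <= k <oo) (4 ^+ k * (u k.+1 x - u k x) ^+ 2)%:E)%E.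
have mS k : measurable_fun setT (fun x => (4 ^+ k * (u k.+1 x - u k x) ^+ 2)%:E).
  apply/measurable_EFinP; apply: measurable_funM => //.
  by apply: measurable_funX; exact: L2_mfun (dL _ _).
have S0 k x : (0 <= (4 ^+ k * (u k.+1 x - u k x) ^+ 2)%:E)%E.
  by rewrite lee_fin; apply: mulr_ge0; [exact: exprn_ge0|exact: sqr_ge0].
have mSS : measurable_fun setT S by apply: ge0_emeasurable_sum => // k x _; exact: S0.
have intS : (\int[mu]_x S x < +oo)%E.
  rewrite integral_nneseries//.
  apply: (@le_lt_trans _ _ (\sum_(0 <= k <oo) (c ^+ 2 * 4^-1 ^+ k)%:E)%E).
    apply: lee_nneseries => k.
      by move=> _ _; apply: integral_ge0 => x _; exact: S0.
    move=> _; under eq_integral do rewrite EFinM.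
    rewrite ge0_integralZl_EFin ?exprn_ge0//; last 2 first.
    - by move=> x _; rewrite lee_fin sqr_ge0.
    - by apply/measurable_EFinP; apply: measurable_funX; exact: L2_mfun (dL _ _).
    rewrite -(nrm2_sqrE (dL k.+1 k)) -EFinM lee_fin.
    have : nrm2 (u k.+1 - u k) ^+ 2 <= (c * 4^-1 ^+ k) ^+ 2.
      by rewrite ler_pXn2r// nnegrE ?nrm2_ge0// mulr_ge0// exprn_ge0.
    move=> /(ler_wpM2l (exprn_ge0 k (ler0n R 4))) /le_trans; apply.
    have e : 4 ^+ k * 4^-1 ^+ k = 1 :> R by rewrite -exprMn divff ?pnatr_eq0// expr1n.
    have -> : 4 ^+ k * (c * 4^-1 ^+ k) ^+ 2 = c ^+ 2 * 4^-1 ^+ k * (4 ^+ k * 4^-1 ^+ k) by ring.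
    by rewrite e mulr1.
  have -> : (\sum_(0 <= k <oo) (c ^+ 2 * 4^-1 ^+ k)%:E =
     (limn (series (geometric (c ^+ 2) 4^-1)))%:E)%E.
    rewrite -EFin_lim; last first.
      by apply: is_cvg_geometric_series; rewrite gtr0_norm ?invr_gt0// invf_lt1// ltr1n.
    by congr (limn _); apply/funext => n; rewrite /series/= sumEFin.
  exact: ltry.
have aeS : {ae mu, forall x, S x \is a fin_num}.
  have : mu.-integrable setT S.
    apply/integrableP; split=> //.
    under eq_integral do rewrite gee0_abs ?nneseries_ge0//.
    by [].
  move/(integrable_ae measurableT); apply: filterS => x; exact.
have aec : {ae mu, forall x, cvgn (fun k => u k x)}.
  apply: filterS aeS => x Sx.
  have Sx0 : 0 <= fine (S x) by rewrite fine_ge0// nneseries_ge0.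
  apply: (@cvg_geometric_increments _ _ (Num.sqrt (fine (S x)))) => k.
  rewrite -(@ler_pXn2r _ 2)// ?nnegrE ?mulr_ge0// ?sqrtr_ge0 ?exprn_ge0//.
  rewrite real_normK ?num_real// exprMn sqr_sqrtr//.
  have h : (4 ^+ k * (u k.+1 x - u k x) ^+ 2) <= fine (S x).
    rewrite -lee_fin fineK//.
    apply: le_trans (nneseries_lim_ge k.+1 _) => //.
    rewrite big_nat_recr//= leeDr//.
    by apply: sume_ge0 => i _; exact: S0.
  rewrite -exprM mulnC exprM.
  have -> : 2^-1 ^+ 2 = 4^-1 :> R by rewrite exprVn -natrX.
  by rewrite exprVn ler_pdivlMr ?exprn_gt0// mulrC.
(* The upper limit is measurable on the whole space and agrees with the limit wherever the latter
   exists; its values on the exceptional null set do not affect the integrals. *)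
pose v x := fine (limn_esup (fun k => (u k x)%:E)).
have mv : measurable_fun setT v.
  apply: measurableT_comp => //; apply: measurable_fun_limn_esup => k.
  by apply/measurable_EFinP; exact: L2_mfun.
have aev : {ae mu, forall x, (fun k => u k x) @ \oo --> v x}.
  apply: filterS aec => x xc.
  have h : (fun k => (u k x)%:E) @ \oo --> (limn (fun k => u k x))%:E.
    by apply/cvg_EFin => //; exact: nearW.
  by rewrite /v (cvg_limn_einf_sup h).2.
have main k : v - u k \in L2 /\ nrm2 (v - u k) <= 2 * c * 4^-1 ^+ k.
  apply: nrm2_le.
  - by rewrite !mulr_ge0// exprn_ge0.
  - by apply: measurable_funB => //; exact: L2_mfun.
  have -> : (\int[mu]_x ((v - u k) x ^+ 2)%:E =
     \int[mu]_x (limn_einf (fun l => ((u l x - u k x) ^+ 2)%:E)))%E.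
    apply: ge0_ae_eq_integral => //.
    - apply/measurable_EFinP; apply: measurable_funX; apply: measurable_funB => //.
      exact: L2_mfun.
    (* Measurability of the lower limit is obtained from that of the upper limit by changing
       signs. *)
    - have -> : (fun x => limn_einf (fun l => ((u l x - u k x) ^+ 2)%:E)) =
          (fun x => - limn_esup (fun l => (- ((u l x - u k x) ^+ 2)%:E)%E))%E.
        by apply/funext => x; rewrite -limn_einfN; congr limn_einf; apply/funext => l/=; rewrite opprK.
      apply: measurableT_comp => //; apply: measurable_fun_limn_esup => l.
      apply: measurableT_comp => //; apply/measurable_EFinP.
      by apply: measurable_funX; exact: L2_mfun (dL _ _).
    - by move=> x _; rewrite lee_fin sqr_ge0.
    - move=> x _; apply: limn_einf_ge0 => l; by rewrite lee_fin sqr_ge0.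
    apply: filterS aev => x xv _.
    have h : (fun l => ((u l x - u k x) ^+ 2)%:E) @ \oo --> ((v x - u k x) ^+ 2)%:E.
      apply/cvg_EFin; first exact: nearW.
      by apply: cvgM; apply: cvgB => //; exact: cvg_cst.
    by rewrite (cvg_limn_einf_sup h).1.
  apply: le_trans (fatou _ _ _ _) _ => //.
  - move=> l; apply/measurable_EFinP; apply: measurable_funX; exact: L2_mfun (dL _ _).
  - by move=> l x _; rewrite lee_fin sqr_ge0.
  have : (limn_einf (fun l => \int[mu]_x ((u l x - u k x) ^+ 2)%:E) <= ((2 * c * 4^-1 ^+ k) ^+ 2)%:E)%E.
    (* The bound on [u l - u k] holds once l is at least k, which is all that a lower limit sees. *)
    apply: (@limn_einf_le _ _ _ k) => l kl.
    rewrite -(nrm2_sqrE (dL l k)) lee_fin ler_pXn2r ?nnegrE ?nrm2_ge0 ?ukl//.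
    by rewrite !mulr_ge0// exprn_ge0.
  exact.
exists v => [|k]; last exact: (main k).2.
by rewrite -[v](subrK (u 0%N)); apply: L2D => //; exact: (main 0%N).1.
Qed.

End square_integrable.

(** * Lebesgue measure on R^n *)

Section rV_sets.
Context (R : realType) (n : nat).
Local Notation X := 'rV[R]_n.

Definition box (a b : 'I_n -> R) : set X := [set x | forall i, x 0 i \in `]a i, b i]].

Lemma measurable_coord_preimage (i : 'I_n) (Y : set (measurableTypeR R)) :
  measurable Y -> measurable [set x : X | Y (x 0 i)].
Proof. by move=> mY; rewrite -[X in measurable X]setTI; exact: measurable_coord. Qed.

Lemma measurable_forall_coord (Y : 'I_n -> set (measurableTypeR R)) :
  (forall i, measurable (Y i)) -> measurable [set x : X | forall i, Y i (x 0 i)].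
Proof.
move=> mY; rewrite (_ : mkset _ = \bigcap_(i in [set: 'I_n]) [set x : X | Y i (x 0 i)]).
  by apply: fin_bigcap_measurable => // i _; exact: measurable_coord_preimage.
by apply/seteqP; split=> x /= h i => [_|]; exact: h.
Qed.

Lemma measurable_box a b : measurable (box a b).
Proof. exact: (@measurable_forall_coord (fun i => `]a i, b i]%classic)). Qed.

Lemma rat_rV_near (x : X) (e : R) : 0 < e ->
  exists q : 'rV[rat]_n, forall i, `|x 0 i - ratr (q 0 i)| < e.
Proof.
move=> e0.
have /choice[q hq] (i : 'I_n) : exists q : rat, `|x 0 i - ratr q| < e.
  have [|q] := @rat_in_itvoo R (x 0 i - e) (x 0 i + e); first lra.
  by rewrite in_itv/= => /andP[q1 q2]; exists q; rewrite ltr_norml; apply/andP; split; lra.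
by exists (\row_i q i) => i; rewrite mxE.
Qed.

(** The sigma-algebra is generated by coordinates, so an open set has to be written as a countable
    union: it is the union of the cubes with rational centre and radius that it contains. *)
Lemma open_measurable_rV (A : set X) : open A -> measurable A.
Proof.
move=> oA.
pose B (p : 'rV[rat]_n * rat) : set X :=
  [set x | forall i, `|x 0 i - ratr (p.1 0 i)| < ratr p.2].
pose C p := if `[< B p `<=` A >] then B p else set0.
suff -> : A = \bigcup_p C p.
  apply: countable_bigcupT_measurable; first exact: countableP.
  move=> p; rewrite /C; case: ifPn => // _.
  apply: (@measurable_forall_coord (fun i => [set t | `|t - ratr (p.1 0 i)| < ratr p.2])) => i.
  rewrite (_ : mkset _ = `]ratr (p.1 0 i) - ratr p.2, ratr (p.1 0 i) + ratr p.2[%classic).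
    exact: measurable_itv.
  apply/seteqP; split=> t /=; rewrite in_itv/= ltr_norml.
    by move=> /andP[? ?]; apply/andP; split; lra.
  by move=> /andP[? ?]; apply/andP; split; lra.
apply/seteqP; split=> [x Ax|x [p _]]; last first.
  by rewrite /C; case: ifPn => // /asboolP h /h.
have /nbhs_ballP[e /= e0 xeA] : nbhs x A by move: oA; rewrite openE => /(_ _ Ax).
have [|r] := @rat_in_itvoo R 0 (e / 2); first by rewrite divr_gt0.
rewrite in_itv/= => /andP[r0 re].
have [q qx] := rat_rV_near x r0.
exists (q, r) => //; rewrite /C; case: ifPn => // /asboolPn[] => y yq.
apply: xeA; split=> // i j; rewrite (ord1 i) /ball/=.
rewrite (_ : x 0 j - y 0 j = (x 0 j - ratr (q 0 j)) - (y 0 j - ratr (q 0 j))); last by lra.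
apply: le_lt_trans (ler_normB _ _) _.
have := qx j; have /= := yq j; lra.
Qed.

Lemma continuous_measurable_rV (f : X -> R) : continuous f -> measurable_fun setT f.
Proof.
move=> cf; apply: (measurability _ (RGenOInfty.measurableE R)).
move=> _ [_ [a ->] <-]; rewrite setTI; apply: open_measurable_rV.
move/continuousP : cf; apply; exact: interval_open.
Qed.

Lemma boxI a b a' b' : box a b `&` box a' b' =
  box (fun i => Num.max (a i) (a' i)) (fun i => Num.min (b i) (b' i)).
Proof.
apply/seteqP; split=> x /=.
  move=> [h h'] i; move: (h i) (h' i); rewrite !in_itv/=.
  by rewrite gt_max le_min => /andP[-> ->] /andP[-> ->].
move=> h; split=> i; move: (h i); rewrite !in_itv/= gt_max le_min.
  by move=> /andP[/andP[-> _] /andP[-> _]].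
by move=> /andP[/andP[_ ->] /andP[_ ->]].
Qed.

Definition cube (N : nat) : set X := box (fun=> - N%:R) (fun=> N%:R).

Lemma le_mx_coord (x : X) i : `|x 0 i| <= `|x|.
Proof.
rewrite /Num.norm/= mx_normrE; apply: le_trans (le_bigmax _ _ (ord0, i)).
by [].
Qed.

Lemma cube_mem (x : X) (N : nat) : `|x| < N%:R -> cube N x.
Proof.
move=> xN i; have := le_lt_trans (le_mx_coord x i) xN.
by rewrite ltr_norml in_itv/= => /andP[-> /ltW].
Qed.

Lemma bigcup_cube : \bigcup_N cube N = [set: X].
Proof.
apply/seteqP; split=> // x _; exists (Num.truncn `|x|).+1 => //.
by apply: cube_mem; exact: truncnS_gt.
Qed.

Lemma measurable_box_gen : @measurable _ X = <<s [set A | exists a b, A = box a b] >>.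
Proof.
apply/seteqP; split; last first.
  apply: smallest_sub; first exact: sigma_algebra_measurable.
  by move=> _ [a [b ->]]; exact: measurable_box.
apply: smallest_sub; first exact: smallest_sigma_algebra.
move=> A; rewrite -bigcup_seq => -[i _ [Y mY <-]]; rewrite setTI.
pose G := [set A : set X | exists a b, A = box a b].
suff H : @measurable_fun _ _ (g_sigma_algebraType G) (measurableTypeR R) setT (fun x => x 0 i).
  by have := H measurableT _ mY; rewrite setTI.
apply: (measurability _ (RGenOInfty.measurableE R)).
move=> _ [_ [a ->] <-]; rewrite setTI.
(* The half-space a < x_i is exhausted by boxes with lower side a in direction i and all other sides
   growing with [N]. *)
rewrite (_ : _ @^-1` _ = \bigcup_N box (fun j => if j == i then a else - N%:R) (fun=> N%:R)).
  by apply: (@bigcup_measurable _ (g_sigma_algebraType G)) => N _; apply: sub_sigma_algebra; do 2 eexists.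
apply/seteqP; split=> x /=; rewrite in_itv/= andbT.
  move=> ax; exists (Num.truncn `|x|).+1 => // j.
  have := cube_mem (truncnS_gt `|x|) j; rewrite !in_itv/=.
  by case: eqP => // -> /andP[_ ->]; rewrite ax.
by move=> [N _ /(_ i)]; rewrite in_itv/= eqxx => /andP[].
Qed.

(** Boxes generate the sigma-algebra and are stable under intersection, and the cubes are boxes of
    finite measure that exhaust the space. *)
Lemma rV_measure_unique (m1 m2 : {measure set X -> \bar R}) :
  (forall a b, m1 (box a b) = m2 (box a b)) -> (forall N, m1 (cube N) < +oo)%E ->
  forall A, measurable A -> m1 A = m2 A.
Proof.
move=> m12 mfin A mA.
apply: (measure_unique _ cube measurable_box_gen) => //.
- move=> _ _ [a [b ->]] [a' [b' ->]]; rewrite boxI; by do 2 eexists.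
- by move=> N; do 2 eexists.
- exact: bigcup_cube.
- by move=> _ [a [b ->]].
Qed.

(** The volume formula asks for ordered endpoints; boxes with a reversed side are empty and are
    treated apart. *)
Lemma box_le_dec a b : (forall i, a i <= b i) \/ box a b = set0.
Proof.
have [h|] := pselect (forall i, a i <= b i); [by left|].
move=> /existsNP[i /negP]; rewrite -ltNge => ba; right.
apply/seteqP; split=> // x /(_ i); rewrite in_itv/= => /andP[h1 h2].
lra.
Qed.

End rV_sets.

Section lebesgue_rV_translation.
Context (R : realType) (n : nat).
Local Notation X := 'rV[R]_n.
Local Notation leb := (@lebesgue_rV R n).

Lemma leb_cube N : (leb (cube N) < +oo)%E.
Proof. by rewrite /cube lebesgue_rV_box ?ltry// => i; have := ler0n R N; lra. Qed.

Lemma measurable_translate (c : X) : measurable_fun setT (fun x : X => x + c).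
Proof.
apply: measurable_fun_rV => i; under eq_fun do rewrite mxE.
by apply: measurable_funD; [exact: measurable_coord|exact: measurable_cst].
Qed.

Lemma leb_translate (c : X) (A : set X) : measurable A ->
  leb ((fun x => x + c) @^-1` A) = leb A.
Proof.
move=> mA; have mc := measurable_translate c.
pose m := measure_function_pushforward__canonical__measure_function_Measure leb mc.
have pre a b : (fun x => x + c) @^-1` box a b = box (fun i => a i - c 0 i) (fun i => b i - c 0 i).
  apply/seteqP; split=> x /= h i; move: (h i); rewrite !in_itv/= mxE => /andP[? ?];
    by apply/andP; split; lra.
have E a b : leb ((fun x => x + c) @^-1` box a b) = leb (box a b).
  rewrite pre; have [ab|b0] := box_le_dec a b.
    rewrite !lebesgue_rV_box//; last by move=> i; rewrite lerB.
    by congr (_%:E); apply: eq_bigr => i _; lra.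
  rewrite b0 measure0 (_ : box _ _ = set0) ?measure0// -pre b0 preimage_set0//.
change (m A = leb A).
apply: rV_measure_unique.
- by move=> a b; exact: E.
- by move=> N; rewrite /m /= /pushforward E leb_cube.
- exact: mA.
Qed.

Lemma Rintegral_translate (c : X) (f : X -> R) : measurable_fun setT f ->
  leb.-integrable setT (EFin \o (fun x => f (x + c))) ->
  \int[leb]_x f (x + c) = \int[leb]_x f x.
Proof.
move=> mf ifc; rewrite /Rintegral; congr fine.
pose m := measure_function_pushforward__canonical__measure_function_Measure leb (measurable_translate c).
transitivity (\int[m]_x (f x)%:E)%E.
  by rewrite integral_pushforward//; [exact: measurable_translate|exact/measurable_EFinP].
by apply: eq_measure_integral => A mA _; exact: leb_translate.
Qed.

End lebesgue_rV_translation.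

(** * Difference quotients and integrals of derivatives on R^n *)

Section calculus.
Context (R : realType) (n : nat).
Local Notation X := 'rV[R]_n.+1.
Local Notation leb := (@lebesgue_rV R n.+1).

Lemma is_derive_line (g : X -> R) (x v : X) (t : R) : derivable g (x + t *: v) v ->
  is_derive t 1 (fun t => g (x + t *: v)) ('D_v g (x + t *: v)).
Proof.
move=> dg.
have E : (fun h : R => h^-1 *: (((fun t => g (x + t *: v)) \o shift t) (h *: 1) - g (x + t *: v)))
       = (fun h : R => h^-1 *: ((g \o shift (x + t *: v)) (h *: v) - g (x + t *: v))).
  apply/funext => h /=; congr (_ *: (g _ - _)).
  have -> : h *: (1 : R) = h by rewrite /GRing.scale/= mulr1.
  by rewrite scalerDl addrCA.
by split; [rewrite /derivable E|rewrite /derive E].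
Qed.

Lemma increment_le (g : X -> R) (v : X) (B : R) : (forall x, derivable g x v) ->
  (forall x, `|'D_v g x| <= B) ->
  forall x (h : R), 0 < h -> `|g (x + h *: v) - g x| <= B * h.
Proof.
move=> dg gB x h h0.
have D (t : R) : is_derive t (1:R) (fun t => g (x + t *: v)) ('D_v g (x + t *: v)) by exact: is_derive_line.
have cD : {within `[0, h], continuous (fun t => g (x + t *: v))}.
  apply: continuous_subspaceT => t; apply/differentiable_continuous/derivable1_diffP.
  by have [] := D t.
have [c _] := MVT h0 (fun t _ => D t) cD.
rewrite scale0r addr0 => ->; rewrite normrM subr0 (gtr0_norm h0).
by rewrite ler_wpM2r// ltW.
Qed.

(** The increments 1/(k+1) turn the derivative into a limit of a sequence, the form that dominated
    convergence takes. *)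
Lemma derivable_seq (g : X -> R) (x v : X) : derivable g x v ->
  (fun k : nat => k.+1%:R * (g (x + k.+1%:R^-1 *: v) - g x)) @ \oo --> 'D_v g x.
Proof.
move=> dg.
have H : (@harmonic R) @ \oo --> (0 : R)^'.
  move=> A hA.
  have : \forall k \near \oo, (@harmonic R k != 0 -> A (@harmonic R k)) := @cvg_harmonic R _ hA.
  by apply: filterS => k; apply; rewrite /harmonic/= invr_eq0 pnatr_eq0.
have := cvg_comp _ _ H dg; rewrite /comp/=; apply: cvg_trans.
apply: near_eq_cvg; apply: nearW => k /=.
by rewrite invrK [_ + x]addrC.
Qed.

Definition vanish_outside (N : nat) (g : X -> R) := forall x, N%:R < `|x| -> g x = 0.

Lemma compact_ball (N : nat) : compact [set x : X | `|x| <= N%:R].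
Proof.
apply: bounded_closed_compact.
  exists N%:R; split; first exact: num_real.
  by move=> M NM x /= xN; apply: le_trans xN _; exact: ltW.
rewrite (_ : mkset _ = (@Num.norm _ X) @^-1` [set t | t <= N%:R])//.
by apply: closed_comp; [move=> x _; exact: norm_continuous|exact: closed_le].
Qed.

Lemma compact_vanish_outside (K : set X) (g : X -> R) : compact K ->
  (forall x, ~ K x -> g x = 0) -> exists N, vanish_outside N g.
Proof.
move=> /compact_bounded[M [_ KM]] gK.
exists (Num.truncn (`|M| + 1)).+1 => x xN; apply: gK => /(KM (`|M| + 1)).
rewrite /= => h; have := lt_trans (truncnS_gt _) xN; rewrite ltNge h//.
by apply: le_lt_trans (ler_norm _) _; rewrite ltrDl.
Qed.

Lemma continuous_vanish_bounded N (g : X -> R) : continuous g -> vanish_outside N g ->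
  exists B : R, forall x, `|g x| <= B.
Proof.
move=> cg gN.
have /compact_bounded [M [_ hM]] : compact (g @` [set x : X | `|x| <= N%:R]).
  by apply: continuous_compact; [exact: continuous_subspaceT|exact: compact_ball].
exists (Num.max 0 (M + 1)) => x; have [xN|xN] := leP `|x| N%:R.
  rewrite le_max; apply/orP; right; apply: hM; [by rewrite ltrDl|by exists x].
by rewrite gN// normr0 le_max lexx.
Qed.

Lemma bounded_vanish_L2 N (g : X -> R) B : measurable_fun setT g -> vanish_outside N g ->
  (forall x, `|g x| <= B) -> g \in Lfun leb 2%:E /\ leb.-integrable setT (EFin \o g).
Proof.
move=> mg gN gB.
have B0 : 0 <= B by apply: le_trans (gB 0); exact: normr_ge0.
(* One unit larger than [N], since [g] may be nonzero on the sphere of radius N and the half-open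
   cube of half-side N omits part of it. *)
have mC : measurable (@cube R n.+1 N.+1) by exact: measurable_box.
have gC x : ~ cube N.+1 x -> g x = 0.
  move=> nC; apply: gN; rewrite ltNge; apply/negP => xN; apply: nC; apply: cube_mem.
  by apply: le_lt_trans xN _; rewrite ltr_nat.
have ind (h : X -> R) (D : R) : measurable_fun setT h -> (forall x, ~ cube N.+1 x -> h x = 0) ->
    (forall x, `|h x| <= D) -> leb.-integrable setT (EFin \o h).
  move=> mh hC hD.
  have -> : EFin \o h = (EFin \o h) \_ (cube N.+1).
    apply/funext => x; rewrite /patch; case: ifPn => // /negP/= hx; rewrite hC//.
    by move=> cx; apply: hx; rewrite inE.
  rewrite -integrable_restrict// setTI.
  apply: measurable_bounded_integrable => //; first exact: leb_cube.
    exact: measurable_funTS.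
  exists D; split; first exact: num_real.
  by move=> M DM x _; apply: le_trans (hD x) _; exact: ltW.
split; last exact: ind gB.
apply/L2_mfunP; split=> //.
have /integrableP[_] : leb.-integrable setT (EFin \o (fun x => g x ^+ 2)).
  apply: (ind _ (B ^+ 2)).
  - exact: measurable_funX.
  - by move=> x /gC ->; rewrite expr0n.
  - by move=> x; rewrite normrX ler_pXn2r ?nnegrE.
apply: le_lt_trans; apply: ge0_le_integral_nomeas => x _ /=.
  by rewrite lee_fin sqr_ge0.
by rewrite lee_fin ler_norm.
Qed.

Lemma derive_vanish N (g : X -> R) v : vanish_outside N g -> vanish_outside N (fun x => 'D_v g x).
Proof.
move=> gN x xN; rewrite (@near_eq_derive _ _ _ g (cst 0)) ?derive_cst//.
have : open [set y : X | N%:R < `|y|].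
  rewrite (_ : mkset _ = (@Num.norm _ X) @^-1` [set t | N%:R < t])//.
  by apply: open_comp; [move=> y _; exact: norm_continuous|exact: open_gt].
by rewrite openE => /(_ _ xN); apply: filterS => y /= /gN.
Qed.

(** By translation invariance each difference quotient has integral zero, and the quotients converge
    to the derivative under a common integrable bound. *)
Lemma Rintegral_derive0 N (g : X -> R) (v : X) : continuous g -> (forall x, derivable g x v) ->
  continuous (fun x => 'D_v g x) -> vanish_outside N g -> \int[leb]_x 'D_v g x = 0.
Proof.
move=> cg dg cdg gN.
have dgN := derive_vanish v gN.
have [B gB] := continuous_vanish_bounded cdg dgN.
have B0 : 0 <= B by apply: le_trans (gB 0); exact: normr_ge0.
have [C gC] := continuous_vanish_bounded cg gN.
have mg := continuous_measurable_rV cg.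
have [_ ig] := bounded_vanish_L2 mg gN gC.
have [V vV] : exists V : nat, `|v| <= V%:R.
  by exists (Num.truncn `|v|).+1; apply/ltW; exact: truncnS_gt.
have shN (k : nat) : vanish_outside (N + V) (fun x => g (x + k.+1%:R^-1 *: v)).
  move=> x; rewrite natrD => xN; apply: gN.
  have h1 : `|k.+1%:R^-1 *: v| <= V%:R.
    rewrite normrZ; apply: le_trans vV; rewrite ler_piMl// ger0_norm ?invr_ge0//.
    by rewrite invf_le1// ler1n.
  have := lerB_normD x (k.+1%:R^-1 *: v); lra.
have msh (k : nat) : measurable_fun setT (fun x : X => g (x + k.+1%:R^-1 *: v)).
  exact: measurableT_comp (measurable_translate _).
have ish k : leb.-integrable setT (EFin \o (fun x : X => g (x + k.+1%:R^-1 *: v))).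
  by have [] := bounded_vanish_L2 (msh k) (shN k) (fun x => gC _).
pose q (k : nat) (x : X) : R := k.+1%:R * (g (x + k.+1%:R^-1 *: v) - g x).
have iB (k : nat) : leb.-integrable setT (EFin \o (fun x : X => g (x + k.+1%:R^-1 *: v) - g x)).
  exact: (integrableB measurableT (ish k) ig).
have q0 k : \int[leb]_x q k x = 0.
  rewrite /q RintegralZl//.
  by rewrite RintegralB// Rintegral_translate// subrr mulr0.
have mq k : measurable_fun setT (q k).
  by apply: measurable_funM => //; apply: measurable_funB.
(* On this ball the mean value theorem bounds the quotients by B. Outside it both [x] and
   [x + v / (k+1)] lie beyond radius N, because V bounds the displacement, and the quotient
   vanishes. *)
pose G (x : X) : R := if `|x| <= (N + V)%:R then B else 0.
have mG : measurable_fun setT G.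
  apply: measurable_fun_ifT => //.
  by apply: measurable_fun_ler => //; apply: continuous_measurable_rV; exact: norm_continuous.
have G0 x : 0 <= G x by rewrite /G; case: ifP.
have iG : leb.-integrable setT (EFin \o G).
  apply: (bounded_vanish_L2 (N := N + V) (B := B) mG _ _).2.
    by move=> x xN; rewrite /G leNgt xN.
  by move=> x; rewrite ger0_norm// /G; case: ifP.
have qG k x : `|q k x| <= G x.
  rewrite /G; case: (leP `|x| (N + V)%:R) => xN; last first.
    have h0 : g (x + k.+1%:R^-1 *: v) = 0 := shN k x xN.
    rewrite /q h0 gN ?subrr ?mulr0 ?normr0//.
    by apply: le_lt_trans xN; rewrite ler_nat leq_addr.
  rewrite normrM ger0_norm// mulrC -ler_pdivlMr//.
  by apply: increment_le => //; rewrite invr_gt0.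
have [_ _] : [/\ leb.-integrable setT (EFin \o (fun x => 'D_v g x)),
    [sequence (\int[leb]_(x in setT) `|(q k x)%:E - ('D_v g x)%:E|)%E]_k @ \oo --> 0%E &
    [sequence (\int[leb]_(x in setT) (q k x)%:E)%E]_k @ \oo --> (\int[leb]_x ('D_v g x)%:E)%E].
  apply: (@dominated_convergence _ _ _ leb setT measurableT _ _ (EFin \o G)) => //.
  - by move=> k; exact/measurable_EFinP.
  - by apply/measurable_EFinP; exact: continuous_measurable_rV.
  - apply: aeW => x _; apply/cvg_EFin; first exact: nearW.
    exact: derivable_seq.
  - by apply: aeW => x k _; rewrite lee_fin qG.
rewrite (_ : [sequence _]_k = cst 0%E).
  by move/cvg_lim => /(_ (@ereal_hausdorff R)); rewrite lim_cst// /Rintegral => <-.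
apply/funext => k /=.
have iq : leb.-integrable setT (EFin \o q k) by exact: (integrableZl measurableT _ (iB k)).
by rewrite -[LHS]fineK ?integrable_fin_num// -/(Rintegral _ _ _) q0.
Qed.

End calculus.

(** * Test functions and the fundamental lemma *)

Section flat.
Context (R : realType).
Implicit Types P Q : {poly R}.

(* This family is stable under derivation, see [flat'], so its members are smooth at 0. *)
Definition flat P (t : R) : R := if 0 < t then P.[t^-1] * expR (- t^-1) else 0.

(** With y = 1/t the claim reads |Q(y)| y <= K e^y, and the exponential dominates each y^(i+1) /
    (i+1)!, whence the factorials in K. *)
Lemma flat_le Q : exists K : R, forall t, `|flat Q t| <= K * `|t|.
Proof.
exists (\sum_(i < size Q) `|Q`_i| * (i.+1)`!%:R) => t; rewrite /flat.
case: ifPn => [t0|_]; last first.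
  by rewrite normr0 mulr_ge0// sumr_ge0// => i _; rewrite mulr_ge0.
set y := t^-1; have y0 : 0 < y by rewrite invr_gt0.
rewrite normrM (gtr0_norm (expR_gt0 _)) (gtr0_norm t0) expRN -ler_pdivrMr//.
rewrite mulrAC -/y ler_pdivrMr ?expR_gt0//.
apply: (@le_trans _ _ ((\sum_(i < size Q) `|Q`_i| * y ^+ i) * y)).
  rewrite ler_wpM2r ?(ltW y0)// horner_coef; apply: le_trans (ler_norm_sum _ _ _) _.
  by apply: ler_sum => i _; rewrite normrM normrX (gtr0_norm y0).
rewrite !mulr_suml; apply: ler_sum => i _.
rewrite -!mulrA ler_wpM2l// -exprSr.
have := @expR_ge1Dxn R y i (ltW y0).
have f0 : 0 < (i.+1)`!%:R :> R by rewrite ltr0n fact_gt0.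
by move=> h; rewrite -ler_pdivrMl// mulrC; lra.
Qed.

(** The difference quotient of [flat P] at 0 is [flat ('X * P)], a function of the same kind, which
    tends to 0 by [flat_le]. *)
Lemma flat0P P : is_derive (0 : R) (1 : R) (flat P) 0.
Proof.
have [K hK] := flat_le ('X * P).
suff H : (fun h : R => h^-1 *: ((flat P \o shift 0) (h *: (1 : R)) - flat P 0)) @ (0 : R)^' --> (0 : R).
  by split; [apply/cvg_ex; exists 0|apply/cvg_lim].
have E : (fun h : R => h^-1 *: ((flat P \o shift 0) (h *: (1 : R)) - flat P 0)) = flat ('X * P).
  apply/funext => h /=.
  have -> : h *: (1 : R) = h by rewrite /GRing.scale/= mulr1.
  rewrite addr0 /flat ltxx subr0; case: ifPn => _; last by rewrite scaler0.
  by rewrite hornerM hornerX /GRing.scale/= mulrA.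
rewrite E; apply: cvg_within_filter; apply/norm_cvg0P.
have H0 : (fun t : R => K * `|t|) @ (0 : R) --> (0 : R).
  rewrite -[X in _ --> X](mulr0 K) -[in X in _ --> X](normr0 R).
  by apply: cvgM; [exact: cvg_cst|exact: norm_continuous].
apply: (squeeze_cvgr _ (cvg_cst 0) H0); apply: nearW => t /=.
by rewrite normr_ge0 hK.
Qed.

(** With y = 1/t, so that dy/dt = -y^2, the chain rule turns P(y) e^(-y) into y^2 (P(y) - P'(y))
    e^(-y). *)
Definition flat' P : {poly R} := 'X^2 * (P - P^`()).

Lemma is_derive_flat P (t : R) : is_derive t 1 (flat P) (flat (flat' P) t).
Proof.
have [t0|t0|<-] := ltgtP 0 t; last first.
- by have -> : flat (flat' P) 0 = 0; [rewrite /flat ltxx|exact: flat0P].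
- have -> : flat (flat' P) t = 0 by rewrite /flat ltNge (ltW t0).
  apply: (@near_eq_is_derive _ _ _ (cst 0)).
  by near=> s; rewrite /flat/= ifN// -leNgt ltW//; near: s; exact: lt_nbhsl.
apply: (@near_eq_is_derive _ _ _ ((horner P \o (fun s => s^-1)) * (expR \o (fun s => - s^-1)))).
  by near=> s; rewrite /flat/= ifT//; near: s; exact: lt_nbhsr.
have dV : is_derive t 1 (fun s : R => s^-1) (- t ^- 2 *: 1).
  by apply: is_deriveV; rewrite gt_eqF.
have dE : is_derive t 1 (expR \o (fun s => - s^-1)) (expR (- t^-1) * - (- t ^- 2 *: 1)).
  by apply: is_derive1_comp; exact: is_deriveN.
have dP : is_derive t 1 (horner P \o (fun s => s^-1)) (P^`().[t^-1] * (- t ^- 2 *: 1)).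
  by apply: is_derive1_comp.
apply: is_derive_eq (is_deriveM dP dE) _.
rewrite /flat t0 /flat' hornerM hornerXn hornerD hornerN /GRing.scale/= exprVn.
by field; rewrite gt_eqF.
Unshelve. all: by end_near.
Qed.

Lemma flat1_le1 (t : R) : 0 <= flat 1 t <= 1.
Proof.
rewrite /flat; case: ifPn => [t0|_]; last by rewrite lexx ler01.
by rewrite hornerC mul1r expR_ge0/= expR_le1 oppr_le0 invr_ge0 ltW.
Qed.

End flat.

Lemma is_derive_affine (R : realType) (a b t : R) : is_derive t (1 : R) (fun s => a + b * s) b.
Proof.
have H := is_deriveD (is_derive_cst a t (1 : R)) (is_deriveZ b (is_derive_id t (1 : R))).
by apply: is_derive_eq H _; rewrite add0r /GRing.scale/= mulr1.
Qed.

Section smooth.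
Context (R : realType) (n : nat).
Local Notation X := 'rV[R]_n.+1.
Implicit Types f g : X -> R.
Local Notation e_ := (fun i => delta_mx 0 i : X).

Definition smooth f := forall k, Ck k f.

Lemma Ck_continuous k f : Ck k f -> continuous f.
Proof. by case: k => [|k] []. Qed.

Lemma CkW k f : Ck k.+1 f -> Ck k f.
Proof.
elim: k f => [|k IH] f; first by move=> [].
move=> [cf df]; split=> // i; have [d1 /IH c1] := df i; split=> //; exact: c1.
Qed.

Lemma smooth_continuous f : smooth f -> continuous f.
Proof. by move=> /(_ 0%N)[]. Qed.

Lemma smooth_derivable f i x : smooth f -> derivable f x (e_ i).
Proof. by move=> /(_ 1%N)[_ /(_ i)[]]. Qed.

Lemma smooth_partial f i : smooth f -> smooth (partial i f).
Proof. by move=> sf k; have [_ /(_ i)[]] := sf k.+1. Qed.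

Lemma partialD f g i : (forall x, derivable f x (e_ i)) -> (forall x, derivable g x (e_ i)) ->
  partial i (f + g) = partial i f + partial i g.
Proof. by move=> df dg; apply/funext => x; rewrite /partial deriveD. Qed.

Lemma partialM f g i : (forall x, derivable f x (e_ i)) -> (forall x, derivable g x (e_ i)) ->
  partial i (f * g) = f * partial i g + g * partial i f.
Proof. by move=> df dg; apply/funext => x; rewrite /partial deriveM. Qed.

Lemma CkD k f g : Ck k f -> Ck k g -> Ck k (f + g).
Proof.
elim: k f g => [|k IH] f g [cf df] [cg dg]; split.
- by move=> x; exact: (continuousD (cf x) (cg x)).
- by [].
- by move=> x; exact: (continuousD (cf x) (cg x)).
move=> i; have [d1 c1] := df i; have [d2 c2] := dg i.
by split=> [x|]; [exact: derivableD (d1 x) (d2 x)|rewrite (partialD d1 d2); exact: IH].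
Qed.

Lemma CkM k f g : Ck k f -> Ck k g -> Ck k (f * g).
Proof.
elim: k f g => [|k IH] f g [cf df] [cg dg]; split.
- by move=> x; exact: (continuousM (cf x) (cg x)).
- by [].
- by move=> x; exact: (continuousM (cf x) (cg x)).
move=> i; have [d1 c1] := df i; have [d2 c2] := dg i.
split; first by move=> x; exact: derivableM.
rewrite (partialM d1 d2); apply: CkD; apply: IH;
  [apply: CkW; split; [exact: cf|exact: df]|exact: c2|apply: CkW; split; [exact: cg|exact: dg]|exact: c1].
Qed.

Lemma Ck_cst k (a : R) : Ck k (fun _ : X => a).
Proof.
elim: k a => [|k IH] a; split=> //; try exact: cst_continuous.
move=> i; split; first by move=> x; exact: derivable_cst.
by have -> : partial i (fun _ : X => a) = fun=> 0 by apply/funext => x; rewrite /partial derive_cst.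
Qed.

Lemma smooth_cst (a : R) : smooth (fun _ : X => a). Proof. by move=> k; exact: Ck_cst. Qed.
Lemma smoothD f g : smooth f -> smooth g -> smooth (f + g).
Proof. by move=> sf sg k; exact: CkD. Qed.
Lemma smoothM f g : smooth f -> smooth g -> smooth (f * g).
Proof. by move=> sf sg k; exact: CkM. Qed.

Lemma smooth_prod (I : Type) (r : seq I) (F : I -> X -> R) :
  (forall i, smooth (F i)) -> smooth (fun x => \prod_(i <- r) F i x).
Proof.
move=> sF; elim: r => [|i r IH].
  by under [X in smooth X]eq_fun do rewrite big_nil; exact: smooth_cst.
by under [X in smooth X]eq_fun do rewrite big_cons; exact: (smoothM (sF i) IH).
Qed.

Lemma is_derive_from_line f (x v : X) (D : R) :
  is_derive (0 : R) (1 : R) (fun t : R => f (x + t *: v)) D -> is_derive x v f D.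
Proof.
move=> [d0 D0].
have E : (fun h : R => h^-1 *: (((fun t : R => f (x + t *: v)) \o shift 0) (h *: (1 : R)) - f (x + (0 : R) *: v)))
       = (fun h : R => h^-1 *: ((f \o shift x) (h *: v) - f x)).
  apply/funext => h /=.
  have -> : h *: (1 : R) = h by rewrite /GRing.scale/= mulr1.
  by rewrite addr0 scale0r addr0 [_ + x]addrC.
by split; [rewrite /derivable -E; exact: d0|rewrite -D0 /derive -E].
Qed.

Lemma is_derive_coord_comp (s : R -> R) (ds : R) (c d : R) (i j : 'I_n.+1) (x : X) :
  is_derive (c * x 0 i + d) 1 s ds ->
  is_derive x (e_ j) (fun x : X => s (c * x 0 i + d)) (if i == j then c * ds else 0).
Proof.
move=> Hs; apply: is_derive_from_line.
have -> : (fun t : R => s (c * (x + t *: delta_mx 0 j : X) 0 i + d)) =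
   s \o (fun t : R => c * (x 0 i + t * (i == j)%:R) + d).
  by apply/funext => t /=; rewrite !mxE eqxx.
apply: (@is_derive_eq _ _ _ _ _ _ _ (ds * (c * (i == j)%:R))); last first.
  by case: ifP => _; rewrite ?mulr1 ?mulr0// mulrC.
apply: is_derive1_comp; first by rewrite mul0r addr0.
have -> : (fun t : R => c * (x 0 i + t * (i == j)%:R) + d) =
   (fun t => (c * x 0 i + d) + (c * (i == j)%:R) * t) by apply/funext => t; lra.
exact: is_derive_affine.
Qed.

(** The induction on the order of differentiation ranges over all P, since [partial j] sends this
    family to multiples of itself with P replaced by [flat' P]. *)
Lemma smooth_flat (P : {poly R}) (c d : R) (i : 'I_n.+1) :
  smooth (fun x : X => flat P (c * x 0 i + d)).
Proof.
move=> k; elim: k P c d => [|k IH] P c d.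
  split=> // x.
  apply: (@continuous_comp _ _ _ (fun x : X => c * x 0 i + d) (flat P)).
    apply: continuousD; last exact: cst_continuous.
    by apply: continuousM; [exact: cst_continuous|exact: coord_continuous].
  apply/differentiable_continuous/derivable1_diffP.
  by have [] := is_derive_flat P (c * x 0 i + d).
split; first exact: Ck_continuous (IH P c d).
move=> j; split.
  move=> x; by have [] := is_derive_coord_comp j (is_derive_flat P (c * x 0 i + d)).
have -> : partial j (fun x : X => flat P (c * x 0 i + d)) =
    (if i == j then c else 0) *: (fun x : X => flat (flat' P) (c * x 0 i + d)).
  apply/funext => x; rewrite /partial.
  have [_ ->] := is_derive_coord_comp j (is_derive_flat P (c * x 0 i + d)).
  by case: ifP => _; rewrite /GRing.scale/= /GRing.scale/= ?mul0r.
by have := CkM (Ck_cst k (if i == j then c else 0)) (IH (flat' P) c d).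
Qed.

Lemma is_derive_coord (i j : 'I_n.+1) (x : X) :
  is_derive x (e_ j) (fun x : X => x 0 i) ((i == j)%:R : R).
Proof.
apply: is_derive_from_line.
have -> : (fun t : R => (x + t *: delta_mx 0 j : X) 0 i) = (fun t => x 0 i + (i == j)%:R * t).
  by apply/funext => t; rewrite !mxE eqxx mulrC.
exact: is_derive_affine.
Qed.

Lemma partial_coord (i j : 'I_n.+1) : partial j (fun x : X => x 0 i) = fun=> (i == j)%:R.
Proof. by apply/funext => x; rewrite /partial; have [_ ->] := is_derive_coord i j x. Qed.

Lemma smooth_coord (i : 'I_n.+1) : smooth (fun x : X => x 0 i).
Proof.
move=> [|k]; split=> //; try exact: coord_continuous.
move=> j; split; first by move=> x; have [] := is_derive_coord i j x.
by rewrite partial_coord; exact: Ck_cst.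
Qed.

End smooth.

Section box_integrals.
Context (R : realType) (n : nat).
Local Notation X := 'rV[R]_n.+1.
Local Notation leb := (@lebesgue_rV R n.+1).

(** The sets over which h has integral zero form a Dynkin class, the total integral being used for
    complements; the class contains the boxes, which are stable under intersection, hence every
    measurable set. *)
Lemma ae_eq0_box_integrals (h : X -> R) : leb.-integrable setT (EFin \o h) ->
  (\int[leb]_x (h x)%:E = 0)%E ->
  (forall a b, \int[leb]_(x in box a b) (h x)%:E = 0)%E ->
  {ae leb, forall x, h x = 0}.
Proof.
move=> ih hT hbox.
suff H A : measurable A -> (\int[leb]_(x in A) (h x)%:E = 0)%E.
  have /integral_ae_eq : measurable_fun setT (fun _ : X => 0%E : \bar R) by [].
  move=> /(_ leb measurableT _ ih) [].
    by move=> E _ mE; rewrite integral0 H.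
  move=> B [mB B0 sB]; exists B; split => // x /= hx; apply: sB => /= h0; apply: hx.
  by case: (h0 I).
move=> mA; move: (mA); rewrite (@measurable_box_gen R n.+1).
move: A {mA}; apply: (@dynkin_induction _ X _ (fun A => \int[leb]_(x in A) (h x)%:E = 0)%E) => //.
- exact: measurable_box_gen.
- by move=> _ _ [a [b ->]] [a' [b' ->]]; rewrite boxI; do 2 eexists.
- by move=> _ [a [b ->]]; exact: hbox.
- move=> S mS hS.
  have := hT; rewrite -(setvU S) integral_setU_EFin//; last 3 first.
  + exact: measurableC.
  + by rewrite setvU; case/integrableP: ih => /measurable_EFinP.
  + by apply/disj_setPS; rewrite setICl.
  by rewrite hS adde0.
- move=> F mF tF hF; rewrite integral_bigcup//; last first.
    by apply: integrableS ih => //; exact: bigcup_measurable.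
  by rewrite eseries0// => k _ _; exact: hF.
Qed.

(* The summand [k.+1] makes the second factor tend to 1 also at the closed end x_i = b_i of
   the half-open box. *)
Definition bump (a b : 'I_n.+1 -> R) (k : nat) (x : X) : R :=
  \prod_i (flat 1 (k.+1%:R * (x 0 i - a i)) * flat 1 (k.+1%:R ^+ 2 * (b i - x 0 i) + k.+1%:R)).

Lemma smooth_bump a b k : smooth (bump a b k).
Proof.
apply: smooth_prod => i; apply: smoothM.
  have -> : (fun x : X => flat 1 (k.+1%:R * (x 0 i - a i))) =
            (fun x => flat 1 (k.+1%:R * x 0 i + - (k.+1%:R * a i))).
    by apply/funext => x; rewrite mulrBr.
  exact: smooth_flat.
have -> : (fun x : X => flat 1 (k.+1%:R ^+ 2 * (b i - x 0 i) + k.+1%:R)) =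
          (fun x => flat 1 (- k.+1%:R ^+ 2 * x 0 i + (k.+1%:R ^+ 2 * b i + k.+1%:R))).
  by apply/funext => x; congr flat; ring.
exact: smooth_flat.
Qed.

Lemma bump01 (a b : 'I_n.+1 -> R) k (x : X) : 0 <= bump a b k x <= 1.
Proof.
have H i : 0 <= flat 1 (k.+1%:R * (x 0 i - a i)) * flat 1 (k.+1%:R ^+ 2 * (b i - x 0 i) + k.+1%:R) <= 1.
  have /andP[p1 p2] := flat1_le1 (k.+1%:R * (x 0 i - a i)).
  have /andP[q1 q2] := flat1_le1 (k.+1%:R ^+ 2 * (b i - x 0 i) + k.+1%:R).
  by rewrite mulr_ge0// mulr_ile1.
by rewrite /bump prodr_ge0/= ?prodr_ile1// => i _; have /andP[] := H i.
Qed.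

(** With K = k+1 the argument K^2 (b - x) + K equals K^2 (b + 1/K - x), so the bump reaches beyond b
    by 1/K only. *)
Lemma bump_eq0 (a b : 'I_n.+1 -> R) k (x : X) : ~ (forall i, a i <= x 0 i <= b i + k.+1%:R^-1) -> bump a b k x = 0.
Proof.
move=> /existsNP[i /negP]; rewrite negb_and -!ltNge => H.
rewrite /bump (bigD1 i)//=; apply/eqP; rewrite mulf_eq0 mulf_eq0; apply/orP; left.
apply/orP; case/orP: H => H; [left|right]; rewrite /flat ifN ?eqxx// -leNgt.
  by rewrite pmulr_rle0// subr_le0 ltW.
have -> : k.+1%:R ^+ 2 * (b i - x 0 i) + k.+1%:R =
   k.+1%:R ^+ 2 * (b i + k.+1%:R^-1 - x 0 i) :> R.
  by have := pnatr_eq0 R k.+1; set K := k.+1%:R => /negbT K0; field.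
by rewrite pmulr_rle0 ?exprn_gt0// subr_le0 ltW.
Qed.

(** Squeeze: exp(-1/s_k) lies between 1 - 1/(t (k+1)) and 1. *)
Lemma cvg_flat1 (s : nat -> R) (t : R) : 0 < t -> (forall k, t * k.+1%:R <= s k) ->
  (fun k => flat 1 (s k)) @ \oo --> (1 : R).
Proof.
move=> t0 ts.
have s0 k : 0 < s k by apply: lt_le_trans (ts k); rewrite mulr_gt0.
have H0 : (fun k => 1 - t^-1 * @harmonic R k) @ \oo --> (1 : R).
  have : (fun k => 1 - t^-1 * @harmonic R k) @ \oo --> (1 - t^-1 * 0 : R).
    by apply: cvgB; [exact: cvg_cst|apply: cvgM; [exact: cvg_cst|exact: cvg_harmonic]].
  by rewrite mulr0 subr0.
have H1 : (fun _ : nat => 1 : R) @ \oo --> (1 : R) by exact: cvg_cst.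
apply: (squeeze_cvgr _ H0 H1); apply: nearW => k.
have /andP[_ ->] := flat1_le1 (s k); rewrite andbT /flat s0 hornerC mul1r.
apply: le_trans (expR_ge1Dx _); rewrite lerD2l lerN2 /harmonic/= -invfM.
by rewrite lef_pV2 ?posrE ?mulr_gt0.
Qed.

Lemma bump_cvg (a b : 'I_n.+1 -> R) (x : X) : (fun k => bump a b k x) @ \oo --> (\1_(box a b) x : R).
Proof.
have -> : \1_(box a b) x = \prod_i ((x 0 i \in `]a i, b i])%:R : R) :> R.
  rewrite indicE; have [xQ|xQ] := boolP (x \in box a b).
    by rewrite big1// => i _; move: xQ; rewrite inE => ->.
  move: xQ; rewrite notin_setE => /existsNP[i /negP/negbTE xi].
  by rewrite (bigD1 i)//= xi mul0r.
apply: cvg_big => [|i _]; first exact: mul_continuous.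
(* Per coordinate: left of a the first factor is 0; in ]a, b] both factors tend to 1; right of b the
   second factor is 0 as soon as 1/(k+1) < x - b. *)
have [xa|ax] := leP (x 0 i) (a i).
  rewrite in_itv/= ltNge xa/=.
  have -> : (fun k : nat => flat 1 (k.+1%:R * (x 0 i - a i)) * flat 1 (k.+1%:R ^+ 2 * (b i - x 0 i) + k.+1%:R)) = cst (0 : R).
    by apply/funext => k; rewrite {1}/flat ifN ?mul0r// -leNgt pmulr_rle0// subr_le0.
  exact: cvg_cst.
rewrite in_itv/= ax/=; have [xb|bx] := leP (x 0 i) (b i).
  rewrite -[X in _ --> X](mulr1 (1 : R)); apply: cvgM.
    by apply: (@cvg_flat1 _ (x 0 i - a i)) => [|k]; rewrite ?subr_gt0// mulrC.
  apply: (@cvg_flat1 _ 1) => // k; rewrite mul1r lerDr mulr_ge0// subr_ge0//.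
rewrite -[X in _ --> X](mulr0 (1 : R)); apply: cvgM.
  by apply: (@cvg_flat1 _ (x 0 i - a i)) => [|k]; rewrite ?subr_gt0// mulrC.
apply: cvg_near_cst.
have := @cvg_harmonic R; move=> /cvgrPdist_lt /(_ _ (eqbRL (subr_gt0 _ _) bx)).
apply: filterS => k; rewrite sub0r normrN /harmonic/= ger0_norm// => kb.
rewrite /flat ifN// -leNgt.
have -> : k.+1%:R ^+ 2 * (b i - x 0 i) + k.+1%:R =
   k.+1%:R ^+ 2 * (k.+1%:R^-1 - (x 0 i - b i)) :> R.
  by have := pnatr_eq0 R k.+1; set K := k.+1%:R => /negbT K0; field.
by rewrite pmulr_rle0 ?exprn_gt0// subr_le0 ltW.
Qed.
End box_integrals.

(** * Test functions, the L2 pairing and weak derivatives on Omega *)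

Section omega_spaces.
Context (R : realType) (n : nat).
Local Notation X := 'rV[R]_n.+1.
Local Notation leb := (@lebesgue_rV R n.+1).
Context (Omega : set X) (oOm : open Omega).
Implicit Types (u v w phi : X -> R).
Local Notation Lf := (Lfun leb 2%:E).
Local Notation test := (test_fun Omega).
Local Notation L2 := (L2 Omega).
Local Notation L2norm := (L2norm Omega).

Lemma mOm : measurable Omega. Proof. exact: open_measurable_rV. Qed.

(** Avoids computing the support: a compact K is closed, so it contains the closure of the set where
    phi is nonzero. *)
Lemma test_of_compact phi (K : set X) : smooth phi -> compact K -> K `<=` Omega ->
  (forall x, ~ K x -> phi x = 0) -> test phi.
Proof.
move=> sphi cK KO phiK; split=> //=.
have cl : closure [set x | phi x != 0] `<=` K.
  have := compact_closed (@norm_hausdorff _ _) cK => /closure_id ->; apply: closureS => x /= /eqP px.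
  by apply: contrapT => /phiK.
split; last exact: subset_trans cl KO.
by apply: subclosed_compact cK cl; exact: closed_closure.
Qed.

Lemma test_compact phi : test phi -> exists K : set X,
  [/\ compact K, K `<=` Omega & forall x, ~ K x -> phi x = 0].
Proof.
move=> [_ [cK KO]]; exists (closure [set x | phi x != 0]); split=> // x nK.
by apply/eqP; apply: contrapT => /negP px; apply: nK; exact: subset_closure.
Qed.

Lemma test_smooth phi : test phi -> smooth phi. Proof. by case. Qed.

Lemma test_out phi x : test phi -> ~ Omega x -> phi x = 0.
Proof. by move=> /test_compact[K [_ KO phiK]] nx; apply: phiK => /KO. Qed.

Lemma test_vanish phi : test phi -> exists N, vanish_outside N phi.
Proof. by move=> /test_compact[K [cK _]]; exact: compact_vanish_outside. Qed.

Lemma test_partial i phi : test phi -> test (partial i phi).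
Proof.
move=> tp; have [K [cK KO phiK]] := test_compact tp.
apply: (test_of_compact (K := K)) => //; first exact: smooth_partial (test_smooth tp).
move=> x nK; rewrite /partial (@near_eq_derive _ _ _ phi (cst 0)) ?derive_cst//.
have : open (~` K) by apply: closed_openC; exact: compact_closed.
by rewrite openE => /(_ _ nK); apply: filterS => y /phiK.
Qed.

Lemma testM f phi : smooth f -> test phi -> test (f * phi).
Proof.
move=> sf tp; have [K [cK KO phiK]] := test_compact tp.
apply: (test_of_compact (K := K)) => //; first exact: smoothM (test_smooth tp).
by move=> x /phiK p0; rewrite /GRing.mul/= p0 mulr0.
Qed.

Lemma testD phi psi : test phi -> test psi -> test (phi + psi).
Proof.
move=> tp tq; have [K [cK KO phiK]] := test_compact tp; have [J [cJ JO psiJ]] := test_compact tq.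
apply: (test_of_compact (K := K `|` J)) => //.
- exact: smoothD (test_smooth tp) (test_smooth tq).
- exact: compactU.
- by move=> x [/KO|/JO].
- by move=> x /not_orP[/phiK p0 /psiJ q0]; rewrite /GRing.add/= p0 q0 addr0.
Qed.

Lemma testZ a phi : test phi -> test (a *: phi).
Proof. by move=> tp; have := testM (smooth_cst n a) tp. Qed.

Lemma test0 : test 0.
Proof.
apply: (test_of_compact (K := set0)) => //; [exact: smooth_cst|exact: compact0].
Qed.

Lemma test_patch phi : test phi -> phi \_ Omega = phi.
Proof.
move=> tp; apply/funext => x; rewrite /patch; case: ifPn => //.
by rewrite notin_setE => /(test_out tp).
Qed.

Lemma test_bounded phi : test phi -> exists B : R, forall x, `|phi x| <= B.
Proof.
move=> tp; have [N pN] := test_vanish tp.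
exact: continuous_vanish_bounded (smooth_continuous (test_smooth tp)) pN.
Qed.

Lemma test_Lf phi : test phi -> phi \in Lf /\ leb.-integrable setT (EFin \o phi).
Proof.
move=> tp; have [N pN] := test_vanish tp; have [B pB] := test_bounded tp.
apply: bounded_vanish_L2 pN pB.
exact: continuous_measurable_rV (smooth_continuous (test_smooth tp)).
Qed.

Lemma test_L2 phi : test phi -> L2 phi.
Proof. by move=> tp; rewrite /Defs.L2/= test_patch//; have [] := test_Lf tp. Qed.

Lemma Rintegral_partial0 i phi : test phi -> \int[leb]_x partial i phi x = 0.
Proof.
move=> tp; have [N pN] := test_vanish tp; have sp := test_smooth tp.
apply: (@Rintegral_derive0 _ _ N) => //.
- exact: smooth_continuous.
- by move=> x; exact: smooth_derivable.
- exact: (smooth_continuous (smooth_partial i sp)).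
Qed.

Lemma patchD u v : (u + v) \_ Omega = u \_ Omega + v \_ Omega.
Proof.
apply/funext => x; rewrite [in RHS]/GRing.add/= /patch; case: ifPn => // _.
by rewrite addr0.
Qed.

Lemma patchZ a u : (a *: u) \_ Omega = a *: (u \_ Omega).
Proof.
apply/funext => x; rewrite [in RHS]/GRing.scale/= /patch; case: ifPn => // _.
by rewrite /GRing.scale/= mulr0.
Qed.

Lemma patchN u : (- u) \_ Omega = - (u \_ Omega).
Proof. by rewrite -scaleN1r patchZ scaleN1r. Qed.

Lemma patchB u v : (u - v) \_ Omega = u \_ Omega - v \_ Omega.
Proof. by rewrite patchD patchN. Qed.

Lemma patch0 : (0 : X -> R) \_ Omega = 0.
Proof. by rewrite -[X in patch _ _ X](scale0r 0) patchZ scale0r. Qed.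

Lemma L2_zero : L2 0. Proof. by rewrite /Defs.L2/= patch0 L2_0. Qed.
Lemma L2_add u v : L2 u -> L2 v -> L2 (u + v).
Proof. by rewrite /Defs.L2/= patchD; exact: L2D. Qed.
Lemma L2_scale a u : L2 u -> L2 (a *: u).
Proof. by rewrite /Defs.L2/= patchZ; exact: L2Z. Qed.
Lemma L2_sub u v : L2 u -> L2 v -> L2 (u - v).
Proof. by rewrite /Defs.L2/= patchB; exact: L2B. Qed.

Lemma L2norm_ge0 u : 0 <= L2norm u. Proof. exact: nrm2_ge0. Qed.
Lemma L2normD u v : L2 u -> L2 v -> L2norm (u + v) <= L2norm u + L2norm v.
Proof. by move=> hu hv; have := (nrm2D hu hv).2; rewrite /nrm2 -patchD. Qed.
Lemma L2normZ a u : L2 u -> L2norm (a *: u) = `|a| * L2norm u.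
Proof. by move=> hu; have := (nrm2Z a hu).2; rewrite /nrm2 -patchZ. Qed.
Lemma L2norm0 : L2norm 0 = 0.
Proof. by rewrite /Defs.L2norm /L2norme patch0; exact: nrm2_0. Qed.

Lemma ae_patch u v : ae_eq leb Omega u v <-> {ae leb, forall x, (u \_ Omega) x = (v \_ Omega) x}.
Proof.
split; apply: filterS => x; rewrite /patch.
  by case: ifPn => // /set_mem xO /(_ xO).
by move=> h xO; move: h; rewrite mem_set.
Qed.

Lemma L2norm_eq0 u : L2 u -> L2norm u = 0 -> ae_eq leb Omega u 0.
Proof.
by move=> hu u0; apply/ae_patch; rewrite patch0; exact: (nrm2_eq0 hu u0).
Qed.

Lemma L2norm_ae u v : L2 u -> L2 v -> ae_eq leb Omega u v -> L2norm u = L2norm v.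
Proof. by move=> hu hv /ae_patch uv; have [_ E] := L2_ae hu (L2_mfun hv) uv; exact/esym/E. Qed.

Definition ip u v := \int[leb]_(x in Omega) (u x * v x).

Lemma ipE u v : ip u v = \int[leb]_x ((u \_ Omega) x * (v \_ Omega) x).
Proof.
rewrite /ip Rintegral_mkcond; apply: eq_Rintegral => x _; rewrite /patch.
by case: ifP => _; rewrite ?mulr0.
Qed.

Lemma ip_le u v : L2 u -> L2 v -> `|ip u v| <= L2norm u * L2norm v.
Proof. by move=> hu hv; rewrite ipE; exact: cauchy_schwarz. Qed.

Lemma ipDl u v w : L2 u -> L2 v -> L2 w -> ip (u + v) w = ip u w + ip v w.
Proof.
move=> hu hv hw; rewrite !ipE -RintegralD//; try exact: L2_mulr_integrable.
by apply: eq_Rintegral => x _; rewrite patchD mulrDl.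
Qed.

Lemma ipZl a u w : L2 u -> L2 w -> ip (a *: u) w = a * ip u w.
Proof.
move=> hu hw; rewrite !ipE -RintegralZl//; try exact: L2_mulr_integrable.
by apply: eq_Rintegral => x _; rewrite patchZ mulrA.
Qed.

Lemma ip0l w : L2 w -> ip 0 w = 0.
Proof. by move=> hw; have := ipZl 0 L2_zero hw; rewrite scale0r mul0r. Qed.

(** Integration by parts: the product of two test functions is a test function, so its partial
    derivative has integral zero. *)
Lemma weak_partial_test i phi : test phi -> weak_partial Omega i phi (partial i phi).
Proof.
move=> tp; have tdp := test_partial i tp; split; [exact: test_L2|exact: test_L2|].
move=> psi tq; have tdq := test_partial i tq.
apply/eqP; rewrite -addr_eq0; apply/eqP.
have := Rintegral_partial0 i (testM (test_smooth tp) tq).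
rewrite partialM; try (by move=> x; exact: smooth_derivable (test_smooth _)).
rewrite -/(ip phi (partial i psi)) -/(ip (partial i phi) psi) !ipE !test_patch//.
rewrite -RintegralD//; try by apply: L2_mulr_integrable; apply: (test_Lf _).1.
move=> <-; apply: eq_Rintegral => x _.
have -> : (phi * partial i psi + psi * partial i phi) x =
  phi x * partial i psi x + psi x * partial i phi x by [].
by rewrite [psi x * _]mulrC.
Qed.

Lemma weak_partial_lin i a u u' v v' : weak_partial Omega i u u' -> weak_partial Omega i v v' ->
  weak_partial Omega i (a *: u + v) (a *: u' + v').
Proof.
move=> [hu hu' uu'] [hv hv' vv']; split.
- by apply: L2_add => //; exact: L2_scale.
- by apply: L2_add => //; exact: L2_scale.
move=> phi tp; have hp := test_L2 tp; have hdp := test_L2 (test_partial i tp).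
have := uu' _ tp; have := vv' _ tp.
rewrite -!/(ip _ _) ipDl ?ipZl// => [-> ->|]; last exact: L2_scale.
by rewrite ipDl ?ipZl//; [ring|exact: L2_scale].
Qed.

End omega_spaces.

Section fundamental.
Context (R : realType) (n : nat).
Local Notation X := 'rV[R]_n.+1.
Local Notation leb := (@lebesgue_rV R n.+1).
Context (Omega : set X) (oOm : open Omega).
Local Notation test := (test_fun Omega).
Local Notation L2 := (L2 Omega).
Local Notation ip := (ip Omega).

Definition cbox (a b : 'I_n.+1 -> R) : set X := [set x | forall i, a i <= x 0 i <= b i].

Lemma compact_cbox a b : compact (cbox a b).
Proof.
have := @rV_compact R n.+1 (fun i => `[a i, b i]%classic) (fun i => @segment_compact _ _ _).
by congr compact; apply/seteqP; split=> x /= h i; have := h i; rewrite in_itv.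
Qed.

Lemma measurable_cbox a b : measurable (cbox a b).
Proof.
have := @measurable_forall_coord R n.+1 (fun i => `[a i, b i]%classic) (fun i => measurable_itv _).
by congr measurable; apply/seteqP; split=> x /= h i; have := h i; rewrite in_itv.
Qed.

Lemma indic_cbox_Lf a b : (\1_(cbox a b) : X -> R) \in Lfun leb 2%:E.
Proof.
have [|N gN] := compact_vanish_outside (g := \1_(cbox a b)) (@compact_cbox a b).
  by move=> x nx; rewrite indicE memNset.
apply: (bounded_vanish_L2 (B := 1) _ gN _).1; first exact: measurable_indic (@measurable_cbox a b).
by move=> x; rewrite indicE; case: (_ \in _); rewrite /= ?normr0 ?normr1.
Qed.

(** The indicator of the half-open box is the pointwise limit of bumps supported in the closed box
    [K]; [dlt] is the room that keeps these supports inside Omega. *)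
Lemma box_integral0 (v : X -> R) a b (dlt : R) : L2 v ->
  (forall phi, test phi -> ip v phi = 0) -> 0 < dlt ->
  cbox a (fun i => b i + dlt) `<=` Omega ->
  (\int[leb]_(x in box a b) ((v \_ Omega) x)%:E = 0)%E.
Proof.
move=> hv vphi d0 KO; set w := v \_ Omega; set K := cbox _ _ in KO.
have wL : w \in Lfun leb 2%:E by [].
have mw := L2_mfun wL.
(* Starting the sequence at [k0] makes the overshoot 1/(k + k0 + 1) at most [dlt] for every k. *)
pose k0 := Num.truncn dlt^-1.
have bK k x : ~ K x -> bump a b (k + k0) x = 0.
  move=> nK; apply: bump_eq0 => h; apply: nK => i; have /andP[-> /le_trans ->] := h i => //.
  rewrite lerD2l -[dlt]invrK lef_pV2 ?posrE ?invr_gt0//.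
  by apply/ltW/(lt_le_trans (truncnS_gt _)); rewrite ler_nat ltnS leq_addl.
have tb k : test (bump a b (k + k0)).
  apply: (test_of_compact (K := K)) ; [exact: smooth_bump|exact: compact_cbox|exact: KO|exact: bK].
have mbump k : measurable_fun setT (bump a b k).
  exact: continuous_measurable_rV (smooth_continuous (smooth_bump a b k)).
have [_ _] : [/\ leb.-integrable setT (EFin \o (fun x => w x * \1_(box a b) x)),
    [sequence (\int[leb]_(x in setT) `|(w x * bump a b (k + k0) x)%:E - (w x * \1_(box a b) x)%:E|)%E]_k @ \oo --> 0%E &
    [sequence (\int[leb]_(x in setT) (w x * bump a b (k + k0) x)%:E)%E]_k @ \oo -->
      (\int[leb]_x (w x * \1_(box a b) x)%:E)%E].
  apply: (@dominated_convergence _ _ _ leb setT measurableT _ _ (EFin \o (fun x => `|w x * \1_K x|))) => //.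
  - by move=> k; apply/measurable_EFinP; exact: measurable_funM.
  - by apply/measurable_EFinP; apply: measurable_funM => //; apply: measurable_indic; exact: measurable_box.
  - apply: aeW => x _; apply/cvg_EFin; first exact: nearW.
    apply: cvgM; first exact: cvg_cst.
    by have := @bump_cvg R n a b x; rewrite -(cvg_shiftn k0).
  - have := L2_mulr_integrable wL (indic_cbox_Lf a (fun i => b i + dlt)).
    by move=> /integrable_abse.
  apply: aeW => x k _; rewrite lee_fin !normrM; rewrite ler_wpM2l//.
  rewrite indicE; have [xK|xK] := boolP (x \in K); last first.
    by rewrite bK ?normr0//; move: xK; rewrite notin_setE.
  by have /andP[p0 p1] := bump01 a b (k + k0) x; rewrite ger0_norm// normr1.
rewrite (_ : [sequence _]_k = cst 0%E).
  move/cvg_lim => /(_ (@ereal_hausdorff R)); rewrite lim_cst// => E.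
  rewrite [RHS]E integral_mkcond; apply: eq_integral => x _.
  by rewrite /patch indicE; case: ifP => _; rewrite ?mulr1 ?mulr0.
apply/funext => k /=.
have := vphi _ (tb k); rewrite ipE (test_patch (tb k)) /Rintegral => fi0.
rewrite -[LHS]fineK ?fi0//; apply: integrable_fin_num => //.
exact: L2_mulr_integrable wL (test_Lf (tb k)).1.
Qed.

Lemma cboxW a b a' b' : (forall i, a' i <= a i) -> (forall i, b i <= b' i) -> cbox a b `<=` cbox a' b'.
Proof. by move=> aa bb x h i; have /andP[h1 h2] := h i; rewrite (le_trans (aa i))// (le_trans h2). Qed.

(** The box criterion is applied to the product of [w] with the indicator of the box: its integral
    over another box is that of [w] over the intersection, again a box with room in Omega. *)
Lemma box_ae0 (v : X -> R) a b (dlt : R) : L2 v ->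
  (forall phi, test phi -> ip v phi = 0) -> 0 < dlt ->
  cbox a (fun i => b i + dlt) `<=` Omega ->
  {ae leb, forall x, box a b x -> (v \_ Omega) x = 0}.
Proof.
move=> hv vphi d0 KO; set w := v \_ Omega.
have wL : w \in Lfun leb 2%:E by [].
have mw := L2_mfun wL.
have hE (A : set X) : (\int[leb]_(x in A) (w x * \1_(box a b) x)%:E =
    \int[leb]_(x in A `&` box a b) (w x)%:E)%E.
  rewrite integral_mkcond [RHS]integral_mkcond; apply: eq_integral => x _.
  rewrite /patch indicE in_setI; case: (x \in A) => //=; case: (x \in box a b);
    by rewrite ?mulr1 ?mulr0.
have ih : leb.-integrable setT (EFin \o (fun x => w x * \1_(box a b) x)).
  have := L2_mulr_integrable wL (indic_cbox_Lf a b).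
  apply: le_integrable => //.
    apply/measurable_EFinP; apply: measurable_funM => //.
    by apply: measurable_indic; exact: measurable_box.
  move=> x _; rewrite lee_fin !normrM ler_wpM2l// !indicE.
  have [/set_mem xb|_] := boolP (x \in box a b); last by rewrite normr0.
  rewrite mem_set// => i; have := xb i; rewrite in_itv/= => /andP[/ltW -> ->//].
have := @ae_eq0_box_integrals R n _ ih.
rewrite hE setTI (box_integral0 hv vphi d0 KO) => /(_ erefl).
have h0 a' b' : (\int[leb]_(x in box a' b') (w x * \1_(box a b) x)%:E = 0)%E.
  rewrite hE boxI; apply: (box_integral0 hv vphi d0).
  apply: subset_trans KO; apply: cboxW => i; first by rewrite le_max lexx orbT.
  by rewrite lerD2r ge_min lexx orbT.
move=> /(_ h0); apply: filterS => x /[swap] xb.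
by rewrite indicE mem_set// mulr1.
Qed.

Lemma fundamental_lemma (v : X -> R) : L2 v ->
  (forall phi, test phi -> ip v phi = 0) -> ae_eq leb Omega v 0.
Proof.
move=> hv vphi; apply/ae_patch; rewrite patch0; set w := v \_ Omega.
pose a (p : 'rV[rat]_n.+1 * rat) (i : 'I_n.+1) : R := ratr (p.1 0 i) - ratr p.2.
pose b (p : 'rV[rat]_n.+1 * rat) (i : 'I_n.+1) : R := ratr (p.1 0 i) + ratr p.2.
pose good p := 0 < (ratr p.2 : R) /\ cbox (a p) (fun i => b p i + ratr p.2) `<=` Omega.
(* [unpickle] enumerates the rational centres and radii, so a single null set serves all boxes. *)
have H : {ae leb, forall x, forall k, if unpickle k is Some p
    then good p -> box (a p) (b p) x -> w x = 0 else True}.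
  apply: ae_foralln => k; case: (unpickle k) => [p|]; last by apply: aeW.
  have [[p0 pO]|np] := pselect (good p); last by apply: aeW => x.
  by apply: filterS (box_ae0 hv vphi p0 pO) => x.
apply: filterS H => x H.
have [xO|nxO] := pselect (Omega x); last first.
  by rewrite /w /patch memNset.
have /nbhs_ballP[e /= e0 xeO] : nbhs x Omega by move: oOm; rewrite openE => /(_ _ xO).
(* A third of e, because the enlarged box reaches 2r beyond its centre, which is itself within r of
   x. *)
have [|r] := @rat_in_itvoo R 0 (e / 3); first by rewrite divr_gt0.
rewrite in_itv/= => /andP[r0 re].
have [q qx] := rat_rV_near x r0.
have := H (pickle (q, r)); rewrite pickleK; apply.
- split=> // y yK; apply: xeO; split=> // i j; rewrite (ord1 i) /ball/=.
  have := yK j; rewrite /a /b/= => /andP[h1 h2].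
  have := qx j; rewrite ltr_norml => /andP[h3 h4].
  by rewrite ltr_norml; apply/andP; split; lra.
- move=> i; rewrite /a /b/= in_itv/=; have := qx i; rewrite ltr_norml => /andP[h3 h4].
  by apply/andP; split; lra.
Qed.

End fundamental.

Lemma nrm2_dominated d (T : measurableType d) (R : realType) (mu : {measure set T -> \bar R})
    (f g : T -> R) (c : R) : 0 <= c -> measurable_fun setT f -> g \in Lfun mu 2%:E ->
  {ae mu, forall x, `|f x| <= c * `|g x|} ->
  f \in Lfun mu 2%:E /\ nrm2 mu f <= c * nrm2 mu g.
Proof.
move=> c0 mf gL fg; apply: nrm2_le => //; first by rewrite mulr_ge0// nrm2_ge0.
have mg := L2_mfun gL.
rewrite exprMn EFinM nrm2_sqrE// -ge0_integralZl_EFin ?sqr_ge0//; last 2 first.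
- by move=> x _; rewrite lee_fin sqr_ge0.
- by apply/measurable_EFinP; exact: measurable_funX.
apply: ae_ge0_le_integral => //.
- by move=> x _; rewrite lee_fin sqr_ge0.
- by apply/measurable_EFinP; exact: measurable_funX.
- by move=> x _; rewrite -EFinM lee_fin mulr_ge0 ?sqr_ge0.
- apply/measurable_EFinP; apply: measurable_funM => //; exact: measurable_funX.
apply: filterS fg => x fg _; rewrite -EFinM lee_fin -exprMn.
rewrite -[X in X <= _]real_normK ?num_real// -[X in _ <= X]real_normK ?num_real//.
by rewrite ler_pXn2r ?nnegrE// normrM (ger0_norm c0).
Qed.

(** * Sobolev spaces *)

Section sqrt_sum.
Context (R : realType).

(** Common source of the triangle inequality for [gradnorm] and [energy_norm], both roots of sums of
    squared seminorms. *)
Lemma sqrt_sum_triangle (I : Type) (r : seq I) (x y z : I -> R) :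
  (forall i, 0 <= x i) -> (forall i, 0 <= y i) -> (forall i, 0 <= z i <= x i + y i) ->
  Num.sqrt (\sum_(i <- r) z i ^+ 2) <=
  Num.sqrt (\sum_(i <- r) x i ^+ 2) + Num.sqrt (\sum_(i <- r) y i ^+ 2).
Proof.
move=> x0 y0 zxy.
suff H : \sum_(i <- r) z i ^+ 2 <=
    (Num.sqrt (\sum_(i <- r) x i ^+ 2) + Num.sqrt (\sum_(i <- r) y i ^+ 2)) ^+ 2.
  by have := ler_wsqrtr H; rewrite sqrtr_sqr ger0_norm// addr_ge0.
elim: r => [|i r IH]; first by rewrite !big_nil sqrtr0 addr0 expr0n.
rewrite !big_cons.
have X0 : 0 <= \sum_(j <- r) x j ^+ 2 by apply: sumr_ge0 => j _; exact: sqr_ge0.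
have Y0 : 0 <= \sum_(j <- r) y j ^+ 2 by apply: sumr_ge0 => j _; exact: sqr_ge0.
have hA := sqr_sqrtr X0; have hB := sqr_sqrtr Y0.
have hA' := sqr_sqrtr (addr_ge0 (sqr_ge0 (x i)) X0).
have hB' := sqr_sqrtr (addr_ge0 (sqr_ge0 (y i)) Y0).
move: IH hA hB hA' hB'.
move: (sqrtr_ge0 (\sum_(j <- r) x j ^+ 2)) (sqrtr_ge0 (\sum_(j <- r) y j ^+ 2)).
move: (sqrtr_ge0 (x i ^+ 2 + \sum_(j <- r) x j ^+ 2)) (sqrtr_ge0 (y i ^+ 2 + \sum_(j <- r) y j ^+ 2)).
set A := Num.sqrt (\sum_(j <- r) x j ^+ 2); set B := Num.sqrt (\sum_(j <- r) y j ^+ 2).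
set A' := Num.sqrt _; set B' := Num.sqrt _ => A'0 B'0 A0 B0 IH hA hB hA' hB'.
apply: le_trans (lerD (_ : z i ^+ 2 <= (x i + y i) ^+ 2) IH) _.
  by have /andP[z0 zi] := zxy i; rewrite ler_pXn2r ?nnegrE// addr_ge0.
rewrite !sqrrD hA' hB' hA hB.
(* Cauchy-Schwarz in the plane for the vectors (x_i, A) and (y_i, B). *)
have cs : x i * y i + A * B <= A' * B'.
  rewrite -(@ler_pXn2r _ 2)// ?nnegrE ?addr_ge0 ?mulr_ge0//.
  rewrite [(A' * B') ^+ 2]exprMn hA' hB' -hA -hB.
  have := sqr_ge0 (x i * B - y i * A); nra.
rewrite !mulr2n; lra.
Qed.

Lemma le_sqrt_sum (I : finType) (x : I -> R) (i : I) : 0 <= x i -> x i <= Num.sqrt (\sum_j x j ^+ 2).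
Proof.
move=> xi0; rewrite -[X in X <= _](ger0_norm xi0) -sqrtr_sqr ler_wsqrtr//.
by rewrite (bigD1 i)//= lerDl sumr_ge0// => j _; exact: sqr_ge0.
Qed.

Lemma sqrt_sum_le (I : Type) (r : seq I) (x : I -> R) : (forall i, 0 <= x i) ->
  Num.sqrt (\sum_(j <- r) x j ^+ 2) <= \sum_(j <- r) x j.
Proof.
move=> x0; suff h : \sum_(j <- r) x j ^+ 2 <= (\sum_(j <- r) x j) ^+ 2.
  have := ler_wsqrtr h; rewrite sqrtr_sqr ger0_norm// sumr_ge0//.
elim: r => [|i r IH]; first by rewrite !big_nil expr0n.
rewrite !big_cons; have S0 : 0 <= \sum_(j <- r) x j by apply: sumr_ge0.
by rewrite sqrrD; have := mulr_ge0 (x0 i) S0; rewrite mulr2n; lra.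
Qed.

End sqrt_sum.

Section sobolev.
Context (R : realType) (n : nat).
Local Notation X := 'rV[R]_n.+1.
Local Notation leb := (@lebesgue_rV R n.+1).
Context (Omega : set X) (oOm : open Omega).
Implicit Types (u v w phi : X -> R) (i : 'I_n.+1).
Local Notation test := (test_fun Omega).
Local Notation L2 := (L2 Omega).
Local Notation L2norm := (L2norm Omega).
Local Notation ip := (ip Omega).
Local Notation wpartial := (wpartial Omega).
Local Notation gradnorm := (gradnorm Omega).
Local Notation H1 := (H1 Omega).
Local Notation H10 := (H10 Omega).
Local Notation weak_partial := (weak_partial Omega).

(** The difference of the two is a weak derivative of u - u = 0, hence orthogonal to every test
    function. *)
Lemma weak_partial_unique i u v v' : weak_partial i u v -> weak_partial i u v' ->
  ae_eq leb Omega v v'.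
Proof.
move=> uv uv'; have := weak_partial_lin (-1) uv' uv.
rewrite !scaleN1r addNr [- v' + v]addrC => -[_ hvv h].
have := @fundamental_lemma R n Omega oOm (v - v') hvv.
have ip0 phi : test phi -> ip (v - v') phi = 0.
  move=> tp; have := h _ tp; rewrite -/(ip _ _) => h'.
  by rewrite -[LHS]opprK -h' -/(ip _ _) (ip0l (test_L2 (test_partial i tp))) oppr0.
by move=> /(_ ip0); apply: filterS => x + xO => /(_ xO) /eqP; rewrite subr_eq0 => /eqP.
Qed.

Lemma wpartialP i u : (exists v, weak_partial i u v) -> weak_partial i u (wpartial i u).
Proof. by move=> h; rewrite /Defs.wpartial; apply: xgetPex. Qed.

(** [wpartial] selects an arbitrary representative; by uniqueness its norm may be computed from any
    weak derivative at hand. *)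
Lemma wpartial_norm i u v : weak_partial i u v -> L2norm (wpartial i u) = L2norm v.
Proof.
move=> uv; have uw := wpartialP (ex_intro _ _ uv).
apply: L2norm_ae; [by case: uw|by case: uv|exact: weak_partial_unique uw uv].
Qed.

Lemma H1_wpartial i u : H1 u -> weak_partial i u (wpartial i u).
Proof. by move=> [_ /(_ i)]; exact: wpartialP. Qed.

Lemma H1_lin a u v : H1 u -> H1 v -> H1 (a *: u + v).
Proof.
move=> hu hv; split; first by apply: L2_add; [apply: L2_scale; exact: hu.1|exact: hv.1].
move=> i; exists (a *: wpartial i u + wpartial i v).
by apply: weak_partial_lin; exact: H1_wpartial.
Qed.

Lemma weak_partial0 i : weak_partial i 0 0.
Proof.
split; [exact: L2_zero|exact: L2_zero|] => phi tp.
by rewrite -!/(ip _ _) !ip0l ?oppr0//; [exact: test_L2|exact: test_L2 (test_partial i tp)].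
Qed.

Lemma H1_0 : H1 0.
Proof. by split; [exact: L2_zero|move=> i; exists 0; exact: weak_partial0]. Qed.

Lemma gradnorm_ge0 u : 0 <= gradnorm u. Proof. exact: sqrtr_ge0. Qed.

Lemma wpartialD_le i u v : H1 u -> H1 v ->
  L2norm (wpartial i (u + v)) <= L2norm (wpartial i u) + L2norm (wpartial i v).
Proof.
move=> hu hv; have := weak_partial_lin 1 (H1_wpartial i hu) (H1_wpartial i hv).
rewrite !scale1r => /wpartial_norm ->.
by apply: L2normD; [case: (H1_wpartial i hu)|case: (H1_wpartial i hv)].
Qed.

Lemma gradnormD u v : H1 u -> H1 v -> gradnorm (u + v) <= gradnorm u + gradnorm v.
Proof.
move=> hu hv; apply: sqrt_sum_triangle => i; rewrite ?L2norm_ge0//=.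
exact: wpartialD_le.
Qed.

Lemma gradnormZ a u : H1 u -> gradnorm (a *: u) = `|a| * gradnorm u.
Proof.
move=> hu; rewrite /Defs.gradnorm -sqrtr_sqr -sqrtrM ?sqr_ge0// mulr_sumr.
congr Num.sqrt; apply: eq_bigr => i _.
have := weak_partial_lin a (H1_wpartial i hu) (weak_partial0 i).
rewrite !addr0 => /wpartial_norm ->.
have [_ h _] := H1_wpartial i hu.
by rewrite L2normZ// exprMn real_normK ?num_real.
Qed.

Lemma gradnorm0 : gradnorm 0 = 0.
Proof. by rewrite -(scale0r 0) (gradnormZ 0 H1_0) normr0 mul0r. Qed.

Lemma test_H1 phi : test phi -> H1 phi.
Proof.
move=> tp; split; first exact: test_L2.
by move=> i; exists (partial i phi); exact: weak_partial_test.
Qed.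

Local Notation H1norm := (H1norm Omega).

Lemma H1norm_le u : L2norm u <= H1norm u /\ gradnorm u <= H1norm u.
Proof.
split; rewrite /Defs.H1norm -[X in X <= _]ger0_norm ?L2norm_ge0 ?gradnorm_ge0//;
  rewrite -sqrtr_sqr ler_wsqrtr// ?lerDl ?lerDr sqr_ge0//.
Qed.

Lemma H1norm_le_add u : H1norm u <= L2norm u + gradnorm u.
Proof.
have h : L2norm u ^+ 2 + gradnorm u ^+ 2 <= (L2norm u + gradnorm u) ^+ 2.
  have := L2norm_ge0 Omega u; have := gradnorm_ge0 u; nra.
have := ler_wsqrtr h; rewrite sqrtr_sqr ger0_norm// addr_ge0 ?L2norm_ge0 ?gradnorm_ge0//.
Qed.

Lemma H10P u : H10 u <-> H1 u /\ forall e : R, 0 < e ->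
  exists phi, [/\ test phi, L2norm (u - phi) < e & gradnorm (u - phi) < e].
Proof.
split=> -[hu h]; split=> // e e0.
  have [phi tp pe] := h e e0; exists phi; have [h1 h2] := H1norm_le (u - phi).
  by split=> //; [exact: le_lt_trans h1 pe|exact: le_lt_trans h2 pe].
have [|phi [tp h1 h2]] := h (e / 2); first by rewrite divr_gt0.
exists phi => //; apply: le_lt_trans (H1norm_le_add (u - phi)) _.
by rewrite [e]splitr ltrD.
Qed.

Lemma H10_H1 u : H10 u -> H1 u. Proof. by case. Qed.

Lemma H1_sub u v : H1 u -> H1 v -> H1 (u - v).
Proof. by move=> hu hv; rewrite addrC -scaleN1r; exact: H1_lin. Qed.

Lemma test_H10 phi : test phi -> H10 phi.
Proof.
move=> tp; apply/H10P; split; first exact: test_H1.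
by move=> e e0; exists phi; rewrite subrr L2norm0 gradnorm0.
Qed.

Lemma H10_lin a u v : H10 u -> H10 v -> H10 (a *: u + v).
Proof.
move=> /H10P[hu hu'] /H10P[hv hv']; apply/H10P; split; first exact: H1_lin.
(* Chosen so that |a| d + d = e. *)
move=> e e0; pose d := e / (`|a| + 1).
have d0 : 0 < d by rewrite divr_gt0// ltr_wpDl.
have [phi [tp p1 p2]] := hu' _ d0; have [psi [tq q1 q2]] := hv' _ d0.
exists (a *: phi + psi).
have E : a *: u + v - (a *: phi + psi) = a *: (u - phi) + (v - psi).
  by rewrite scalerBr opprD addrACA.
have hup := H1_sub hu (test_H1 tp); have hvq := H1_sub hv (test_H1 tq).
have de : `|a| * d + d = e.
  by rewrite -{2}[d]mul1r -mulrDl /d mulrC divfK// gt_eqF// ltr_wpDl.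
have haup : H1 (a *: (u - phi)) by have := H1_lin a hup H1_0; rewrite addr0.
split; first exact: testD (testZ a tp) tq.
- rewrite E; apply: le_lt_trans (L2normD haup.1 hvq.1) _.
  by rewrite (L2normZ a hup.1) -de; exact: (ler_ltD (ler_wpM2l (normr_ge0 a) (ltW p1)) q1).
- rewrite E; apply: le_lt_trans (gradnormD haup hvq) _.
  by rewrite (gradnormZ a hup) -de; exact: (ler_ltD (ler_wpM2l (normr_ge0 a) (ltW p2)) q2).
Qed.

Lemma H10_0 : H10 0. Proof. exact: test_H10 (test0 Omega). Qed.

End sobolev.

(** * Poincare inequality and completeness of H_0^1 *)

Section poincare.
Context (R : realType) (n : nat).
Local Notation X := 'rV[R]_n.+1.
Local Notation leb := (@lebesgue_rV R n.+1).
Context (Omega : set X) (oOm : open Omega) (bOm : bounded_set Omega).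
Implicit Types (u v w phi : X -> R) (i : 'I_n.+1).
Local Notation test := (test_fun Omega).
Local Notation L2 := (L2 Omega).
Local Notation L2norm := (L2norm Omega).
Local Notation ip := (ip Omega).
Local Notation wpartial := (wpartial Omega).
Local Notation gradnorm := (gradnorm Omega).
Local Notation H1 := (H1 Omega).
Local Notation H10 := (H10 Omega).
Local Notation weak_partial := (weak_partial Omega).

Lemma bounded_coord : exists2 K : R, 0 < K & forall x, Omega x -> `|x 0 ord0| <= K.
Proof.
have [M [_ hM]] := bOm; exists (`|M| + 1); first by rewrite ltr_wpDl.
move=> x xO; apply: le_trans (le_mx_coord x ord0) _.
by apply: hM => //; apply: le_lt_trans (ler_norm _) _; rewrite ltrDl.
Qed.

(* the divergence of [x_0 phi^2] in the direction 0 has integral zero *)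
Lemma poincare_test (K : R) phi : 0 < K -> (forall x, Omega x -> `|x 0 ord0| <= K) ->
  test phi -> L2norm phi <= 2 * K * L2norm (partial ord0 phi).
Proof.
move=> K0 KO tp; have sp := test_smooth tp.
pose x0 : X -> R := fun x => x 0 ord0.
have sx : smooth x0 by exact: smooth_coord.
have txp : test (x0 * phi) by exact: testM.
have tdp := test_partial ord0 tp.
have dx x : derivable x0 x (delta_mx 0 ord0) by exact: smooth_derivable.
have dp x : derivable phi x (delta_mx 0 ord0) by exact: smooth_derivable.
have dxp x : derivable (x0 * phi) x (delta_mx 0 ord0) by exact: smooth_derivable (test_smooth txp).
have := Rintegral_partial0 ord0 (testM sp txp).
rewrite (partialM dp dxp) (partialM dx dp) partial_coord eqxx.
have -> : \int[leb]_x (phi * (x0 * partial ord0 phi + phi * (fun=> 1)) + (x0 * phi) * partial ord0 phi) x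
   = \int[leb]_x (phi x * phi x + 2 * ((x0 * phi) x * partial ord0 phi x)).
  apply: eq_Rintegral => x _.
  transitivity (phi x * (x0 x * partial ord0 phi x + phi x * 1) + (x0 x * phi x) * partial ord0 phi x) => //.
  transitivity (phi x * phi x + 2 * (x0 x * phi x * partial ord0 phi x)) => //.
  by ring.
have pL := (test_Lf tp).1; have xpL := (test_Lf txp).1; have dpL := (test_Lf tdp).1.
rewrite RintegralD//; last 2 first.
- exact: (L2_mulr_integrable pL pL).
- by have := integrableZl measurableT 2 (L2_mulr_integrable xpL dpL).
rewrite RintegralZl//; last exact: L2_mulr_integrable.
have E1 : \int[leb]_x (phi x * phi x) = L2norm phi ^+ 2.
  apply: EFin_inj; rewrite /Defs.L2norm /L2norme test_patch//.
  have := nrm2_sqrE pL; rewrite /nrm2 => ->.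
  rewrite /Rintegral fineK; first by apply: eq_integral => x _; rewrite expr2.
  by apply: integrable_fin_num => //; exact: (L2_mulr_integrable pL pL).
have E2 : `|\int[leb]_x ((x0 * phi) x * partial ord0 phi x)| <= K * L2norm phi * L2norm (partial ord0 phi).
  apply: le_trans (cauchy_schwarz xpL dpL) _.
  have [_ h] : x0 * phi \in Lfun leb 2%:E /\ nrm2 leb (x0 * phi) <= K * nrm2 leb phi.
    apply: nrm2_dominated => //; [exact: ltW|exact: (L2_mfun xpL)|apply: aeW => x].
    have -> : (x0 * phi) x = x0 x * phi x by [].
    rewrite normrM; have [xO|xO] := pselect (Omega x).
      by rewrite ler_wpM2r//; exact: KO.
    by rewrite (test_out tp xO) normr0 !mulr0.
  rewrite /Defs.L2norm /L2norme !test_patch//.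
  by rewrite ler_wpM2r// nrm2_ge0.
rewrite E1 => Z.
have [p0|p0] := leP (L2norm phi) 0.
  apply: le_trans p0 _; rewrite !mulr_ge0//; [exact: ltW|exact: L2norm_ge0].
rewrite -(ler_pM2l p0) -expr2.
have : - (\int[leb]_x ((x0 * phi) x * partial ord0 phi x)) <= K * L2norm phi * L2norm (partial ord0 phi).
  by apply: le_trans (ler_norm _) _; rewrite normrN.
lra.
Qed.

Lemma le_gradnorm i u : L2norm (wpartial i u) <= gradnorm u.
Proof. by apply: (@le_sqrt_sum _ _ (fun i => L2norm (wpartial i u)) i); exact: L2norm_ge0. Qed.

(** Density of test functions: replacing u by phi at distance d in both norms costs d + 2 K d, which
    is e for the d chosen below. *)
Lemma poincare : exists2 K : R, 0 < K & forall u, H10 u -> L2norm u <= K * gradnorm u.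
Proof.
have [K K0 KO] := bounded_coord; exists (2 * K); first by rewrite mulr_gt0.
have K20 : 0 < 2 * K by rewrite mulr_gt0.
have K21 : 0 < 1 + 2 * K by rewrite ltr_wpDl// ltW.
move=> u hu; have [hu1 hu2] := (@H10P R n Omega u).1 hu.
apply/ler_addgt0Pr => e e0; pose d := e / (1 + 2 * K).
have d0 : 0 < d by rewrite divr_gt0.
have [phi [tp h1 h2]] := hu2 d d0.
have hp := test_H1 tp.
have a1 : L2norm u <= L2norm phi + L2norm (u - phi).
  rewrite -{1}[u](subrK phi) addrC; apply: L2normD; first by case: hp.
  by case: (H1_sub hu1 hp).
have a2 : gradnorm phi <= gradnorm u + gradnorm (u - phi).
  have := gradnormZ oOm (-1) (H1_sub hu1 hp); rewrite normrN normr1 mul1r => <-.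
  rewrite scaleN1r opprB -{1}[phi](subrK u) addrC.
  by apply: (gradnormD oOm) => //; exact: H1_sub.
have a3 : L2norm phi <= 2 * K * gradnorm phi.
  apply: le_trans (poincare_test K0 KO tp) _; rewrite ler_wpM2l ?mulr_ge0 ?(ltW K0)//.
  by rewrite -(wpartial_norm oOm (weak_partial_test ord0 tp)) le_gradnorm.
have de : e = d + 2 * K * d by rewrite /d -{1}[_ / _]mul1r -mulrDl mulrC divfK// gt_eqF.
have a4 := le_trans a3 (ler_wpM2l (ltW K20) (le_trans a2 (lerD (lexx _) (ltW h2)))).
rewrite de [d + _]addrC addrA -mulrDr; exact: (le_trans a1 (lerD a4 (ltW h1))).
Qed.

Lemma H10_separated u : H10 u -> gradnorm u = 0 -> ae_eq leb Omega u 0.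
Proof.
move=> hu u0; have [K K0 hK] := poincare; have := hK _ hu.
rewrite u0 mulr0 => h; apply: L2norm_eq0; first by case: (H10_H1 hu).
by apply/eqP; rewrite eq_le h L2norm_ge0.
Qed.

(** The limit is taken for the extensions by zero on all of R^n; cutting it off outside Omega does
    not increase any of the distances. *)
Lemma L2_complete_Omega (u : nat -> X -> R) (c : R) : 0 <= c -> (forall k, L2 (u k)) ->
  (forall k, L2norm (u k.+1 - u k) <= c * 4^-1 ^+ k) ->
  exists2 v, L2 v & forall k, L2norm (v - u k) <= 2 * c * 4^-1 ^+ k.
Proof.
move=> c0 hu uc.
have [|v vL hv] := @L2_complete _ _ R leb (fun k => (u k) \_ Omega) c c0 hu.
  by move=> k; have := uc k; rewrite /Defs.L2norm /L2norme patchB.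
have mv : measurable_fun setT (v \_ Omega).
  apply: (measurable_restrictT v (mOm oOm)).1; apply: measurable_funTS; exact: (L2_mfun vL).
have dv k : v \_ Omega - (u k) \_ Omega = (v - (u k) \_ Omega) \_ Omega.
  rewrite patchB; congr (_ - _); apply/funext => x; rewrite /patch.
  by case: ifPn => // xO; rewrite xO.
have main k : v \_ Omega - (u k) \_ Omega \in Lfun leb 2%:E /\
    nrm2 leb (v \_ Omega - (u k) \_ Omega) <= 1 * nrm2 leb (v - (u k) \_ Omega).
  apply: nrm2_dominated => //; [|exact: (L2B vL (hu k))|].
    by apply: measurable_funB => //; exact: L2_mfun (hu k).
  apply: aeW => x; rewrite mul1r dv /patch; case: ifP => // _; by rewrite normr0.
exists v => [|k].
  have := L2D (main 0%N).1 (hu 0%N).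
  by rewrite subrK.
rewrite /Defs.L2norm /L2norme patchB; have := (main k).2; rewrite mul1r => h.
exact: le_trans h (hv k).
Qed.

(** Poincare makes a gradient-Cauchy sequence Cauchy in L2, and the L2 limits of the derivatives are
    weak derivatives of the limit. The constant [C] is left free: [HH_complete] recovers the sharp
    one. *)
Lemma H10_complete (u : nat -> X -> R) (c : R) : 0 <= c -> (forall k, H10 (u k)) ->
  (forall k, gradnorm (u k.+1 - u k) <= c * 4^-1 ^+ k) ->
  exists2 v, H10 v & exists C : R, forall k, gradnorm (v - u k) <= C * 4^-1 ^+ k.
Proof.
move=> c0 hu uc; have hu1 k := H10_H1 (hu k).
have H10_sub k l : H10 (u k - u l).
  by rewrite addrC -scaleN1r; apply: (H10_lin oOm).
have [K K0 hK] := poincare.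
have [|||v vL vlim] := @L2_complete_Omega u (K * c).
- by rewrite mulr_ge0// ltW.
- by move=> k; case: (hu1 k).
- move=> k; apply: le_trans (hK _ (H10_sub _ _)) _.
  by rewrite -mulrA ler_wpM2l// ltW.
have /choice[dv hdv] i : exists dv, L2 dv /\ forall k, L2norm (dv - wpartial i (u k)) <= 2 * c * 4^-1 ^+ k.
  have [|||w wL wlim] := @L2_complete_Omega (fun k => wpartial i (u k)) c => //.
  - by move=> k; case: (H1_wpartial i (hu1 k)).
  - move=> k; apply: le_trans (uc k); apply: le_trans (le_gradnorm i _).
    have := weak_partial_lin (-1) (H1_wpartial i (hu1 k)) (H1_wpartial i (hu1 k.+1)).
    by rewrite !scaleN1r ![- _ + _]addrC => /(wpartial_norm oOm) ->.
  by exists w.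
have wv i : weak_partial i v (dv i).
  have [dvL dvlim] := hdv i; split=> // phi tp.
  have tdp := test_partial i tp.
  have pL := test_L2 tp; have dpL := test_L2 tdp.
  rewrite -!/(ip _ _); apply/eqP; rewrite -subr_eq0 opprK -normr_eq0 eq_le normr_ge0 andbT.
  pose B := 2 * (K * c) * L2norm (partial i phi) + 2 * c * L2norm phi.
  (* Both pairings with a test function are L2-continuous, and for u_k their sum is exactly zero;
     what remains is of order 4^-k. *)
  have HB k : `|ip v (partial i phi) + ip (dv i) phi| <= B * 4^-1 ^+ k.
    have [ukL wkL wk] := H1_wpartial i (hu1 k).
    have e1 : ip v (partial i phi) = ip (v - u k) (partial i phi) + ip (u k) (partial i phi).
      by rewrite -ipDl ?subrK//; exact: L2_sub.
    have e2 : ip (dv i) phi = ip (dv i - wpartial i (u k)) phi + ip (wpartial i (u k)) phi.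
      by rewrite -ipDl ?subrK//; exact: L2_sub.
    have e3 : ip (u k) (partial i phi) = - ip (wpartial i (u k)) phi by exact: wk.
    rewrite e1 e2 e3 addrACA addNr addr0.
    apply: le_trans (ler_normD _ _) _; rewrite /B mulrDl.
    apply: lerD; apply: le_trans (ip_le _ _) _ => //; try exact: L2_sub.
      by rewrite [X in _ <= X]mulrAC ler_wpM2r ?L2norm_ge0//; exact: vlim.
    by rewrite [X in _ <= X]mulrAC ler_wpM2r ?L2norm_ge0//; exact: dvlim.
  by apply: (ler_cvg_to (cvg_cst _) (cvg4 B)); apply: nearW => k; exact: HB.
have hv1 : H1 v by split=> // i; exists (dv i).
have gv k : gradnorm (v - u k) <= (n.+1%:R * (2 * c)) * 4^-1 ^+ k.
  apply: le_trans (sqrt_sum_le _ _) _ => [i|]; first exact: L2norm_ge0.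
  apply: (@le_trans _ _ (\sum_(i < n.+1) 2 * c * 4^-1 ^+ k)).
    apply: ler_sum => i _; have [dvL dvlim] := hdv i.
    have := weak_partial_lin (-1) (H1_wpartial i (hu1 k)) (wv i).
    by rewrite !scaleN1r ![- _ + _]addrC => /(wpartial_norm oOm) ->.
  by rewrite sumr_const card_ord -[X in X <= _]mulr_natl !mulrA.
exists v; last by exists (n.+1%:R * (2 * c)).
apply/H10P; split=> // e e0.
have small (C : R) : \forall k \near \oo, C * 4^-1 ^+ k < e / 2.
  by apply: (near_small (cvg4 C)); rewrite divr_gt0.
(* Half of e for the distance to [u k], the other half for a test function approximating [u k]. *)
have [k [k1 k2]] : exists k : nat, 2 * (K * c) * 4^-1 ^+ k < e / 2 /\ (n.+1%:R * (2 * c)) * 4^-1 ^+ k < e / 2.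
  have : \forall k \near \oo, 2 * (K * c) * 4^-1 ^+ k < e / 2 /\ (n.+1%:R * (2 * c)) * 4^-1 ^+ k < e / 2.
    by apply: filterS2 (small (2 * (K * c))) (small (n.+1%:R * (2 * c))) => k h1 h2; split.
  by move=> [N _ hN]; exists N; apply: hN => /=; exact: leqnn.
have [_ /(_ (e / 2))[]] := (@H10P R n Omega (u k)).1 (hu k); first by rewrite divr_gt0.
move=> phi [tp p1 p2]; exists phi; split=> //.
- have -> : v - phi = (v - u k) + (u k - phi) by rewrite addrA subrK.
  apply: le_lt_trans (L2normD _ _) _.
  + by apply: L2_sub => //; case: (hu1 k).
  + by apply: L2_sub; [case: (hu1 k)|exact: test_L2].
  by rewrite [e]splitr; exact: (ltrD (le_lt_trans (vlim k) k1) p1).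
- have -> : v - phi = (v - u k) + (u k - phi) by rewrite addrA subrK.
  apply: le_lt_trans (gradnormD oOm (H1_sub hv1 (hu1 k)) (H1_sub (hu1 k) (test_H1 tp))) _.
  by rewrite [e]splitr; exact: (ltrD (le_lt_trans (gv k) k2) p2).
Qed.

End poincare.

(** Arithmetic of [hnorm_opF]: h is the energy norm of the source difference, with only two nonzero
    components x1 and x3, and the g's are the components of the state difference. *)
Lemma two_components_le (R : realType) (h k l x1 x3 g1 g2 g3 g4 : R) :
  0 <= h -> 0 <= k -> 0 <= l -> 0 <= x1 -> 0 <= x3 -> 0 <= g1 -> 0 <= g3 ->
  h ^+ 2 = x1 ^+ 2 + x3 ^+ 2 -> k ^+ 2 = g1 ^+ 2 + g2 ^+ 2 + g3 ^+ 2 + g4 ^+ 2 ->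
  x1 <= l * g1 -> x3 <= l * g3 -> h <= l * k.
Proof.
move=> h0 k0 l0 x10 x30 g10 g30 hE kE d1 d3.
have s1 : x1 ^+ 2 <= l ^+ 2 * g1 ^+ 2 by rewrite -exprMn ler_pXn2r ?nnegrE ?mulr_ge0.
have s3 : x3 ^+ 2 <= l ^+ 2 * g3 ^+ 2 by rewrite -exprMn ler_pXn2r ?nnegrE ?mulr_ge0.
rewrite -(@ler_pXn2r _ 2) ?nnegrE ?mulr_ge0// exprMn hE kE.
apply: le_trans (lerD s1 s3) _; rewrite -mulrDr ler_wpM2l ?sqr_ge0//.
have := sqr_ge0 g2; have := sqr_ge0 g4; lra.
Qed.

(** * The energy space *)

(* Representatives that agree a.e. are at distance 0, so the energy is only a seminorm. *)
Record seminorm_on (R : realType) (V : lmodType R) (HH : set V) (p : V -> R) : Prop := {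
  csn_0 : HH 0;
  csn_lin : forall a U W, HH U -> HH W -> HH (a *: U + W);
  csn_ge0 : forall U, 0 <= p U;
  csnD : forall U W, HH U -> HH W -> p (U + W) <= p U + p W;
  csnZ : forall a U, HH U -> p (a *: U) = `|a| * p U }.

(** Only sequences with increments c 4^-k occur, from Picard iterates and from simple-function
    integrals; 2 c 4^-k is the telescoped tail. *)
Record complete_seminorm (R : realType) (V : lmodType R) (HH : set V) (p : V -> R) : Prop := {
  csn_seminorm :> seminorm_on HH p;
  csn_complete : forall (U : nat -> V) (c : R), 0 <= c -> (forall k, HH (U k)) ->
    (forall k, p (U k.+1 - U k) <= c * 4^-1 ^+ k) ->
    exists2 W, HH W & forall k, p (W - U k) <= 2 * c * 4^-1 ^+ k }.

Section seminorm.
Context (R : realType) (V : lmodType R) (HH : set V) (p : V -> R).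
Hypothesis Hp : seminorm_on HH p.
Implicit Types U W : V.

Lemma csn_add U W : HH U -> HH W -> HH (U + W).
Proof. by move=> hU hW; rewrite -[U]scale1r; exact: (csn_lin Hp). Qed.
Lemma csn_scale a U : HH U -> HH (a *: U).
Proof. by move=> hU; rewrite -[_ *: _]addr0; exact: (csn_lin Hp a hU (csn_0 Hp)). Qed.
Lemma csn_opp U : HH U -> HH (- U).
Proof. by rewrite -scaleN1r; exact: csn_scale. Qed.
Lemma csn_sub U W : HH U -> HH W -> HH (U - W).
Proof. by move=> hU hW; apply: csn_add => //; exact: csn_opp. Qed.
Lemma csn_sum (I : Type) (r : seq I) (F : I -> V) : (forall i, HH (F i)) -> HH (\sum_(i <- r) F i).
Proof. by move=> hF; elim/big_ind : _ => //; [exact: csn_0 Hp|exact: csn_add]. Qed.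
Lemma csn_norm0 : p 0 = 0.
Proof. by rewrite -(scale0r 0) (csnZ Hp _ (csn_0 Hp)) normr0 mul0r. Qed.
Lemma csn_normN U : HH U -> p (- U) = p U.
Proof. by move=> hU; rewrite -scaleN1r (csnZ Hp)// normrN1 mul1r. Qed.
Lemma csnB U W : HH U -> HH W -> p (U - W) <= p U + p W.
Proof. by move=> hU hW; rewrite -(csn_normN hW); apply: (csnD Hp) => //; exact: csn_opp. Qed.
Lemma csn_subC U W : HH U -> HH W -> p (U - W) = p (W - U).
Proof. by move=> hU hW; rewrite -csn_normN ?opprB//; exact: csn_sub. Qed.
Lemma csn_triangle U W Z : HH U -> HH W -> HH Z -> p (U - Z) <= p (U - W) + p (W - Z).
Proof.
move=> hU hW hZ; have -> : U - Z = (U - W) + (W - Z) by rewrite addrA subrK.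
by apply: (csnD Hp); exact: csn_sub.
Qed.
Lemma csn_le_add U W : HH U -> HH W -> p U <= p W + p (U - W).
Proof. by move=> hU hW; rewrite -{1}[U](subrK W) addrC; apply: (csnD Hp) => //; exact: csn_sub. Qed.

End seminorm.

Section energy.
Context (R : realType) (n : nat).
Local Notation X := 'rV[R]_n.+1.
Local Notation leb := (@lebesgue_rV R n.+1).
Context (Omega : set X) (oOm : open Omega) (bOm : bounded_set Omega).
Local Notation HH := (energy_space Omega).
Local Notation hnorm := (energy_norm Omega).
Local Notation state := (state R n).
Implicit Types U V W : state.

(** Indexing the four seminorms by numbers puts the energy norm in the form treated by
    [sqrt_sum_triangle]. *)
Definition energy_component U (i : nat) : R :=
  match i with
  | 0 => gradnorm Omega U.1.1
  | 1 => L2norm Omega U.1.2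
  | 2 => gradnorm Omega U.2.1
  | _ => L2norm Omega U.2.2
  end.

Lemma energy_normE U : hnorm U = Num.sqrt (\sum_(i <- iota 0 4) energy_component U i ^+ 2).
Proof. by rewrite /energy_norm !big_cons big_nil addr0 /= !addrA. Qed.

Lemma energy_component_ge0 U i : 0 <= energy_component U i.
Proof. by case: i => [|[|[|i]]]; rewrite ?gradnorm_ge0 ?L2norm_ge0. Qed.

Lemma hnorm_sqr U : hnorm U ^+ 2 = gradnorm Omega U.1.1 ^+ 2 + L2norm Omega U.1.2 ^+ 2
          + gradnorm Omega U.2.1 ^+ 2 + L2norm Omega U.2.2 ^+ 2.
Proof. by rewrite sqr_sqrtr// !addr_ge0 ?sqr_ge0. Qed.

Lemma HH_lin a U V : HH U -> HH V -> HH (a *: U + V).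
Proof.
move=> [u1 u2 u3 u4] [v1 v2 v3 v4]; split.
- exact: (H10_lin oOm a u1 v1).
- exact: (L2_add (L2_scale a u2) v2).
- exact: (H10_lin oOm a u3 v3).
- exact: (L2_add (L2_scale a u4) v4).
Qed.

Lemma HH0 : HH 0.
Proof. by split; [exact: H10_0|exact: L2_zero|exact: H10_0|exact: L2_zero]. Qed.

Lemma hnorm_ge0 U : 0 <= hnorm U. Proof. exact: sqrtr_ge0. Qed.

Lemma hnormD U V : HH U -> HH V -> hnorm (U + V) <= hnorm U + hnorm V.
Proof.
move=> [u1 u2 u3 u4] [v1 v2 v3 v4]; rewrite !energy_normE.
apply: sqrt_sum_triangle => i; rewrite ?energy_component_ge0//=.
case: i => [|[|[|i]]] /=.
- exact: (gradnormD oOm (H10_H1 u1) (H10_H1 v1)).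
- exact: (L2normD u2 v2).
- exact: (gradnormD oOm (H10_H1 u3) (H10_H1 v3)).
- exact: (L2normD u4 v4).
Qed.

Lemma hnormZ a U : HH U -> hnorm (a *: U) = `|a| * hnorm U.
Proof.
move=> [u1 u2 u3 u4]; rewrite !energy_normE -sqrtr_sqr -sqrtrM ?sqr_ge0// mulr_sumr.
congr Num.sqrt; apply: eq_bigr => i _; rewrite -[a ^+ 2]real_normK ?num_real// -exprMn; congr (_ ^+ 2).
case: i => [|[|[|i]]] /=.
- exact: (gradnormZ oOm a (H10_H1 u1)).
- exact: (L2normZ a u2).
- exact: (gradnormZ oOm a (H10_H1 u3)).
- exact: (L2normZ a u4).
Qed.

Lemma energy_seminorm : seminorm_on HH hnorm.
Proof. by split; [exact: HH0|exact: HH_lin|exact: hnorm_ge0|exact: hnormD|exact: hnormZ]. Qed.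

Let Hp := energy_seminorm.

Lemma le_energy_component U i : (i < 4)%N -> energy_component U i <= hnorm U.
Proof.
move=> i4; rewrite energy_normE -[X in X <= _](ger0_norm (energy_component_ge0 U i)) -sqrtr_sqr.
rewrite ler_wsqrtr// (big_rem i) ?mem_iota//= lerDl.
by apply: sumr_ge0 => j _; exact: sqr_ge0.
Qed.

Lemma hnorm_le_sum U : hnorm U <=
  gradnorm Omega U.1.1 + L2norm Omega U.1.2 + gradnorm Omega U.2.1 + L2norm Omega U.2.2.
Proof.
rewrite energy_normE; apply: le_trans (sqrt_sum_le _ _) _; first exact: energy_component_ge0.
by rewrite !big_cons big_nil addr0 !addrA.
Qed.

Lemma ae_eq_sub (u v : X -> R) : ae_eq leb Omega (u - v) 0 <-> ae_eq leb Omega u v.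
Proof.
split; apply: filterS => x h xO; have := h xO; rewrite /GRing.add/= /GRing.opp/=.
  by move=> /eqP; rewrite subr_eq0 => /eqP.
by move=> ->; rewrite subrr.
Qed.

(** From right to left the position components need Poincare. From left to right the point is that a
    function vanishing a.e. has weak gradient 0, which is checked against test functions. *)
Lemma state_eqP U V : HH U -> HH V -> state_eq Omega U V <-> hnorm (U - V) = 0.
Proof.
move=> hu hv; have [w1 w2 w3 w4] := csn_sub Hp hu hv.
have z u : L2 Omega u -> ae_eq leb Omega u 0 -> L2norm Omega u = 0.
  by move=> hu0 u0; rewrite (L2norm_ae hu0 (@L2_zero R n Omega) u0) L2norm0.
have zg u : H10 Omega u -> ae_eq leb Omega u 0 -> gradnorm Omega u = 0.
  move=> /H10_H1 hu0 u0; rewrite /gradnorm big1 ?sqrtr0// => i _.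
  have [uL wL h] := H1_wpartial i hu0.
  have W0 : weak_partial Omega i u 0.
    split=> //; first exact: L2_zero.
    move=> phi tp; rewrite -!/(ip _ _ _).
    have dpL := test_L2 (test_partial i tp).
    rewrite (ip0l (test_L2 tp)) oppr0.
    have := ip_le uL dpL; rewrite (z _ uL u0) mul0r normr_le0 => /eqP.
    exact.
  by rewrite (wpartial_norm oOm W0) L2norm0 expr0n.
split.
  move=> [/ae_eq_sub e1 /ae_eq_sub e2 /ae_eq_sub e3 /ae_eq_sub e4].
  apply/eqP; rewrite eq_le hnorm_ge0 andbT; apply: le_trans (hnorm_le_sum _) _.
  by rewrite (zg _ w1 e1) (z _ w2 e2) (zg _ w3 e3) (z _ w4 e4) !addr0.
move=> h0.
have c0 i : (i < 4)%N -> energy_component (U - V) i = 0.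
  by move=> /(le_energy_component (U - V)); rewrite h0 => h; apply/eqP; rewrite eq_le h energy_component_ge0.
split; apply/ae_eq_sub.
- exact: H10_separated w1 (c0 0%N _).
- exact: L2norm_eq0 w2 (c0 1%N _).
- exact: H10_separated w3 (c0 2%N _).
- exact: L2norm_eq0 w4 (c0 3%N _).
Qed.

Lemma hnorm_eq_trans U V W : HH U -> HH V -> HH W -> state_eq Omega U V ->
  hnorm (U - W) = hnorm (V - W).
Proof.
move=> hu hv hw /(state_eqP hu hv) uv.
have vu : hnorm (V - U) = 0 by have := csn_subC Hp hu hv; rewrite uv => <-.
apply/eqP; rewrite eq_le -{1}[hnorm (V - W)]add0r -{1}uv (csn_triangle Hp)//=.
by rewrite -{1}[hnorm (U - W)]add0r -{1}vu (csn_triangle Hp).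
Qed.

Lemma hnorm_state_eq U V : HH U -> HH V -> state_eq Omega U V -> hnorm U = hnorm V.
Proof. by move=> hu hv /(hnorm_eq_trans hu hv HH0); rewrite !subr0. Qed.

Lemma HH_complete (U : nat -> state) (c : R) : 0 <= c -> (forall k, HH (U k)) ->
  (forall k, hnorm (U k.+1 - U k) <= c * 4^-1 ^+ k) ->
  exists2 V, HH V & forall k, hnorm (V - U k) <= 2 * c * 4^-1 ^+ k.
Proof.
move=> c0 hU Uc.
have comp i k : (i < 4)%N -> energy_component (U k.+1 - U k) i <= c * 4^-1 ^+ k.
  by move=> i4; exact: le_trans (le_energy_component _ i4) (Uc k).
have [||v1 v1H [C1 hC1]] := @H10_complete R n Omega oOm bOm (fun k => (U k).1.1) c c0.
- by move=> k; have [] := hU k.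
- by move=> k; exact: (comp 0%N).
have [||v2 v2H hC2] := @L2_complete_Omega R n Omega oOm (fun k => (U k).1.2) c c0.
- by move=> k; have [] := hU k.
- by move=> k; exact: (comp 1%N).
have [||v3 v3H [C3 hC3]] := @H10_complete R n Omega oOm bOm (fun k => (U k).2.1) c c0.
- by move=> k; have [] := hU k.
- by move=> k; exact: (comp 2%N).
have [||v4 v4H hC4] := @L2_complete_Omega R n Omega oOm (fun k => (U k).2.2) c c0.
- by move=> k; have [] := hU k.
- by move=> k; exact: (comp 3%N).
pose V : state := ((v1, v2), (v3, v4)).
have hV : HH V by split; [exact: v1H|exact: v2H|exact: v3H|exact: v4H].
exists V => // k.
have lim l : hnorm (V - U l) <= (C1 + 2 * c + C3 + 2 * c) * 4^-1 ^+ l.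
  apply: le_trans (hnorm_le_sum _) _.
  have -> : (C1 + 2 * c + C3 + 2 * c) * 4^-1 ^+ l = C1 * 4^-1 ^+ l + 2 * c * 4^-1 ^+ l +
    C3 * 4^-1 ^+ l + 2 * c * 4^-1 ^+ l by ring.
  by apply: lerD; [apply: lerD; [apply: lerD|]|]; [exact: hC1|exact: hC2|exact: hC3|exact: hC4].
have tel l : (k <= l)%N -> hnorm (U l - U k) <= 2 * c * 4^-1 ^+ k.
  apply: (@geometric_telescope _ (fun k l => hnorm (U l - U k))) => //.
    by move=> j; rewrite subrr (csn_norm0 Hp).
  move=> i j ij; apply: le_trans (csn_triangle Hp (hU j.+1) (hU j) (hU i)) _.
  by rewrite [X in X <= _]addrC lerD2l; exact: Uc.
set C := C1 + _ + _ + _ in lim; set D := 2 * c * 4^-1 ^+ k.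
(* The constants of the component limits are uncontrolled, but they multiply 4^-l; letting l tend to
   infinity leaves the telescoped bound [D]. *)
have H : (fun l => C * 4^-1 ^+ l + D) @ \oo --> 0 + D.
  by apply: cvgD; [exact: cvg4|exact: cvg_cst].
rewrite -[D]add0r; apply: (ler_cvg_to (cvg_cst _) H).
exists k => // l /= kl; apply: le_trans (csn_triangle Hp hV (hU l) (hU k)) _.
by apply: lerD; [exact: lim|exact: tel].
Qed.

Context (a2 : X -> R) (a2L : Linfty Omega a2).
Local Notation beta := (Linftynorm Omega a2).

Lemma Linftynorm_ge0 : 0 <= beta. Proof. by rewrite fine_ge0// Lnorm_ge0. Qed.

Lemma a2_meas : measurable_fun setT (a2 \_ Omega).
Proof. by move: a2L; rewrite /Linfty/= inE => /andP[/[!inE]]. Qed.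

Lemma a2_ae : {ae leb, forall x, `|(a2 \_ Omega) x| <= beta}.
Proof.
have fin : 'N[leb]_+oo%E[EFin \o (a2 \_ Omega)]%E \is a fin_num.
  by move: a2L; rewrite /Linfty/= inE => /andP[_ /[!inE]/= h]; rewrite ge0_fin_numE// Lnorm_ge0.
(* The norm is the essential supremum when the whole space has positive measure; in the other case
   every set is null and the bound holds trivially. *)
have := fineK fin; rewrite -/beta [in RHS]unlock /=; case: ifPn => [m0 E|m0 _]; last first.
  exists setT; split=> //.
  by apply/eqP; rewrite eq_le measure_ge0 andbT leNgt.
have /ess_supP : (ess_sup leb (abse \o (EFin \o (a2 \_ Omega))) <= beta%:E)%E by rewrite E.
by apply: filterS => x /=; rewrite lee_fin.
Qed.

Lemma L2_mul_Linfty (y : X -> R) : L2 Omega y ->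
  L2 Omega (fun x => a2 x * y x) /\ L2norm Omega (fun x => a2 x * y x) <= beta * L2norm Omega y.
Proof.
move=> hy.
have E : (fun x => a2 x * y x) \_ Omega = (a2 \_ Omega) \* (y \_ Omega).
  by apply/funext => x /=; rewrite /patch; case: ifP => _; rewrite ?mulr0.
have := @nrm2_dominated _ _ R leb ((fun x => a2 x * y x) \_ Omega) (y \_ Omega) beta Linftynorm_ge0.
apply=> //.
  by rewrite E; apply: measurable_funM; [exact: a2_meas|exact: L2_mfun hy].
by apply: filterS a2_ae => x ax; rewrite E /= normrM ler_wpM2r.
Qed.

Lemma hnorm_velocity2 (u : X -> R) : hnorm ((0, 0), (0, u)) = L2norm Omega u.
Proof.
rewrite /energy_norm /= gradnorm0// L2norm0 expr0n /= !add0r sqrtr_sqr ger0_norm//.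
exact: L2norm_ge0.
Qed.

Lemma HH_velocity2 (u : X -> R) : L2 Omega u -> HH ((0, 0), (0, u)).
Proof. by move=> hu; split => //=; [exact: H10_0|exact: L2_zero|exact: H10_0]. Qed.

Lemma HH_opB U : HH U -> HH (opB a2 U).
Proof. by move=> [_ _ _ h]; apply: HH_velocity2; have [] := L2_mul_Linfty h. Qed.

Lemma opB_sub U V : opB a2 U - opB a2 V = opB a2 (U - V).
Proof.
by congr ((_, _), (_, _)); apply/funext => x; rewrite /GRing.add/= /GRing.opp/= ?subrr// mulrBr.
Qed.

Lemma hnorm_opB U : HH U -> hnorm (opB a2 U) <= beta * hnorm U.
Proof.
move=> hU; have [_ _ _ h] := hU; rewrite hnorm_velocity2.
apply: le_trans (L2_mul_Linfty h).2 _.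
by rewrite ler_wpM2l ?Linftynorm_ge0// (@le_energy_component U 3).
Qed.

Context (f1 f2 L : R -> R).
Hypothesis f_N : hypothesis_N Omega f1 f2 L.

(** Finiteness of the norm comes from comparison with v = 0, the Lipschitz hypothesis being an
    inequality between extended reals. The condition f 0 = 0 also makes composition commute with
    extension by zero. *)
Lemma L2_comp_source (f : R -> R) (r : R) u : continuous f -> f 0 = 0 ->
  local_lipschitz_source Omega L f -> 0 < r -> H10 Omega u -> gradnorm Omega u <= r ->
  L2 Omega (f \o u).
Proof.
move=> cf f0 lf r0 hu ur.
have E : (f \o u) \_ Omega = f \o (u \_ Omega).
  by apply/funext => x /=; rewrite /patch; case: ifP.
rewrite /Defs.L2/= inE; apply/andP; split; rewrite inE/=.
  rewrite E; apply: measurableT_comp; first exact: continuous_measurable_fun.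
  by have [/L2_mfun] := H10_H1 hu.
have := lf r u 0 r0 hu (@H10_0 R n Omega oOm) ur; rewrite gradnorm0// => /(_ (ltW r0)).
move=> /le_lt_trans/(_ (ltry _)); rewrite /finite_norm /L2norme.
have -> : (fun x => f (u x) - f ((0 : X -> R) x)) = f \o u.
  by apply/funext => x; have e : f ((0 : X -> R) x) = 0 := f0; rewrite e subr0.
by [].
Qed.

Lemma L2_source_diff (f : R -> R) (r : R) u v : continuous f -> f 0 = 0 ->
  local_lipschitz_source Omega L f -> 0 < r -> H10 Omega u -> H10 Omega v ->
  gradnorm Omega u <= r -> gradnorm Omega v <= r ->
  L2norm Omega ((f \o u) - (f \o v)) <= L r * gradnorm Omega (u - v).
Proof.
move=> cf f0 lf r0 hu hv ur vr.
have h1 := L2_comp_source cf f0 lf r0 hu ur; have h2 := L2_comp_source cf f0 lf r0 hv vr.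
have := lf r u v r0 hu hv ur vr.
rewrite -lee_fin /L2norm fineK //.
exact: L2_fin (L2_sub h1 h2).
Qed.

Lemma le_gradnorm_hnorm U : gradnorm Omega U.1.1 <= hnorm U /\ gradnorm Omega U.2.1 <= hnorm U.
Proof. by split; [exact: (@le_energy_component U 0)|exact: (@le_energy_component U 2)]. Qed.

Lemma HH_opF U : HH U -> HH (opF f1 f2 U).
Proof.
move=> [u1 _ u3 _]; have [[c1 c2] [z1 z2] _ [l1 l2] _] := f_N.
have [g1 g2] := le_gradnorm_hnorm U.
(* The Lipschitz hypothesis needs a positive radius, and [hnorm U] may vanish. *)
have r0 : 0 < hnorm U + 1 by rewrite ltr_wpDl// hnorm_ge0.
have ur : hnorm U <= hnorm U + 1 by rewrite lerDl.
split => /=; [exact: H10_0| |exact: H10_0|].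
  exact: (L2_comp_source c1 z1 l1 r0 u1 (le_trans g1 ur)).
exact: (L2_comp_source c2 z2 l2 r0 u3 (le_trans g2 ur)).
Qed.

Lemma hnorm_opF (r : R) U V : 0 < r -> HH U -> HH V -> hnorm U <= r -> hnorm V <= r ->
  hnorm (opF f1 f2 U - opF f1 f2 V) <= L r * hnorm (U - V).
Proof.
move=> r0 [u1 _ u3 _] [v1 _ v3 _] ur vr.
have [[c1 c2] [z1 z2] [L0 _] [l1 l2] _] := f_N.
have [gu1 gu3] := le_gradnorm_hnorm U; have [gv1 gv3] := le_gradnorm_hnorm V.
have Lr0 : 0 <= L r by rewrite ltW// L0.
have d1 := L2_source_diff c1 z1 l1 r0 u1 v1 (le_trans gu1 ur) (le_trans gv1 vr).
have d3 := L2_source_diff c2 z2 l2 r0 u3 v3 (le_trans gu3 ur) (le_trans gv3 vr).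
have E : hnorm (opF f1 f2 U - opF f1 f2 V) ^+ 2 =
    L2norm Omega ((f1 \o U.1.1) - (f1 \o V.1.1)) ^+ 2 + L2norm Omega ((f2 \o U.2.1) - (f2 \o V.2.1)) ^+ 2.
  rewrite hnorm_sqr; have c00 : (cst 0 : X -> R) - cst 0 = 0 by exact: subrr.
  have -> : (opF f1 f2 U - opF f1 f2 V).1.1 = 0 by exact: c00.
  have -> : (opF f1 f2 U - opF f1 f2 V).2.1 = 0 by exact: c00.
  by rewrite gradnorm0// expr0n /= add0r addr0.
exact: (two_components_le (hnorm_ge0 _) (hnorm_ge0 _) Lr0 (L2norm_ge0 _ _) (L2norm_ge0 _ _)
  (gradnorm_ge0 _ _) (gradnorm_ge0 _ _) E (hnorm_sqr (U - V)) d1 d3).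
Qed.

Lemma opF0 : opF f1 f2 (0 : state) = 0.
Proof.
by have [_ [z1 z2] _ _ _] := f_N; congr ((_, _), (_, _)); apply/funext => x /=; rewrite ?z1 ?z2.
Qed.

Lemma hnorm_opF_le (r : R) U : 0 < r -> HH U -> hnorm U <= r ->
  hnorm (opF f1 f2 U) <= L r * hnorm U.
Proof.
move=> r0 hU ur; have := hnorm_opF r0 hU HH0 ur; rewrite (csn_norm0 Hp) opF0 !subr0.
by apply; exact: ltW.
Qed.

End energy.

(** * Bochner integrals *)

Lemma measure_lty_subset d (T : measurableType d) (R : realType) (mu : {measure set T -> \bar R})
  (A B : set T) : measurable A -> measurable B -> A `<=` B -> (mu B < +oo)%E -> (mu A < +oo)%E.
Proof. by move=> mA mB AB; apply: le_lt_trans; apply: le_measure; rewrite ?inE. Qed.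

Section bochner.
Context (R : realType) (V : lmodType R) (HH : set V) (p : V -> R).
Hypothesis Hp : complete_seminorm HH p.
Local Notation mu := (@lebesgue_measure R).
Implicit Types (U W v : V) (D : set R).

Let HH0 : HH 0. Proof. exact: csn_0 Hp. Qed.
Let p0 U : 0 <= p U. Proof. exact: csn_ge0 Hp _. Qed.

Definition simple_fun (N : nat) (E : nat -> set R) (w : nat -> V) (s : R) : V :=
  \sum_(k < N) \1_(E k) s *: w k.
Definition simple_int (N : nat) (E : nat -> set R) (w : nat -> V) : V :=
  \sum_(k < N) fine (mu (E k)) *: w k.

Lemma csn_simple_fun N E w s : (forall k, HH (w k)) -> HH (simple_fun N E w s).
Proof. by move=> hw; apply: (csn_sum Hp) => i; exact: (csn_scale Hp). Qed.
Lemma csn_simple_int N E w : (forall k, HH (w k)) -> HH (simple_int N E w).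
Proof. by move=> hw; apply: (csn_sum Hp) => i; exact: (csn_scale Hp). Qed.

(* The indicator functions are removed one at a time: the domain is split along the last
   set, on which the corresponding vector joins the constant [c]. *)
Lemma simple_int_le_aux N : forall D c E w (m : R -> R), measurable D -> (mu D < +oo)%E ->
  HH c -> (forall k, measurable (E k)) -> (forall k, HH (w k)) -> measurable_fun D m ->
  (forall s, D s -> p (c + simple_fun N E w s) <= m s) ->
  ((p (fine (mu D) *: c + simple_int N (fun k => E k `&` D) w))%:E <= \int[mu]_(s in D) (m s)%:E)%E.
Proof.
elim: N => [|N IH] D c E w m mD Doo hc mE hw mm pm.
  rewrite /simple_int big_ord0 addr0 (csnZ Hp)// ger0_norm ?fine_ge0// EFinM fineK ?ge0_fin_numE//.
  rewrite muleC -integral_cst//; apply: ge0_le_integral => //.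
  - by move=> s _; rewrite lee_fin.
  - by apply/measurable_EFinP.
  by move=> s Ds; have := pm s Ds; rewrite /simple_fun big_ord0 addr0 lee_fin.
have m0 s : D s -> 0 <= m s by move=> Ds; exact: le_trans (p0 _) (pm s Ds).
pose D1 := D `&` E N; pose D2 := D `\` E N.
have mD1 : measurable D1 by exact: measurableI.
have mD2 : measurable D2 by exact: measurableD.
have D12 : D = D1 `|` D2 by rewrite /D1 /D2 setUIDK.
have d12 : [disjoint D1 & D2]%classic by apply/disj_setPS => s [[_ h] [_ h']].
have oo1 : (mu D1 < +oo)%E by apply: measure_lty_subset Doo => //; exact: subIsetl.
have oo2 : (mu D2 < +oo)%E by apply: measure_lty_subset Doo => //; exact: subDsetl.
have I12 (A : set R) : measurable A -> fine (mu (A `&` D)) = fine (mu (A `&` D1)) + fine (mu (A `&` D2)).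
  move=> mA; rewrite D12 setIUr measureU//; last 3 first.
  - exact: measurableI.
  - exact: measurableI.
  - by apply/seteqP; split=> // s [[_ [_ h]] [_ [_ h']]].
  rewrite fineD// ge0_fin_numE//.
    by apply: measure_lty_subset oo1; [exact: measurableI|by []|exact: subIsetr].
  by apply: measure_lty_subset oo2; [exact: measurableI|by []|exact: subIsetr].
have -> : fine (mu D) *: c + simple_int N.+1 (fun k => E k `&` D) w =
    (fine (mu D1) *: (c + w N) + simple_int N (fun k => E k `&` D1) w) +
    (fine (mu D2) *: c + simple_int N (fun k => E k `&` D2) w).
  rewrite /simple_int big_ord_recr/=.
  have -> : fine (mu D) = fine (mu D1) + fine (mu D2).
    by have := I12 setT measurableT; rewrite !setTI.
  have -> : E N `&` D = D1 by rewrite setIC.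
  have -> : \sum_(k < N) fine (mu (E k `&` D)) *: w k =
     \sum_(k < N) fine (mu (E k `&` D1)) *: w k + \sum_(k < N) fine (mu (E k `&` D2)) *: w k.
    by rewrite -big_split/=; apply: eq_bigr => k _; rewrite -scalerDl I12.
  by rewrite scalerDl scalerDr [LHS](AC (2*(2*1)) ((1*5*3)*(2*4))).
apply: le_trans (_ : (_ <= (p (fine (mu D1) *: (c + w N) + simple_int N (fun k => E k `&` D1) w))%:E +
    (p (fine (mu D2) *: c + simple_int N (fun k => E k `&` D2) w))%:E)%E) _.
  rewrite -EFinD lee_fin; apply: (csnD Hp); apply: (csn_add Hp); try exact: csn_simple_int.
    by apply: (csn_scale Hp); exact: (csn_add Hp).
  exact: (csn_scale Hp).
have -> : (\int[mu]_(s in D) (m s)%:E = \int[mu]_(s in D1) (m s)%:E + \int[mu]_(s in D2) (m s)%:E)%E.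
  rewrite {1}D12 ge0_integral_setU//; first by rewrite -D12; exact/measurable_EFinP.
  by rewrite -D12 => s Ds; rewrite lee_fin m0.
apply: leeD; apply: IH => //.
- exact: (csn_add Hp).
- by apply: measurable_funS mm => //; exact: subIsetl.
- move=> s [Ds Es]; apply: le_trans (pm s Ds); rewrite /simple_fun big_ord_recr/=.
  by rewrite indicE mem_set// scale1r -addrA [w N + _]addrC.
- by apply: measurable_funS mm => //; exact: subDsetl.
- move=> s [Ds Es]; apply: le_trans (pm s Ds); rewrite /simple_fun big_ord_recr/=.
  by rewrite indicE memNset// scale0r addr0.
Qed.

(** A measurable majorant [m] takes the place of the norm of the integrand, whose measurability
    would need its own proof. *)
Lemma simple_int_le N D E w (m : R -> R) : measurable D -> (mu D < +oo)%E ->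
  (forall k, measurable (E k) /\ E k `<=` D) -> (forall k, HH (w k)) -> measurable_fun D m ->
  (forall s, D s -> p (simple_fun N E w s) <= m s) ->
  ((p (simple_int N E w))%:E <= \int[mu]_(s in D) (m s)%:E)%E.
Proof.
move=> mD Doo hE hw mm pm.
have := @simple_int_le_aux N D 0 E w m mD Doo HH0 (fun k => (hE k).1) hw mm.
rewrite scaler0 add0r (_ : simple_int N (fun k => E k `&` D) w = simple_int N E w); last first.
  by apply: eq_bigr => k _; rewrite setIidl//; exact: (hE k).2.
by apply=> s Ds; rewrite add0r pm.
Qed.

Definition catN T (N : nat) (a b : nat -> T) (k : nat) : T := if (k < N)%N then a k else b (k - N)%N.

Lemma catN_sum N N' T (a b : nat -> T) (F : T -> V) :
  \sum_(k < N + N') F (catN N a b k) = \sum_(k < N) F (a k) + \sum_(k < N') F (b k).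
Proof.
rewrite big_split_ord /=; congr (_ + _); apply: eq_bigr => k _; rewrite /catN.
  by rewrite ltn_ord.
by rewrite ltnNge leq_addr/= addnC addnK.
Qed.

(** [F] is either the indicator evaluated at a point or the measure, so that one identity covers
    differences of simple functions and of their integrals. *)
Lemma simple_sub N N' (E E' : nat -> set R) (w w' : nat -> V) (F : set R -> R) :
  \sum_(k < N + N') F (catN N E E' k) *: catN N w (fun k => - w' k) k =
  \sum_(k < N) F (E k) *: w k - \sum_(k < N') F (E' k) *: w' k.
Proof.
have := @catN_sum N N' (set R * V)%type (fun k => (E k, w k)) (fun k => (E' k, - w' k))
  (fun q => F q.1 *: q.2).
under [X in _ = _ + X -> _]eq_bigr do rewrite scalerN; rewrite sumrN => <-.
by apply: eq_bigr => k _; rewrite /catN; case: ifP.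
Qed.

Lemma simple_int_sub_le N N' D E E' w w' (m : R -> R) : measurable D -> (mu D < +oo)%E ->
  (forall k, measurable (E k) /\ E k `<=` D) -> (forall k, measurable (E' k) /\ E' k `<=` D) ->
  (forall k, HH (w k)) -> (forall k, HH (w' k)) -> measurable_fun D m ->
  (forall s, D s -> p (simple_fun N E w s - simple_fun N' E' w' s) <= m s) ->
  ((p (simple_int N E w - simple_int N' E' w'))%:E <= \int[mu]_(s in D) (m s)%:E)%E.
Proof.
move=> mD Doo hE hE' hw hw' mm pm.
rewrite -(simple_sub N N' E E' w w' (fun A => fine (mu A))).
apply: simple_int_le => //.
- by move=> k; rewrite /catN; case: ifP.
- by move=> k; rewrite /catN; case: ifP => // _; exact: (csn_opp Hp).
by move=> s Ds; rewrite /simple_fun (simple_sub N N' E E' w w' (fun A => \1_A s)); exact: pm.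
Qed.

(* [bochner_integral Omega] is the case [HH := energy_space Omega], [p := energy_norm Omega]. *)
Definition bint D (f : R -> V) (v : V) :=
  [/\ forall s, D s -> HH (f s), HH v &
  exists (N : nat -> nat) (E : nat -> nat -> set R) (w : nat -> nat -> V),
  let err j s := p (f s - \sum_(k < N j) \1_(E j k) s *: w j k) in
  [/\ forall j k, [/\ measurable (E j k), E j k `<=` D,
          (mu (E j k) < +oo)%E & HH (w j k)],
      forall j, measurable_fun D (err j),
      (\int[mu]_(s in D) (err j s)%:E)%E @[j --> \oo] --> 0%E &
      p (v - \sum_(k < N j) fine (mu (E j k)) *: w j k) @[j --> \oo] --> (0 : R)]].

Lemma near_smalle (a : nat -> \bar R) (e : R) : a @ \oo --> 0%E -> 0 < e -> \forall j \near \oo, (a j < e%:E)%E.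
Proof. by move=> a0 e0; exact: (a0 _ (@nbhs_open_ereal_lt R 0 (fun=> e) e0)). Qed.

(** Compares two integrals directly, without first building a linear theory: f = g with [m = 0] is
    uniqueness, and g = 0 is the norm inequality. *)
Lemma bint_le D f g v w (m : R -> R) : measurable D -> (mu D < +oo)%E ->
  bint D f v -> bint D g w -> measurable_fun D m ->
  (forall s, D s -> p (f s - g s) <= m s) ->
  ((p (v - w))%:E <= \int[mu]_(s in D) (m s)%:E)%E.
Proof.
move=> mD Doo [hf hv [N [E [x [hE mef ief cf]]]]] [hg hw [N' [E' [y [hE' meg ieg cg]]]]] mm pm.
have m0 s : D s -> 0 <= m s by move=> Ds; exact: le_trans (p0 _) (pm s Ds).
set r := (\int[mu]_(s in D) (m s)%:E)%E.
have r0 : (0 <= r)%E by apply: integral_ge0 => s Ds; rewrite lee_fin m0.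
have [roo|roo] := eqVneq r +oo%E; first by rewrite roo leey.
have rfin : r \is a fin_num by rewrite ge0_fin_numE// ltey.
rewrite -(fineK rfin) lee_fin; apply/ler_addgt0Pr => e e0.
have e4 : 0 < e / 4 by rewrite divr_gt0.
(* Four errors share e: for each of the two functions, the distance of the integrals and the L1
   distance of the approximation. *)
have [j [j1 j2 j3 j4]] : exists j, [/\ p (v - simple_int (N j) (E j) (x j)) < e / 4,
    p (w - simple_int (N' j) (E' j) (y j)) < e / 4,
    (\int[mu]_(s in D) (p (f s - simple_fun (N j) (E j) (x j) s))%:E < (e / 4)%:E)%E &
    (\int[mu]_(s in D) (p (g s - simple_fun (N' j) (E' j) (y j) s))%:E < (e / 4)%:E)%E].
  near \oo => j; exists j; split; near: j.
  - exact: near_small cf e4.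
  - exact: near_small cg e4.
  - exact: near_smalle ief e4.
  - exact: near_smalle ieg e4.
set I := simple_int _ _ _ in j1; set I' := simple_int _ _ _ in j2.
have hx k : HH (x j k) by case: (hE j k).
have hy k : HH (y j k) by case: (hE' j k).
have hI : HH I by exact: csn_simple_int.
have hI' : HH I' by exact: csn_simple_int.
pose ef s := p (f s - simple_fun (N j) (E j) (x j) s).
pose eg s := p (g s - simple_fun (N' j) (E' j) (y j) s).
have mef' : measurable_fun D (EFin \o ef) by apply/measurable_EFinP; exact: mef.
have meg' : measurable_fun D (EFin \o eg) by apply/measurable_EFinP; exact: meg.
have mm' : measurable_fun D (EFin \o m) by exact/measurable_EFinP.
have : ((p (I - I'))%:E <= \int[mu]_(s in D) (ef s + eg s + m s)%:E)%E.
  apply: simple_int_sub_le => //.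
  - by move=> k; case: (hE j k).
  - by move=> k; case: (hE' j k).
  - by apply: measurable_funD => //; apply: measurable_funD; [exact: mef|exact: meg].
  move=> s Ds; set F := simple_fun _ _ _ s; set G := simple_fun _ _ _ s.
  have hF : HH F by exact: csn_simple_fun.
  have hG : HH G by exact: csn_simple_fun.
  apply: le_trans (csn_triangle Hp hF (hf s Ds) hG) _; rewrite -addrA; apply: lerD.
    by rewrite (csn_subC Hp hF (hf s Ds)) lexx.
  apply: le_trans (csn_triangle Hp (hf s Ds) (hg s Ds) hG) _; rewrite [X in X <= _]addrC.
  by apply: lerD; [exact: lexx|exact: pm].
rewrite (_ : (\int[mu]_(s in D) (ef s + eg s + m s)%:E =
    \int[mu]_(s in D) (ef s)%:E + \int[mu]_(s in D) (eg s)%:E + r)%E); last first.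
  have ef0 s : D s -> (0 <= (ef s)%:E)%E by move=> _; rewrite lee_fin; exact: p0.
  have eg0 s : D s -> (0 <= (eg s)%:E)%E by move=> _; rewrite lee_fin; exact: p0.
  have me0 s : D s -> (0 <= (m s)%:E)%E by move=> Ds; rewrite lee_fin; exact: m0.
  have efg0 s : D s -> (0 <= (ef s)%:E + (eg s)%:E)%E.
    by move=> Ds; apply: adde_ge0; [exact: ef0|exact: eg0].
  by rewrite -(ge0_integralD mu mD ef0 mef' eg0 meg') -(ge0_integralD mu mD efg0 (emeasurable_funD mef' meg') me0 mm').
move=> hII.
have {}hII : p (I - I') <= e / 4 + e / 4 + fine r.
  rewrite -lee_fin !EFinD fineK//; apply: le_trans hII _.
  by rewrite leeD2r// leeD// ltW.
have t1 := csn_triangle Hp hv hI hw; have t2 := csn_triangle Hp hI hI' hw.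
have t3 := csn_subC Hp hI' hw.
rewrite t3 in t2; move: t1 t2 hII j1 j2; rewrite -/I -/I'; lra.
Unshelve. all: by end_near.
Qed.

End bochner.

(** * Existence of Bochner integrals *)

Section bochner_existence.
Context (R : realType) (V : lmodType R) (HH : set V) (p : V -> R).
Hypothesis Hp : complete_seminorm HH p.
Local Notation mu := (@lebesgue_measure R).
Implicit Types (U W v : V) (D : set R).
Local Notation bint := (bint HH p).

Let HH0 : HH 0. Proof. exact: csn_0 Hp. Qed.
Let p0 U : 0 <= p U. Proof. exact: csn_ge0 Hp _. Qed.

(** Brings integrals over [segment t] and [segment t'] to a common domain, where [bint_le] can
    compare them. *)
Lemma bint_ext D D' f v : measurable D -> measurable D' -> D `<=` D' -> bint D f v ->
  bint D' (fun s => if s \in D then f s else 0) v.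
Proof.
move=> mD mD' DD' [hf hv [N [E [w [hE mef ief cf]]]]]; split=> //.
  by move=> s _; case: ifPn => [/set_mem/hf//|_]; exact: HH0.
exists N, E, w => err.
have errE j : err j = (fun s => p (f s - \sum_(k < N j) \1_(E j k) s *: w j k)) \_ D.
  apply/funext => s; rewrite /err /patch; case: ifPn => // /negP sD.
  rewrite big1 ?subr0 ?(csn_norm0 Hp)// => k _.
  rewrite indicE memNset ?scale0r//; have [_ h _ _] := hE j k => /h Ds.
  by apply: sD; rewrite inE.
split=> //.
- by move=> j k; have [h1 h2 h3 h4] := hE j k; split=> //; exact: subset_trans h2 DD'.
- by move=> j; rewrite errE; apply: measurable_funTS; apply: (measurable_restrictT _ mD).1; exact: mef.
have -> : (fun j => (\int[mu]_(s in D') (err j s)%:E)%E) =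
   (fun j => (\int[mu]_(s in D) (p (f s - \sum_(k < N j) \1_(E j k) s *: w j k))%:E)%E).
  apply/funext => j; rewrite [LHS]integral_mkcond [RHS]integral_mkcond.
  apply: eq_integral => s _; rewrite errE /patch.
  have [sD|sD] := boolP (s \in D); last by case: ifP.
  by rewrite mem_set//; apply: DD'; exact: set_mem.
exact: ief.
Qed.

(** Uniform approximation rather than L1: on a domain of finite measure it gives L1 convergence with
    an explicit rate. *)
Definition approxable D (f : R -> V) := forall e : R, 0 < e ->
  exists (N : nat) (E : nat -> set R) (w : nat -> V),
  [/\ forall k, measurable (E k) /\ E k `<=` D, forall k, HH (w k),
      measurable_fun D (fun s => p (f s - simple_fun N E w s)) &
      forall s, D s -> p (f s - simple_fun N E w s) <= e].

Lemma bint_of_approxable D f : measurable D -> (mu D < +oo)%E -> (forall s, D s -> HH (f s)) ->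
  approxable D f -> exists v, bint D f v.
Proof.
move=> mD Doo hf happ.
have e0 j : 0 < 4^-1 ^+ j :> R by rewrite exprn_gt0.
have /choice[N hN] j := happ _ (e0 j); have /choice[E hE] := hN; have /choice[w hw] := hE.
pose I j := simple_int (N j) (E j) (w j).
have hI j : HH (I j) by apply: (csn_simple_int Hp); have [] := hw j.
have [c c0 muE] : exists2 c : R, 0 <= c & mu D = c%:E.
  by exists (fine (mu D)); [exact: fine_ge0|rewrite fineK ?ge0_fin_numE].
have intc (a : R) : (\int[mu]_(s in D) a%:E = (a * c)%:E)%E.
  by rewrite integral_cst// EFinM; congr (_ * _)%E; exact: muE.
(* Approximants within 4^-j of f have integrals that differ by at most (5/4) c 4^-j, where c is the
   measure of D; the bound 2 c leaves room. *)
have IS j : p (I j.+1 - I j) <= 2 * c * 4^-1 ^+ j.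
  have [a1 a2 a3 a4] := hw j; have [b1 b2 b3 b4] := hw j.+1.
  have h : ((p (I j.+1 - I j))%:E <= \int[mu]_(s in D) (4^-1 ^+ j.+1 + 4^-1 ^+ j)%:E)%E.
    apply: (simple_int_sub_le Hp mD Doo b1 a1 b2 a2 (m := fun=> 4^-1 ^+ j.+1 + 4^-1 ^+ j)).
      exact: measurable_cst.
    move=> s Ds; have hF := csn_simple_fun Hp (N j) (E j) s a2.
    have hG := csn_simple_fun Hp (N j.+1) (E j.+1) s b2.
    apply: le_trans (csn_triangle Hp hG (hf s Ds) hF) _; apply: lerD; last exact: a4.
    by rewrite (csn_subC Hp hG (hf s Ds)); exact: b4.
  move: h; rewrite intc lee_fin => /le_trans; apply.
  rewrite mulrC -mulrA mulrCA ler_wpM2l// exprS.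
  have := e0 j; lra.
have c20 : 0 <= 2 * c by rewrite mulr_ge0.
have [v hv vlim] := csn_complete Hp c20 hI IS.
exists v; split=> //; exists N, E, w => err; split.
- move=> j k; have [h1 h2 _ _] := hw j; have [m1 s1] := h1 k; split=> //.
  exact: measure_lty_subset Doo.
- by move=> j; have [] := hw j.
- have H0 : (fun j => (c * 4^-1 ^+ j)%:E) @ \oo --> 0%E.
    apply/cvg_EFin; first exact: nearW.
    have : (geometric c (4^-1 : R)) @ \oo --> (0 : R).
      by apply: cvg_geometric; rewrite gtr0_norm ?invr_gt0// invf_lt1// ltr1n.
    by [].
  apply: (squeeze_cvge _ (cvg_cst _) H0); apply: nearW => j; apply/andP; split.
    by apply: integral_ge0 => s _; rewrite lee_fin; exact: p0.
  have [_ _ h3 h4] := hw j.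
  apply: (@le_trans _ _ (\int[mu]_(s in D) (4^-1 ^+ j)%:E)%E).
    apply: ge0_le_integral => //.
    - by move=> s _; rewrite lee_fin; exact: p0.
    - by apply/measurable_EFinP; exact: h3.
  by rewrite intc mulrC.
- have H0 : (fun j => 2 * (2 * c) * 4^-1 ^+ j) @ \oo --> (0 : R).
    have : (geometric (2 * (2 * c)) (4^-1 : R)) @ \oo --> (0 : R).
      by apply: cvg_geometric; rewrite gtr0_norm ?invr_gt0// invf_lt1// ltr1n.
    by [].
  apply: (squeeze_cvgr _ (cvg_cst _) H0); apply: nearW => j; apply/andP; split.
    exact: p0.
  exact: vlim.
Qed.

(** Serves the jump of the delayed term: the sets of the two approximants are cut by A and by its
    complement. *)
Lemma approxable_if D f g A : measurable D -> measurable A ->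
  approxable D f -> approxable D g -> approxable D (fun s => if s \in A then f s else g s).
Proof.
move=> mD mA hf hg e e0; have [N [E [w [a1 a2 a3 a4]]]] := hf e e0.
have [N' [E' [w' [b1 b2 b3 b4]]]] := hg e e0.
pose E1 k := E k `&` A; pose E2 k := E' k `\` A.
exists (N + N')%N, (catN N E1 E2), (catN N w w').
have sE s : simple_fun (N + N') (catN N E1 E2) (catN N w w') s =
    if s \in A then simple_fun N E w s else simple_fun N' E' w' s.
  have := @catN_sum R V N N' (set R * V)%type (fun k => (E1 k, w k)) (fun k => (E2 k, w' k))
    (fun q => \1_(q.1) s *: q.2).
  rewrite /simple_fun => h.
  transitivity (\sum_(k < N) \1_(E1 k) s *: w k + \sum_(k < N') \1_(E2 k) s *: w' k).
    by rewrite -h; apply: eq_bigr => k _; rewrite /catN; case: ifP.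
  case: ifPn => sA.
    rewrite [X in _ + X]big1 ?addr0 => [|k _].
      by apply: eq_bigr => k _; rewrite !indicE /E1 in_setI sA andbT.
    by rewrite indicE /E2 in_setD sA andbF scale0r.
  rewrite [X in X + _]big1 ?add0r => [|k _].
    by apply: eq_bigr => k _; rewrite !indicE /E2 in_setD (negbTE sA) andbT.
  by rewrite indicE /E1 in_setI (negbTE sA) andbF scale0r.
have pE s : p ((if s \in A then f s else g s) - simple_fun (N + N') (catN N E1 E2) (catN N w w') s) =
   if s \in A then p (f s - simple_fun N E w s) else p (g s - simple_fun N' E' w' s).
  by rewrite sE; case: ifP.
split.
- move=> k; rewrite /catN; case: ifP => _.
    by have [h1 h2] := a1 k; split; [exact: measurableI|move=> s [/h2]].
  by have [h1 h2] := b1 (k - N)%N; split; [exact: measurableD|move=> s [/h2]].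
- by move=> k; rewrite /catN; case: ifP.
- have -> : (fun s => p ((if s \in A then f s else g s) - simple_fun (N + N') (catN N E1 E2) (catN N w w') s)) =
      (fun s => if s \in A then p (f s - simple_fun N E w s) else p (g s - simple_fun N' E' w' s)).
    by apply/funext => s; exact: pE.
  have preA : (fun s => s \in A) @^-1` [set true] = A.
    by apply/seteqP; split=> s /=; [exact: set_mem|exact: mem_set].
  have mDA : measurable (D `&` (fun s => s \in A) @^-1` [set true]).
    by rewrite preA; exact: measurableI.
  exact: (measurable_fun_if mD (measurable_fun_bool true mDA)
    (measurable_funS mD (@subIsetl _ _ _) a3) (measurable_funS mD (@subIsetl _ _ _) b3)).
by move=> s Ds; have := pE s; rewrite /= => ->; case: ifP => _; [exact: a4|exact: b4].
Qed.

End bochner_existence.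

(** * Seminorm-continuous functions on segments *)

Section continuity.
Context (R : realType) (V : lmodType R) (HH : set V) (p : V -> R).
Hypothesis Hp : complete_seminorm HH p.
Local Notation mu := (@lebesgue_measure R).
Implicit Types (U v : V) (D : set R).
Local Notation bint := (bint HH p).
Local Notation approxable := (approxable HH p).

Let HH0 : HH 0. Proof. exact: csn_0 Hp. Qed.
Let p0 U : 0 <= p U. Proof. exact: csn_ge0 Hp _. Qed.

(** The module carries no topology, so continuity for [p] is spelled out with epsilon and delta. *)
Definition contp D (W : R -> V) :=
  (forall s, D s -> HH (W s)) /\
  forall s, D s -> forall e : R, 0 < e -> exists2 d : R, 0 < d &
    forall s', D s' -> `|s' - s| < d -> p (W s' - W s) <= e.

Definition segment (T : R) : set R := `[0, T]%classic.

Lemma compact_segment T : compact (segment T). Proof. exact: segment_compact. Qed.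
Lemma measurable_segment T : measurable (segment T). Proof. exact: measurable_itv. Qed.
Lemma segmentP T s : segment T s <-> 0 <= s <= T.
Proof. by rewrite /segment /= in_itv. Qed.
Lemma mu_segment T : 0 <= T -> mu (segment T) = T%:E.
Proof.
rewrite /segment lebesgue_measure_itv/= lte_fin le_eqVlt => /predU1P[<-|->].
  by rewrite ltxx.
by rewrite oppr0 adde0.
Qed.
Lemma mu_segment_lty T : (mu (segment T) < +oo)%E.
Proof.
have [T0|T0] := leP 0 T; first by rewrite mu_segment ?ltry.
rewrite (_ : segment T = set0) ?measure0//; apply/seteqP; split=> // s /segmentP/andP[h1 h2].
by have := le_lt_trans (le_trans h1 h2) T0; rewrite ltxx.
Qed.

Lemma contpW D D' W : D `<=` D' -> contp D' W -> contp D W.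
Proof.
move=> DD' [h1 h2]; split=> [s /DD'|s /DD' Ds e e0]; first exact: h1.
by have [d d0 hd] := h2 s Ds e e0; exists d => // s' /DD'; exact: hd.
Qed.

(** Heine's theorem by near-covering compactness along the filter of large N: the radius 1/(N+1)
    works at all points near any given x once N is large. *)
Lemma contp_uniform T W : contp (segment T) W -> forall e : R, 0 < e ->
  exists2 d : R, 0 < d & forall s s', segment T s -> segment T s' -> `|s' - s| < d -> p (W s' - W s) <= e.
Proof.
move=> [hW cW] e e0; have e2 : 0 < e / 2 by rewrite divr_gt0.
have := (compact_near_coveringP (segment T)).1 (@compact_segment T) nat \oo
  (fun N x => segment T x -> forall s, segment T s -> `|s - x| < N.+1%:R^-1 -> p (W s - W x) <= e) _.
case=> [x Kx|N _ hN].
  have [d d0 hd] := cW x Kx _ e2; have d2 : 0 < d / 2 by rewrite divr_gt0.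
  have hN : \forall N \near \oo, (@harmonic R N) < d / 2 by exact: (near_small (@cvg_harmonic R)).
  exists (ball x (d / 2), [set N | (@harmonic R N) < d / 2]) => /=.
    by split=> //; exact: nbhsx_ballx.
  move=> [x' N] [/= bx' hN'] Kx' s Ks sx'.
  have sx : `|s - x| < d.
    have -> : s - x = (s - x') + (x' - x) by rewrite addrA subrK.
    apply: le_lt_trans (ler_normD _ _) _; rewrite [d]splitr; apply: ltrD.
      exact: lt_trans sx' hN'.
    by rewrite distrC.
  have x'x : `|x' - x| < d.
    by rewrite distrC; apply: lt_trans bx' _; rewrite ltr_pdivrMr// ltr_pMr// ltr1n.
  have h1 := hd s Ks sx; have h2 := hd x' Kx' x'x.
  apply: le_trans (csn_triangle Hp (hW s Ks) (hW x Kx) (hW x' Kx')) _.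
  by rewrite [e]splitr; apply: lerD => //; rewrite (csn_subC Hp (hW x Kx) (hW x' Kx')).
exists N.+1%:R^-1; first by rewrite invr_gt0.
by move=> s s' Ks Ks' ss'; exact: (hN N (leqnn N) s Ks Ks s' Ks' ss').
Qed.

Lemma contp_bounded T W : contp (segment T) W ->
  exists2 C : R, 0 <= C & forall s, segment T s -> p (W s) <= C.
Proof.
move=> cW; have [hW _] := cW.
have := (compact_near_coveringP (segment T)).1 (@compact_segment T) nat \oo
  (fun N x => segment T x -> p (W x) <= N%:R) _.
case=> [x Kx|N _ hN]; last by exists N%:R => // s Ks; exact: (hN N (leqnn N) s Ks Ks).
have [d d0 hd] := cW.2 x Kx _ ltr01.
exists (ball x d, [set N | p (W x) + 1 <= N%:R]) => /=.
  split; first exact: nbhsx_ballx.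
  exact: nbhs_infty_ger.
move=> [x' N] [/= bx' hN'] Kx'; apply: le_trans hN'.
apply: le_trans (csn_le_add Hp (hW x' Kx') (hW x Kx)) _; rewrite lerD2l.
by apply: hd => //; rewrite distrC.
Qed.

Lemma contp_norm_sub_continuous D W w : contp D W -> HH w ->
  {within D, continuous (fun s => p (W s - w))}.
Proof.
move=> [hW cW] hw; apply/subspace_continuousP => s Ds; apply/cvgrPdist_le => e e0.
have [d d0 hd] := cW s Ds e e0.
rewrite near_withinE; apply/nbhs_ballP; exists d => //= t st Dt.
have ts : `|t - s| < d by rewrite distrC.
have h := hd t Dt ts; have hs := hW s Ds; have ht := hW t Dt.
have h1 := csn_triangle Hp hs ht hw; have h2 := csn_triangle Hp ht hs hw.
have h3 := csn_subC Hp hs ht; rewrite h3 in h1.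
by rewrite /from_subspace ler_norml; apply/andP; split; lra.
Qed.

Lemma approxable_contp T W : 0 <= T -> contp (segment T) W -> approxable (segment T) W.
Proof.
move=> T0 cW e e0; have [hW _] := cW; have [d d0 hd] := contp_uniform cW e0.
pose N := (Num.truncn (T / d)).+1.
pose E (k : nat) : set R := segment T `&` `[k%:R * d, k.+1%:R * d[%classic.
(* The sample point is clipped at T so that [w k] lies in [HH] for every k, including indices past
   the last cell. *)
pose w (k : nat) := W (Num.min (k%:R * d) T).
have Tk k : segment T (Num.min (k%:R * d) T).
  by apply/segmentP; rewrite le_min T0 ge_min lexx orbT mulr_ge0// ltW.
have hw k : HH (w k) by exact: hW.
have mE k : measurable (E k) by apply: measurableI => //; exact: measurable_itv.
(* The half-open cells partition the segment, and s lies in the cell of index floor(s/d) alone. *)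
have key s : segment T s -> let k := Num.truncn (s / d) in
    [/\ (k < N)%N, simple_fun N E w s = w k & (forall j, \1_(E j) s = (j == k)%:R :> R)
     /\ p (W s - w k) <= e].
  move=> Ks k; have [/andP[s0 sT]] := (segmentP T s).1 Ks.
  have sd0 : 0 <= s / d by rewrite divr_ge0// ltW.
  have /andP[k1 k2] := truncn_itv sd0.
  rewrite ler_pdivlMr// in k1; rewrite ltr_pdivrMr// in k2.
  have kN : (k < N)%N by rewrite ltnS; apply: le_truncn; rewrite ler_pM2r ?invr_gt0.
  have indE j : \1_(E j) s = (j == k)%:R :> R.
    rewrite indicE; congr ((nat_of_bool _)%:R); apply/idP/eqP => [/set_mem[_]|->].
      rewrite /= in_itv/= => /andP[j1 j2]; apply/esym; apply: truncn_def.
      by rewrite ler_pdivlMr// ltr_pdivrMr// j1.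
    by rewrite mem_set//; split=> //=; rewrite in_itv/= k1.
  split=> //.
    rewrite /simple_fun (bigD1 (Ordinal kN))//= indE eqxx scale1r big1 ?addr0// => j /eqP jk.
    by rewrite indE (_ : (_ == _) = false) ?scale0r//; apply/eqP => h; apply: jk; exact: val_inj.
  split=> //; apply: hd => //.
  have -> : Num.min (k%:R * d) T = k%:R * d by apply/min_idPl; exact: le_trans sT.
  rewrite ger0_norm ?subr_ge0//; move: k2; rewrite -natr1 mulrDl mul1r; lra.
exists N, E, w; split=> //.
- by move=> k; split=> // s [].
(* Cell by cell the error is the distance from [W] to a fixed vector, a continuous real function. *)
- apply: (eq_measurable_fun (fun s => \sum_(k < N) \1_(E k) s * p (W s - w k))).
    move=> s /set_mem/key; set k := Num.truncn _ => -[kN -> [indE _]].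
    rewrite (bigD1 (Ordinal kN))//= indE eqxx mul1r big1 ?addr0// => j /eqP jk.
    by rewrite indE (_ : (_ == _) = false) ?mul0r//; apply/eqP => h; apply: jk; exact: val_inj.
  apply: measurable_sum => k; apply: measurable_funM.
    exact: measurable_indic.
  apply: subspace_continuous_measurable_fun; first exact: measurable_segment.
  exact: contp_norm_sub_continuous cW (hw k).
by move=> s /key; set k := Num.truncn _ => -[_ -> [_ ?]].
Qed.

Lemma contp_norm_continuous D W : contp D W -> {within D, continuous (fun s => p (W s))}.
Proof.
move=> cW; have := contp_norm_sub_continuous cW HH0.
by have -> : (fun s => p (W s - 0)) = (fun s => p (W s)) by apply/funext => s; rewrite subr0.
Qed.

End continuity.

(** * The Duhamel formula *)

(** [S] acts on representatives: linearity enters only through the Lipschitz bound [sg_lip], and the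
    semigroup law as a vanishing seminorm. *)
Record bounded_semigroup (R : realType) (V : lmodType R) (HH : set V) (p : V -> R)
    (S : R -> V -> V) (M alpha : R) : Prop := {
  sg_M : 0 < M;
  sg_alpha : 0 < alpha;
  sg_HH : forall t U, 0 <= t -> HH U -> HH (S t U);
  sg_lip : forall t U W, 0 <= t -> HH U -> HH W ->
    p (S t U - S t W) <= M * expR (- alpha * t) * p (U - W);
  sg_bound : forall t U, 0 <= t -> HH U -> p (S t U) <= M * expR (- alpha * t) * p U;
  sg_add : forall s t U, 0 <= s -> 0 <= t -> HH U -> p (S (s + t) U - S s (S t U)) = 0;
  sg_cont : forall U, HH U -> forall e : R, 0 < e -> exists2 d : R, 0 < d &
    forall h, 0 <= h -> h < d -> p (S h U - U) <= e }.

Section duhamel.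
Context (R : realType) (V : lmodType R) (HH : set V) (p : V -> R).
Hypothesis Hp : complete_seminorm HH p.
Context (S : R -> V -> V) (M alpha : R).
Hypothesis HS : bounded_semigroup HH p S M alpha.
Local Notation mu := (@lebesgue_measure R).
Implicit Types (U v : V) (D : set R).
Local Notation bint := (bint HH p).
Local Notation approxable := (approxable HH p).
Local Notation contp := (contp HH p).

Let p0 U : 0 <= p U. Proof. exact: csn_ge0 Hp _. Qed.
Let M0 : 0 < M. Proof. exact: sg_M HS. Qed.

Lemma sg_exp_le1 t : 0 <= t -> expR (- alpha * t) <= 1.
Proof. by move=> t0; rewrite expR_le1 mulNr oppr_le0 mulr_ge0// ltW// (sg_alpha HS). Qed.

Lemma sg_lipM t U W : 0 <= t -> HH U -> HH W -> p (S t U - S t W) <= M * p (U - W).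
Proof.
move=> t0 hU hW; apply: le_trans (sg_lip HS t0 hU hW) _.
by rewrite -mulrA ler_wpM2l ?(ltW M0)// ler_piMl ?p0// sg_exp_le1.
Qed.

Lemma sg_boundM t U : 0 <= t -> HH U -> p (S t U) <= M * p U.
Proof.
move=> t0 hU; apply: le_trans (sg_bound HS t0 hU) _.
by rewrite -mulrA ler_wpM2l ?(ltW M0)// ler_piMl ?p0// sg_exp_le1.
Qed.

(** Writing h' = h + (h' - h) reduces continuity of orbits everywhere to continuity at time 0. *)
Lemma sg_orbit h h' U : 0 <= h -> h <= h' -> HH U ->
  p (S h' U - S h U) <= M * p (S (h' - h) U - U).
Proof.
move=> h0 hh hU; have d0 : 0 <= h' - h by rewrite subr_ge0.
have hS := sg_HH HS d0 hU.
apply: le_trans (csn_triangle Hp (sg_HH HS (le_trans h0 hh) hU) (sg_HH HS h0 hS) (sg_HH HS h0 hU)) _.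
have := sg_add HS h0 d0 hU; rewrite [h + _]addrC subrK => ->; rewrite add0r.
exact: sg_lipM.
Qed.

Lemma sg_orbit_cont U : HH U -> forall e : R, 0 < e -> exists2 d : R, 0 < d &
  forall h h', 0 <= h -> 0 <= h' -> `|h' - h| < d -> p (S h' U - S h U) <= e.
Proof.
move=> hU e e0; have [d d0 hd] := sg_cont HS hU (divr_gt0 e0 M0).
exists d => // h h' h0 h'0 hh.
wlog le : h h' h0 h'0 hh / h <= h'.
  move=> H; have [|/ltW le] := leP h h'; first exact: H.
  rewrite (csn_subC Hp (sg_HH HS h'0 hU) (sg_HH HS h0 hU)); apply: H => //.
  by rewrite distrC.
apply: le_trans (sg_orbit h0 le hU) _; rewrite mulrC -ler_pdivlMr//.
by apply: hd; rewrite ?subr_ge0//; apply: le_lt_trans hh; exact: ler_norm.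
Qed.

Lemma contp_convolution T W t : contp (segment T) W -> 0 <= t -> t <= T ->
  contp (segment t) (fun s => S (t - s) (W s)).
Proof.
move=> [hW cW] t0 tT.
have sub s : segment t s -> segment T s.
  by move=> /segmentP/andP[s0 st]; apply/segmentP; rewrite s0 (le_trans st).
have ts s : segment t s -> 0 <= t - s by move=> /segmentP/andP[s0 st]; rewrite subr_ge0.
split=> [s Ks|s Ks e e0]; first exact: (sg_HH HS (ts s Ks) (hW s (sub s Ks))).
have e2 : 0 < e / 2 by rewrite divr_gt0.
have [d1 d10 hd1] := cW s (sub s Ks) _ (divr_gt0 e2 M0).
have [d2 d20 hd2] := sg_orbit_cont (hW s (sub s Ks)) e2.
exists (Num.min d1 d2); first by rewrite lt_min d10.
move=> s' Ks'; rewrite lt_min => /andP[s1 s2].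
have hs := hW s (sub s Ks); have hs' := hW s' (sub s' Ks').
(* The variation of [W] is absorbed by the uniform bound M of the semigroup, the variation of time
   by the continuity of the orbit of the fixed vector [W s]. *)
apply: le_trans (csn_triangle Hp (sg_HH HS (ts s' Ks') hs') (sg_HH HS (ts s' Ks') hs) (sg_HH HS (ts s Ks) hs)) _.
rewrite [e]splitr; apply: lerD.
  apply: le_trans (sg_lipM (ts s' Ks') hs' hs) _.
  by rewrite mulrC -ler_pdivlMr//; exact: hd1 (sub s' Ks') s1.
apply: (hd2 _ _ (ts s Ks) (ts s' Ks')).
have -> : t - s' - (t - s) = - (s' - s) by ring.
by rewrite normrN.
Qed.

(** Strong continuity becomes uniform over the compact range of [W], because the operators are
    equi-Lipschitz. [duhamel_contp] needs one d for all s. *)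
Lemma sg_uniform T W : contp (segment T) W -> forall e : R, 0 < e ->
  exists2 d : R, 0 < d & forall h s, 0 <= h -> h < d -> segment T s -> p (S h (W s) - W s) <= e.
Proof.
move=> [hW cW] e e0.
(* Passing from [W x] to a nearby [W x'] costs their distance twice, once multiplied by M under the
   semigroup. *)
have M1 : 0 < M + 1 by rewrite addr_gt0.
have e2 : 0 < e / 2 by rewrite divr_gt0.
have := (compact_near_coveringP (segment T)).1 (@compact_segment R T) nat \oo
  (fun N x => segment T x -> forall h, 0 <= h -> h < N.+1%:R^-1 -> p (S h (W x) - W x) <= e) _.
case=> [x Kx|N _ hN]; last first.
  exists N.+1%:R^-1; first by rewrite invr_gt0.
  by move=> h s h0 hd Ks; exact: (hN N (leqnn N) s Ks Ks h h0 hd).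
have [d1 d10 hd1] := cW x Kx _ (divr_gt0 e2 M1).
have [d2 d20 hd2] := sg_cont HS (hW x Kx) e2.
have nN : \forall N \near \oo, (@harmonic R N) < d2 by exact: (near_small (@cvg_harmonic R)).
exists (ball x d1, [set N | (@harmonic R N) < d2]) => /=.
  by split=> //; exact: nbhsx_ballx.
move=> [x' N] [/= bx' hN'] Kx' h h0 hN.
have hx := hW x Kx; have hx' := hW x' Kx'.
have Shx := sg_HH HS h0 hx; have Shx' := sg_HH HS h0 hx'.
have a1 := csn_triangle Hp Shx' Shx hx'; have a2 := csn_triangle Hp Shx hx hx'.
have a3 := sg_lipM h0 hx' hx; have a4 := hd2 h h0 (lt_trans hN hN').
have a5 : p (W x' - W x) <= e / 2 / (M + 1) by apply: hd1 => //; rewrite distrC.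
have a6 := csn_subC Hp hx hx'.
rewrite ler_pdivlMr// in a5.
move: a1 a2 a3 a4 a5 a6; move: (p _) (p _) (p _) (p _) (p _) (p _) => z1 z2 z3 z4 z5 z6.
by move=> *; lra.
Qed.

Lemma bint0 D : bint D (fun=> 0) 0.
Proof.
have HH0 := csn_0 Hp.
split=> //; exists (fun=> 0%N), (fun _ _ => set0), (fun _ _ => 0) => err.
have errE j : err j = fun=> 0.
  by apply/funext => s; rewrite /err big_ord0 subr0 (csn_norm0 Hp).
split.
- by move=> j k; split=> //; rewrite measure0.
- by move=> j; rewrite errE; exact: measurable_cst.
- have -> : (fun j => \int[mu]_(s in D) (err j s)%:E)%E = fun=> 0%E.
    by apply/funext => j; rewrite errE integral0.
  exact: cvg_cst.
- have -> : (fun j : nat => p (0 - \sum_(k < 0) fine (mu set0) *: (0 : V))) = fun=> 0.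
    by apply/funext => j; rewrite big_ord0 subr0 (csn_norm0 Hp).
  exact: cvg_cst.
Qed.

Lemma bint_norm_le D f v (m : R -> R) : measurable D -> (mu D < +oo)%E -> bint D f v ->
  measurable_fun D m -> (forall s, D s -> p (f s) <= m s) ->
  ((p v)%:E <= \int[mu]_(s in D) (m s)%:E)%E.
Proof.
move=> mD Doo hv mm pm; rewrite -[v]subr0.
apply: (bint_le Hp mD Doo hv (bint0 D) mm) => s Ds; rewrite subr0; exact: pm.
Qed.

(* The delayed term [S (t - s) (delayed s)] may jump at [s = tau]. *)
Definition piecewise_contp T (W : R -> V) := exists (A : set R) (W1 W2 : R -> V),
  [/\ measurable A, contp (segment T) W1, contp (segment T) W2 &
      W = fun s => if s \in A then W1 s else W2 s].

Lemma contp_piecewise T W : contp (segment T) W -> piecewise_contp T W.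
Proof. by move=> cW; exists setT, W, W; split=> //; apply/funext => s; rewrite in_setT. Qed.

Lemma piecewise_HH T W s : piecewise_contp T W -> segment T s -> HH (W s).
Proof.
by move=> [A [W1 [W2 [_ [h1 _] [h2 _] ->]]]] Ks; case: ifP => _; [exact: h1|exact: h2].
Qed.

Lemma segment_sub (t T s : R) : t <= T -> segment t s -> segment T s.
Proof. by move=> tT /segmentP/andP[s0 st]; apply/segmentP; rewrite s0 (le_trans st). Qed.

Lemma duhamel_exists T W t : piecewise_contp T W -> 0 <= t -> t <= T ->
  exists v, bint (segment t) (fun s => S (t - s) (W s)) v.
Proof.
move=> [A [W1 [W2 [mA c1 c2 ->]]]] t0 tT.
have d1 := contp_convolution c1 t0 tT; have d2 := contp_convolution c2 t0 tT.
apply: (bint_of_approxable Hp (@measurable_segment R t) (mu_segment_lty t)).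
  by move=> s Ks; case: ifP => _; [exact: d1.1|exact: d2.1].
have -> : (fun s => S (t - s) (if s \in A then W1 s else W2 s)) =
    (fun s => if s \in A then S (t - s) (W1 s) else S (t - s) (W2 s)).
  by apply/funext => s; case: ifP.
by apply: (approxable_if (@measurable_segment R t) mA); exact: approxable_contp.
Qed.

Lemma piecewise_bounded T W : piecewise_contp T W ->
  exists2 C : R, 0 <= C & forall s, segment T s -> p (W s) <= C.
Proof.
move=> [A [W1 [W2 [mA c1 c2 ->]]]].
have [C1 C10 h1] := contp_bounded Hp c1; have [C2 C20 h2] := contp_bounded Hp c2.
exists (Num.max C1 C2); first by rewrite le_max C10.
by move=> s Ks; rewrite le_max; case: ifP => _; rewrite ?h1 ?h2 ?orbT.
Qed.

Lemma piecewise_sg_uniform T W : piecewise_contp T W -> forall e : R, 0 < e ->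
  exists2 d : R, 0 < d & forall h s, 0 <= h -> h < d -> segment T s -> p (S h (W s) - W s) <= e.
Proof.
move=> [A [W1 [W2 [mA c1 c2 ->]]]] e e0.
have [d1 d10 h1] := sg_uniform c1 e0; have [d2 d20 h2] := sg_uniform c2 e0.
exists (Num.min d1 d2); first by rewrite lt_min d10.
by move=> h s h0; rewrite lt_min => /andP[hd1 hd2] Ks; case: ifP => _; [exact: h1|exact: h2].
Qed.

Lemma integral_affine (a b T : R) (q : R -> R) : 0 <= T -> 0 <= a -> 0 <= b -> (forall s, 0 <= q s) ->
  measurable_fun (segment T) q ->
  (\int[mu]_(s in segment T) (a + b * q s)%:E =
   (a * T)%:E + b%:E * \int[mu]_(s in segment T) (q s)%:E)%E.
Proof.
move=> T0 a0 b0 q0 mq; have mK := @measurable_segment R T.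
have ma : measurable_fun (segment T) (fun _ : R => a%:E) by exact: measurable_cst.
have mb : measurable_fun (segment T) (fun s => (b * q s)%:E).
  by apply/measurable_EFinP; apply: measurable_funM => //; exact: measurable_cst.
have a0' (s : R) : segment T s -> (0 <= a%:E)%E by rewrite lee_fin.
have q0' (s : R) : segment T s -> (0 <= (q s)%:E)%E by rewrite lee_fin.
have b0' (s : R) : segment T s -> (0 <= (b * q s)%:E)%E by rewrite lee_fin => _; exact: mulr_ge0.
under eq_integral do rewrite EFinD.
rewrite (ge0_integralD mu mK a0' ma b0' mb).
under [X in (_ + X)%E]eq_integral do rewrite EFinM.
rewrite (ge0_integralZl_EFin mu mK q0' ((measurable_EFinP _ _).2 mq) b0); congr (_ + _)%E.
transitivity (a%:E * mu (segment T))%E; first exact: integral_cst.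
by rewrite (mu_segment T0).
Qed.

Lemma integral_step (a b t t' : R) : 0 <= a -> 0 <= b -> 0 <= t -> t <= t' ->
  (\int[mu]_(s in segment t') (a + b * \1_(`]t, t']%classic) s)%:E = (a * t' + b * (t' - t))%:E)%E.
Proof.
move=> a0 b0 t0 tt'; have t'0 := le_trans t0 tt'; have mK := @measurable_segment R t'.
have mI : measurable (`]t, t']%classic : set R) by exact: measurable_itv.
have iI : (\int[mu]_(s in segment t') (\1_(`]t, t']%classic) s : R)%:E = (t' - t)%:E)%E.
  rewrite integral_indic// (_ : _ `&` _ = `]t, t']%classic); last first.
    apply/seteqP; split=> s /=; first by case.
    rewrite in_itv/= => /andP[s1 s2]; split; first by rewrite s1.
    by apply/segmentP; rewrite s2 andbT (le_trans t0)// ltW.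
  suff e : lebesgue_measure (`]t, t']%classic : set R) = (t' - t)%:E by exact: e.
  rewrite lebesgue_measure_itv/= lte_fin; case: ltP => // t't.
  have -> : t' = t by apply/eqP; rewrite eq_le t't tt'.
  by rewrite subrr.
by rewrite integral_affine// iI -EFinM -EFinD.
Qed.

(** For t <= t' the increment is the integral over [0, t] of (S(t'-s) - S(t-s)) W plus that over ]t,
    t'] of S(t'-s) W. The first is small by uniform strong continuity, the second by the length of
    the interval. *)
Lemma duhamel_contp T W (v : R -> V) : 0 <= T -> piecewise_contp T W ->
  (forall t, segment T t -> bint (segment t) (fun s => S (t - s) (W s)) (v t)) ->
  contp (segment T) v.
Proof.
move=> T0 pW hv; have [C C0 hC] := piecewise_bounded pW.
have HHv t : segment T t -> HH (v t) by move=> /hv[].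
have key (e : R) : 0 < e -> exists2 d : R, 0 < d & forall t t', segment T t -> segment T t' ->
    t <= t' -> t' - t < d -> p (v t' - v t) <= e.
  move=> e0.
  (* Multiplied by M from [sg_orbit] and by a length of at most T, this stays below e/2. *)
  have e1 : 0 < e / 2 / (T + 1) / M by rewrite !divr_gt0// ltr_wpDl.
  have [d1 d10 hd1] := piecewise_sg_uniform pW e1.
  have MC : 0 < M * C + 1 by rewrite ltr_wpDl// mulr_ge0// ltW.
  exists (Num.min d1 (e / 2 / (M * C + 1))).
    by rewrite lt_min d10/= !divr_gt0.
  move=> t t' Kt Kt' tt'; rewrite lt_min => /andP[dt1 dt2].
  have [/andP[t0 tT] /andP[t'0 t'T]] := ((segmentP T t).1 Kt, (segmentP T t').1 Kt').
  have ext := bint_ext Hp (@measurable_segment R t) (@measurable_segment R t')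
    (fun s => @segment_sub t t' s tt') (hv t Kt).
  pose q := e / 2 / (T + 1).
  have q0 : 0 < q by rewrite !divr_gt0// ltr_wpDl.
  have MC0 : 0 <= M * C by rewrite mulr_ge0// ltW.
  have := bint_le Hp (@measurable_segment R t') (mu_segment_lty t') (hv t' Kt') ext
    (m := fun s => q + M * C * \1_(`]t, t']%classic) s).
  rewrite integral_step// ?(ltW q0)// lee_fin => H.
  have {}H : p (v t' - v t) <= q * t' + M * C * (t' - t).
    apply: H.
      apply: measurable_funD => //; apply: measurable_funM => //; exact: measurable_indic.
    move=> s Ks; have Ws := piecewise_HH pW (segment_sub t'T Ks).
    have /segmentP/andP[s0 st'] := Ks.
    have hs' : 0 <= t' - s by rewrite subr_ge0.
    have [st|st] := leP s t.
      rewrite mem_set; last by apply/segmentP; rewrite s0.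
      rewrite indicE memNset ?mulr0 ?addr0; last by rewrite /= in_itv/= ltNge st.
      have hs : 0 <= t - s by rewrite subr_ge0.
      have sst : t - s <= t' - s by rewrite lerD2r.
      have S1 : p (S (t' - t) (W s) - W s) <= e / 2 / (T + 1) / M.
        by apply: hd1 => //; [rewrite subr_ge0|exact: segment_sub t'T Ks].
      have dE : t' - s - (t - s) = t' - t by ring.
      apply: le_trans (sg_orbit hs sst Ws) _; rewrite dE mulrC -ler_pdivlMr//.
    rewrite memNset; last by move=> /segmentP; rewrite (leNgt s) st andbF.
    rewrite subr0 indicE mem_set ?mulr1; last by rewrite /= in_itv/= st st'.
    apply: le_trans (sg_boundM hs' Ws) _.
    apply: (@le_trans _ _ (M * C)); last by rewrite lerDr ltW.
    by rewrite ler_wpM2l ?(ltW M0)//; apply: hC; exact: segment_sub t'T Ks.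
  apply: le_trans H _; rewrite [e]splitr; apply: lerD.
    rewrite /q -mulrA ler_piMr ?divr_ge0 ?(ltW e0)// mulrC ler_pdivrMr ?ltr_wpDl// mul1r.
    by apply: le_trans t'T _; rewrite lerDl.
  rewrite ltr_pdivlMr// in dt2; apply: le_trans (ltW dt2).
  rewrite mulrC ler_wpM2l ?subr_ge0// lerDl//.
split=> // t Kt e e0; have [d d0 hd] := key e e0; exists d => // t' Kt' tt'.
have [le|/ltW le] := leP t t'.
  by apply: hd => //; apply: le_lt_trans tt'; exact: ler_norm.
rewrite (csn_subC Hp (HHv _ Kt') (HHv _ Kt)); apply: hd => //.
by apply: le_lt_trans tt'; rewrite distrC; exact: ler_norm.
Qed.

End duhamel.

(** * Picard iteration for the delay equation *)

Section real_integrals.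
Context (R : realType).
Local Notation mu := (@lebesgue_measure R).

Lemma continuous_cexpR (c l : R) : continuous (fun s : R => c * expR (l * s)).
Proof.
move=> s; apply: (@continuousM _ _ (fun=> c) (fun s => expR (l * s))); first exact: cst_continuous.
apply: (@continuous_comp _ _ _ (fun s : R => l * s) expR); last exact: continuous_expR.
by apply: (@continuousM _ _ (fun=> l) id); [exact: cst_continuous|exact: cvg_id].
Qed.

Lemma measurable_cexpR (D : set R) (c l : R) : measurable_fun D (fun s : R => c * expR (l * s)).
Proof. by apply: measurable_funTS; apply: continuous_measurable_fun; exact: continuous_cexpR. Qed.

Lemma integral_cexpR (c l t : R) : l != 0 -> 0 <= t ->
  (\int[mu]_(s in segment t) (c * expR (l * s))%:E = (c / l * (expR (l * t) - 1))%:E)%E.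
Proof.
move=> l0; rewrite le_eqVlt => /predU1P[<-|t0].
  by rewrite /segment set_itv1 integral_set1 mulr0 expR0 subrr mulr0.
pose F (s : R) := c / l * expR (l * s).
have dF (s : R) : is_derive s (1 : R) F (c * expR (l * s)).
  have h1 : is_derive s (1 : R) (fun s => 0 + l * s) l by exact: is_derive_affine.
  have h2 : is_derive s (1 : R) (fun s => l * s) l.
    by have -> : (fun s => l * s) = (fun s => 0 + l * s) by apply/funext => u; rewrite add0r.
  have h3 := is_derive1_comp (is_derive_expR (l * s)) h2.
  have h4 := is_deriveZ (c / l) h3.
  apply: is_derive_eq h4 _; rewrite /GRing.scale/= /GRing.scale/=.
  by field.
have cF : continuous F by exact: continuous_cexpR.
rewrite /segment (@continuous_FTC2 _ _ F)//.
- by rewrite -EFinB /F mulr0 expR0 mulr1 mulrBr mulr1.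
- by apply: continuous_subspaceT; exact: continuous_cexpR.
- split.
  + by move=> s _; have [] := dF s.
  + by apply: cvg_at_right_filter; exact: cF.
  + by apply: cvg_at_left_filter; exact: cF.
by move=> s _; rewrite derive1E; have [] := dF s.
Qed.

End real_integrals.

Lemma min_dist_le (R : realDomainType) (a b c : R) : `|Num.min a c - Num.min b c| <= `|a - b|.
Proof.
have h1 := ler_norm (a - b); have h2 := ler_norm (b - a); rewrite distrC in h2.
by rewrite ler_norml; case: (leP a c) => ac; case: (leP b c) => bc; apply/andP; split; lra.
Qed.

Lemma max_dist_le (R : realDomainType) (a b c : R) : `|Num.max a c - Num.max b c| <= `|a - b|.
Proof.
have h1 := ler_norm (a - b); have h2 := ler_norm (b - a); rewrite distrC in h2.
by rewrite ler_norml; case: (leP a c) => ac; case: (leP b c) => bc; apply/andP; split; lra.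
Qed.

Section delay_equation.
Context (R : realType) (V : lmodType R) (HH : set V) (p : V -> R).
Hypothesis Hp : complete_seminorm HH p.
Context (S : R -> V -> V) (M alpha : R).
Hypothesis HS : bounded_semigroup HH p S M alpha.
Local Notation mu := (@lebesgue_measure R).
Implicit Types (U W : R -> V).
Local Notation bint := (bint HH p).
Local Notation contp := (contp HH p).
Context (B F : V -> V) (beta : R) (L : R -> R) (tau : R) (Psi : R -> V) (U0 : V).
Hypothesis beta0 : 0 <= beta.
Hypothesis HHB : forall u, HH u -> HH (B u).
Hypothesis B_lip : forall u w, HH u -> HH w -> p (B u - B w) <= beta * p (u - w).
Hypothesis B_le : forall u, HH u -> p (B u) <= beta * p u.
Hypothesis HHF : forall u, HH u -> HH (F u).
Hypothesis L0 : forall r : R, 0 < r -> 0 < L r.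
Hypothesis F_lip : forall (r : R) u w, 0 < r -> HH u -> HH w -> p u <= r -> p w <= r ->
  p (F u - F w) <= L r * p (u - w).
Hypothesis F_le : forall (r : R) u, 0 < r -> HH u -> p u <= r -> p (F u) <= L r * p u.
Hypothesis tau0 : 0 < tau.
Hypothesis cPsi : contp `[- tau, 0]%classic Psi.
Hypothesis hU0 : HH U0.

Let p0 u : 0 <= p u. Proof. exact: csn_ge0 Hp _. Qed.
Let M0 : 0 < M. Proof. exact: sg_M HS. Qed.

Definition delayed U (s : R) : V := if s < tau then Psi (s - tau) else B (U (s - tau)).

(** One Picard step as a relation, because the integrals determine [W] only up to seminorm 0; mild
    solutions are the [U] related to themselves. *)
Definition duhamel_step U W := forall t, 0 <= t -> exists Id Is : V,
  [/\ bint (segment t) (fun s => S (t - s) (delayed U s)) Id,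
      bint (segment t) (fun s => S (t - s) (F (U s))) Is &
      p (W t - (S t U0 - Id + Is)) = 0].

Definition halfline : set R := `[0, +oo[%classic.
Lemma halflineP t : halfline t <-> 0 <= t.
Proof. by rewrite /halfline /= in_itv/= andbT. Qed.

Lemma segment_halfline T : segment T `<=` halfline.
Proof. by move=> s /segmentP/andP[s0 _]; apply/halflineP. Qed.

Lemma contp_halfline U : (forall T, 0 <= T -> contp (segment T) U) -> contp halfline U.
Proof.
move=> cU; split=> [s /halflineP s0|s /halflineP s0 e e0].
  by apply: (cU s s0).1; apply/segmentP; rewrite s0 lexx.
have Ks : segment (s + 1) s by apply/segmentP; rewrite s0 lerDl ler01.
have [d d0 hd] := (cU (s + 1) (addr_ge0 s0 ler01)).2 s Ks e e0.
exists (Num.min d 1); first by rewrite lt_min d0 ltr01.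
move=> s' /halflineP s'0; rewrite lt_min => /andP[h1 h2]; apply: hd => //.
apply/segmentP; rewrite s'0/=; have := le_lt_trans (ler_norm _) h2.
by rewrite ltrBlDl => /ltW.
Qed.

Lemma piecewise_delayed T U : contp halfline U -> piecewise_contp HH p T (delayed U).
Proof.
move=> [hU cU].
(* Freezing the time at tau extends each branch continuously to the whole segment, and keeps [Psi]
   and [U] within their domains. *)
exists `]-oo, tau[%classic, (fun s => Psi (Num.min s tau - tau)), (fun s => B (U (Num.max s tau - tau))).
have inPsi s : 0 <= s -> `[- tau, 0]%classic (Num.min s tau - tau).
  move=> s0 /=; rewrite in_itv/= subr_le0 ge_min lexx orbT andbT lerDr.
  by rewrite le_min s0 ltW.
have inU s : halfline (Num.max s tau - tau) by apply/halflineP; rewrite subr_ge0 le_max lexx orbT.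
split.
- exact: measurable_itv.
- split=> [s /segmentP/andP[s0 _]|s /segmentP/andP[s0 _] e e0]; first exact: cPsi.1 (inPsi s s0).
  have [d d0 hd] := cPsi.2 _ (inPsi s s0) e e0; exists d => // s' /segmentP/andP[s'0 _] ss.
  apply: hd; first exact: inPsi.
  rewrite opprB addrA subrK; apply: le_lt_trans ss; exact: min_dist_le.
- split=> [s _|s _ e e0]; first by apply: HHB; exact: hU.
  have b1 : 0 < beta + 1 by rewrite ltr_wpDl.
  have [d d0 hd] := cU _ (inU s) _ (divr_gt0 e0 b1); exists d => // s' _ ss.
  apply: le_trans (B_lip (hU _ (inU s')) (hU _ (inU s))) _.
  apply: (@le_trans _ _ ((beta + 1) * p (U (Num.max s' tau - tau) - U (Num.max s tau - tau)))).
    by rewrite ler_wpM2r// lerDl.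
  rewrite mulrC -ler_pdivlMr//; apply: hd => //.
  rewrite opprB addrA subrK; apply: le_lt_trans ss; exact: max_dist_le.
apply/funext => s; rewrite /delayed; case: ltP => st.
  by rewrite mem_set/= ?in_itv//= min_l// ltW.
by rewrite memNset/= ?max_l// in_itv/=; apply/negP; rewrite -leNgt.
Qed.

Lemma contp_source T U : contp halfline U -> contp (segment T) (fun s => F (U s)).
Proof.
move=> /(contpW (@segment_halfline T)) cU; have [C C0 hC] := contp_bounded Hp cU.
have [hU h] := cU; split=> [s Ks|s Ks e e0]; first exact: HHF (hU s Ks).
(* The source is Lipschitz on balls of positive radius only, and the bound C of [U] on the segment
   may be 0. *)
have C1 : 0 < C + 1 by rewrite ltr_wpDl.
have [d d0 hd] := h s Ks _ (divr_gt0 e0 (L0 C1)); exists d => // s' Ks' ss.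
have le1 u : segment T u -> p (U u) <= C + 1 by move=> /hC /le_trans; apply; rewrite lerDl.
apply: le_trans (F_lip C1 (hU s' Ks') (hU s Ks) (le1 _ Ks') (le1 _ Ks)) _.
by rewrite mulrC -ler_pdivlMr ?L0//; exact: hd.
Qed.

Lemma step_HH U t : 0 <= t -> forall Id Is, bint (segment t) (fun s => S (t - s) (delayed U s)) Id ->
  bint (segment t) (fun s => S (t - s) (F (U s))) Is -> HH (S t U0 - Id + Is).
Proof.
move=> t0 Id Is [_ h1 _] [_ h2 _]; apply: (csn_add Hp) => //; apply: (csn_sub Hp) => //.
exact: (sg_HH HS t0 hU0).
Qed.

Lemma contpB_D T U W Z : contp (segment T) U -> contp (segment T) W -> contp (segment T) Z ->
  contp (segment T) (fun t => U t - W t + Z t).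
Proof.
move=> [h1 c1] [h2 c2] [h3 c3]; split=> [s Ks|s Ks e e0].
  by apply: (csn_add Hp); [apply: (csn_sub Hp); [exact: h1|exact: h2]|exact: h3].
have e3 : 0 < e / 3 by rewrite divr_gt0.
have [d1 d10 hd1] := c1 s Ks _ e3; have [d2 d20 hd2] := c2 s Ks _ e3.
have [d3 d30 hd3] := c3 s Ks _ e3.
exists (Num.min d1 (Num.min d2 d3)); first by rewrite !lt_min d10 d20.
move=> s' Ks'; rewrite !lt_min => /and3P[g1 g2 g3].
have -> : U s' - W s' + Z s' - (U s - W s + Z s) = (U s' - U s) + (W s - W s') + (Z s' - Z s).
  by rewrite opprD opprB [LHS](AC ((2*1)*(2*1)) (((1*5)*(4*2))*(3*6))).
have u := csn_sub Hp (h1 _ Ks') (h1 _ Ks); have w := csn_sub Hp (h2 _ Ks) (h2 _ Ks').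
have z := csn_sub Hp (h3 _ Ks') (h3 _ Ks).
apply: le_trans (csnD Hp (csn_add Hp u w) z) _.
have a1 := csnD Hp u w; have a2 := hd1 s' Ks' g1; have a3 := hd2 s' Ks' g2; have a4 := hd3 s' Ks' g3.
rewrite (csn_subC Hp (h2 _ Ks') (h2 _ Ks)) in a3.
move: a1 a2 a3 a4; move: (p _) (p _) (p _) (p _) => x1 x2 x3 x4; lra.
Qed.

Lemma contp_orbit T : contp (segment T) (fun t => S t U0).
Proof.
split=> [s /segmentP/andP[s0 _]|s /segmentP/andP[s0 _] e e0]; first exact: (sg_HH HS s0 hU0).
have [d d0 hd] := sg_orbit_cont Hp HS hU0 e0; exists d => // s' /segmentP/andP[s'0 _] ss.
exact: hd.
Qed.

Lemma step_exists U : contp halfline U -> exists2 W, contp halfline W & duhamel_step U W.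
Proof.
move=> cU.
have ex t : exists I : V * V, 0 <= t -> bint (segment t) (fun s => S (t - s) (delayed U s)) I.1 /\
    bint (segment t) (fun s => S (t - s) (F (U s))) I.2.
  have [t0|t0] := leP 0 t; last by exists (0, 0).
  have [Id hId] := duhamel_exists Hp HS (piecewise_delayed t cU) t0 (lexx t).
  have [Is hIs] := duhamel_exists Hp HS (contp_piecewise (contp_source t cU)) t0 (lexx t).
  by exists (Id, Is).
have [I hI] := choice ex.
exists (fun t => S t U0 - (I t).1 + (I t).2).
  apply: contp_halfline => T T0; apply: contpB_D; first exact: contp_orbit.
    apply: (duhamel_contp Hp HS T0 (piecewise_delayed T cU)).
    by move=> t /segmentP/andP[t0 _]; exact: (hI t t0).1.
  apply: (duhamel_contp Hp HS T0 (contp_piecewise (contp_source T cU))).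
  by move=> t /segmentP/andP[t0 _]; exact: (hI t t0).2.
move=> t t0; exists (I t).1, (I t).2; have [h1 h2] := hI t t0; split=> //.
by rewrite subrr (csn_norm0 Hp).
Qed.

Lemma delayed_HH U t s : contp halfline U -> 0 <= t -> segment t s -> HH (delayed U s).
Proof. by move=> cU t0; exact: piecewise_HH (piecewise_delayed t cU). Qed.

(** The integral of e^(l s) over [0, t] is at most e^(l t) / l, which is the gain. Before tau the
    common history cancels; after tau the shift by the delay only lowers the weight. *)
Lemma step_diff U U' W W' (r t c l : R) : 0 < r -> 0 <= t -> 0 <= c -> 0 < l ->
  contp halfline U -> contp halfline U' -> contp halfline W -> contp halfline W' ->
  duhamel_step U W -> duhamel_step U' W' ->
  (forall s, segment t s -> p (U s) <= r) -> (forall s, segment t s -> p (U' s) <= r) ->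
  (forall s, segment t s -> p (U s - U' s) <= c * expR (l * s)) ->
  p (W t - W' t) <= M * (beta + L r) * (c / l) * expR (l * t).
Proof.
move=> r0 t0 c0 l0 cU cU' cW cW' sU sU' Ur U'r UU'.
have [Id [Is [hd hs eW]]] := sU t t0; have [Id' [Is' [hd' hs' eW']]] := sU' t t0.
have mK := @measurable_segment R t; have Koo := mu_segment_lty t.
have Kt : halfline t by exact/halflineP.
have hcU := contpW (@segment_halfline t) cU; have hcU' := contpW (@segment_halfline t) cU'.
have ts s : segment t s -> 0 <= t - s by move=> /segmentP/andP[s0 st]; rewrite subr_ge0.
have Lr := L0 r0.
have intE k : 0 <= k ->
    (\int[mu]_(s in segment t) (k * c * expR (l * s))%:E <= (k * (c / l) * expR (l * t))%:E)%E.
  move=> k0; rewrite integral_cexpR ?gt_eqF// lee_fin.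
  have -> : k * c / l * (expR (l * t) - 1) = k * (c / l) * expR (l * t) - k * (c / l) by ring.
  by rewrite gerBl mulr_ge0// divr_ge0// ltW.
have dB : p (Id - Id') <= M * beta * (c / l) * expR (l * t).
  have h : 0 <= M * beta by rewrite mulr_ge0// ltW.
  rewrite -lee_fin; apply: le_trans (intE _ h).
  apply: (bint_le Hp mK Koo hd hd' (@measurable_cexpR R (segment t) (M * beta * c) l)) => s Ks.
  have h1 := delayed_HH cU t0 Ks; have h2 := delayed_HH cU' t0 Ks.
  apply: le_trans (sg_lipM Hp HS (ts s Ks) h1 h2) _; rewrite -!mulrA ler_wpM2l ?(ltW M0)//.
  rewrite /delayed; case: ltP => st.
    by rewrite subrr (csn_norm0 Hp) !mulr_ge0// expR_ge0.
  have /andP[s0 s1] := (segmentP t s).1 Ks.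
  have Ks' : segment t (s - tau).
    by apply/segmentP; rewrite subr_ge0 st/= lerBlDr (le_trans s1)// lerDl ltW.
  apply: le_trans (B_lip (hcU.1 _ Ks') (hcU'.1 _ Ks')) _; rewrite ler_wpM2l//.
  apply: le_trans (UU' _ Ks') _; rewrite ler_wpM2l// ler_expR ler_pM2l//.
  by rewrite gerBl ltW.
have dF : p (Is - Is') <= M * L r * (c / l) * expR (l * t).
  have h : 0 <= M * L r by rewrite mulr_ge0// ltW.
  rewrite -lee_fin; apply: le_trans (intE _ h).
  apply: (bint_le Hp mK Koo hs hs' (@measurable_cexpR R (segment t) (M * L r * c) l)) => s Ks.
  have h1 := hcU.1 s Ks; have h2 := hcU'.1 s Ks.
  apply: le_trans (sg_lipM Hp HS (ts s Ks) (HHF h1) (HHF h2)) _; rewrite -!mulrA ler_wpM2l ?(ltW M0)//.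
  apply: le_trans (F_lip r0 h1 h2 (Ur s Ks) (U'r s Ks)) _.
  by rewrite ler_wpM2l ?(ltW Lr)//; exact: UU'.
have hId : HH Id by case: hd. have hId' : HH Id' by case: hd'.
have hIs : HH Is by case: hs. have hIs' : HH Is' by case: hs'.
have hWt := cW.1 t Kt; have hWt' := cW'.1 t Kt.
have hS := sg_HH HS t0 hU0.
set Z := S t U0 - Id + Is in eW; set Z' := S t U0 - Id' + Is' in eW'.
have hZ : HH Z by apply: (csn_add Hp) => //; exact: (csn_sub Hp).
have hZ' : HH Z' by apply: (csn_add Hp) => //; exact: (csn_sub Hp).
have ZZ : Z - Z' = (Id' - Id) + (Is - Is').
  by rewrite /Z /Z' opprD addrACA opprB; congr (_ + _); rewrite addrC addrA subrK.
have a1 := csn_triangle Hp hWt hZ hWt'; have a2 := csn_triangle Hp hZ hZ' hWt'.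
have a3 := csn_subC Hp hWt' hZ'.
have a4 := csnD Hp (csn_sub Hp hId' hId) (csn_sub Hp hIs hIs').
have a5 := csn_subC Hp hId' hId.
rewrite -ZZ a5 in a4.
have -> : M * (beta + L r) * (c / l) * expR (l * t) =
  M * beta * (c / l) * expR (l * t) + M * L r * (c / l) * expR (l * t) by ring.
rewrite a3 in eW'; move: eW eW' a1 a2 a4 dB dF; rewrite -/Z -/Z'.
move: (p _) (p _) (p _) (p _) (p _) (p _) (p _) (M * beta * _ * _) (M * L r * _ * _) => x1 x2 x3 x4 x5 x6 x7 y z.
lra.
Qed.

Lemma step_contract U U' W W' (r t c : R) : 0 < r -> 0 <= t -> 0 <= c ->
  contp halfline U -> contp halfline U' -> contp halfline W -> contp halfline W' ->
  duhamel_step U W -> duhamel_step U' W' ->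
  (forall s, segment t s -> p (U s) <= r) -> (forall s, segment t s -> p (U' s) <= r) ->
  let l := 4 * (M * (beta + L r)) in
  (forall s, segment t s -> p (U s - U' s) <= c * expR (l * s)) ->
  p (W t - W' t) <= c * 4^-1 * expR (l * t).
Proof.
move=> r0 t0 c0 cU cU' cW cW' sU sU' Ur U'r l UU'.
have K0 : 0 < M * (beta + L r) by rewrite mulr_gt0// ltr_wpDl// L0.
have l0 : 0 < l by rewrite mulr_gt0.
apply: le_trans (step_diff r0 t0 c0 l0 cU cU' cW cW' sU sU' Ur U'r UU') _.
rewrite ler_wpM2r ?expR_ge0// /l.
move: K0; set K := M * _ => K0.
have -> : K * (c / (4 * K)) = c * 4^-1 by field; rewrite gt_eqF.
exact: lexx.
Qed.

Definition history_size : R := \int[mu]_(s in `[0, tau]) (expR (alpha * s) * p (Psi (s - tau))).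

Lemma history_integrand : contp (segment tau) (fun s => Psi (s - tau)).
Proof.
have inPsi s : segment tau s -> `[- tau, 0]%classic (s - tau).
  by move=> /segmentP/andP[s0 st]; rewrite /= in_itv/= subr_le0 st andbT lerDr.
split=> [s /inPsi|s Ks e e0]; first exact: cPsi.1.
have [d d0 hd] := cPsi.2 _ (inPsi s Ks) e e0; exists d => // s' Ks' ss.
apply: hd; first exact: inPsi.
by rewrite opprB addrA subrK.
Qed.

Lemma history_integrable : mu.-integrable (segment tau)
  (EFin \o (fun s => expR (alpha * s) * p (Psi (s - tau)))).
Proof.
apply: continuous_compact_integrable; first exact: compact_segment.
apply/subspace_continuousP => s Ks; apply: cvgM.
  have h := @continuous_cexpR R 1 alpha.
  have e : (fun s : R => 1 * expR (alpha * s)) = (fun s => expR (alpha * s)).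
    by apply/funext => u; rewrite mul1r.
  by rewrite e in h; apply: cvg_within_filter; exact: h.
by have /subspace_continuousP/(_ s Ks) := contp_norm_continuous Hp history_integrand.
Qed.

Lemma history_sizeE : (\int[mu]_(s in segment tau) (expR (alpha * s) * p (Psi (s - tau)))%:E =
  history_size%:E)%E.
Proof.
rewrite /history_size /Rintegral fineK//.
apply: (integrable_fin_num _ history_integrable); exact: measurable_segment.
Qed.

Lemma history_size_ge0 : 0 <= history_size.
Proof. by apply: Rintegral_ge0 => s _; rewrite mulr_ge0// expR_ge0. Qed.

(** Trades the square-integral smallness of the data for the weighted L1 size in the estimate. [K]
    is not assumed measurable, so its integral is used only to bound that of the measurable minorant
    [q]. *)
Lemma history_size_le (b r : R) (K : R -> \bar R) : 0 < b -> 0 < r ->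
  (forall s, segment tau s -> ((b^-1 * p (Psi (s - tau)) ^+ 2)%:E <= K s)%E) ->
  (\int[mu]_(s in segment tau) K s <= (r ^+ 2)%:E)%E ->
  history_size <= expR (alpha * tau) * ((tau + b) / 2) * r.
Proof.
move=> b0 r0 hK intK; have mK := @measurable_segment R tau.
pose E := expR (alpha * tau); have E0 : 0 <= E := expR_ge0 _.
pose q s := b^-1 * p (Psi (s - tau)) ^+ 2.
have q0 s : 0 <= q s by rewrite mulr_ge0 ?sqr_ge0// invr_ge0 ltW.
have mh : measurable_fun (segment tau) (fun s => p (Psi (s - tau))).
  have h := contp_norm_continuous Hp history_integrand.
  exact: (subspace_continuous_measurable_fun mK h).
have mq : measurable_fun (segment tau) q.
  by apply: measurable_funM; [exact: measurable_cst|exact: measurable_funX].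
have intq : (\int[mu]_(s in segment tau) (q s)%:E <= (r ^+ 2)%:E)%E.
  apply: le_trans intK; apply: ge0_le_integral_nomeas => s Ks; first by rewrite lee_fin.
  exact: hK.
(* The two halves of the arithmetic-geometric mean inequality times E, with h^2 rewritten as b q;
   integrated, they give E r tau / 2 and at most E r b / 2. *)
pose c1 := E * (r / 2); pose c2 := E * (b / (2 * r)).
have c10 : 0 <= c1 by rewrite mulr_ge0// divr_ge0// ltW.
have c20 : 0 <= c2 by rewrite mulr_ge0// divr_ge0// ?mulr_ge0// ltW.
rewrite -lee_fin -history_sizeE.
have pt s : segment tau s -> expR (alpha * s) * p (Psi (s - tau)) <= c1 + c2 * q s.
  move=> /segmentP/andP[s0 st]; have h0 := p0 (Psi (s - tau)); rewrite /q.
  move: (p _) h0 => h h0.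
  apply: (@le_trans _ _ (E * h)).
    by rewrite ler_wpM2r// ler_expR ler_wpM2l// ltW// (sg_alpha HS).
  (* AM-GM: [h <= (r + h ^+ 2 / r) / 2] *)
  have -> : c1 + c2 * (b^-1 * h ^+ 2) = E * ((r ^+ 2 + h ^+ 2) / (2 * r)).
    by rewrite /c1 /c2; field; rewrite !gt_eqF.
  rewrite ler_wpM2l// ler_pdivlMr ?mulr_gt0//.
  have := sqr_ge0 (r - h); rewrite sqrrB; lra.
apply: (@le_trans _ _ (\int[mu]_(s in segment tau) (c1 + c2 * q s)%:E)%E).
  apply: ge0_le_integral_nomeas => s Ks; rewrite lee_fin ?pt//.
  by rewrite mulr_ge0// expR_ge0.
under eq_integral do rewrite EFinD.
rewrite (integral_affine (ltW tau0) c10 c20 q0 mq).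
have c20' : (0 <= c2%:E)%E by rewrite lee_fin.
apply: le_trans (leeD (lexx _) (lee_wpmul2l c20' intq)) _.
rewrite -EFinM -EFinD lee_fin le_eqVlt; apply/orP; left; apply/eqP.
by rewrite -/E /c1 /c2; field; rewrite gt_eqF.
Qed.

Definition initial_size : R := M * (p U0 + history_size).

Lemma initial_size_ge0 : 0 <= initial_size.
Proof. by rewrite mulr_ge0 ?(ltW M0)// addr_ge0// history_size_ge0. Qed.

Lemma step_decay U W (C : R) : 0 < C -> initial_size <= C ->
  let k := M * beta * expR (alpha * tau) + M * L C in
  k <= alpha ->
  contp halfline U -> contp halfline W -> duhamel_step U W ->
  (forall s, 0 <= s -> p (U s) <= initial_size * expR (- (alpha - k) * s)) ->
  forall t, 0 <= t -> p (W t) <= initial_size * expR (- (alpha - k) * t).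
Proof.
move=> C0 C0C k ka cU cW sU hUs t t0.
have [Id [Is [hd hs eW]]] := sU t t0.
have mK := @measurable_segment R t; have Koo := mu_segment_lty t.
have I0 := initial_size_ge0; have M0' := ltW M0.
have [C1 eC1] : exists C1 : R, C1 = initial_size by exists initial_size.
rewrite -eC1 in C0C I0 hUs *.
have LC := L0 C0; have LC' := ltW LC; have al := sg_alpha HS.
have k0 : 0 < k by rewrite /k ltr_wpDl ?mulr_ge0 ?(ltW M0) ?expR_ge0// mulr_gt0.
have hcU := contpW (@segment_halfline t) cU.
have ts s : segment t s -> 0 <= t - s by move=> /segmentP/andP[s0 st]; rewrite subr_ge0.
have ts0 s : segment t s -> 0 <= s by move=> /segmentP/andP[s0 st].
(* Since k <= alpha the exponential is at most 1, which keeps [U] in the ball where the source has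
   constant [L C]. *)
have Uball s : 0 <= s -> p (U s) <= C.
  move=> s0; apply: le_trans (hUs s s0) _; apply: le_trans C0C; rewrite ler_piMr// expR_le1.
  by rewrite mulNr oppr_le0 mulr_ge0// subr_ge0.
pose G s := expR (alpha * s) * p (Psi (s - tau)).
have G0 s : 0 <= G s by rewrite mulr_ge0// expR_ge0.
have Etts s : expR (- alpha * (t - s)) = expR (- alpha * t) * expR (alpha * s).
  by rewrite -expRD; congr expR; ring.
have Ek s : expR (alpha * s) * expR (- (alpha - k) * s) = expR (k * s).
  by rewrite -expRD; congr expR; ring.
(* Extending the history term by zero past tau bounds its integral over [0, t] by that over
   [0, tau], whether or not t has passed tau. *)
have mG : measurable_fun setT (G \_ (segment tau)).
  apply: (measurable_restrictT G (@measurable_segment R tau)).1.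
  by have /measurable_int/measurable_EFinP := history_integrable.
have mGt : measurable_fun (segment t) (fun s => M * expR (- alpha * t) * (G \_ (segment tau)) s).
  by apply: measurable_funM => //; exact: measurable_funTS.
(* Coefficients of e^(k s) in the bounds of the delayed and source integrands; they add up to k C1
   e^(-alpha t), which is the reason for the value of k. *)
pose cd := M * expR (- alpha * t) * (beta * expR (alpha * tau) * C1).
pose cs := M * expR (- alpha * t) * (L C * C1).
have cd0 : 0 <= cd by rewrite /cd !mulr_ge0// ?expR_ge0// ltW.
have cs0 : 0 <= cs by rewrite /cs !mulr_ge0// ?expR_ge0// ltW.
have dd : p Id <= M * expR (- alpha * t) * history_size + cd / k * (expR (k * t) - 1).
  have := bint_norm_le Hp mK Koo hd
    (m := fun s => M * expR (- alpha * t) * (G \_ (segment tau)) s + cd * expR (k * s)).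
  move=> /(_ (measurable_funD mGt (@measurable_cexpR R (segment t) cd k))) H.
  have {}H : ((p Id)%:E <= \int[mu]_(s in segment t)
      (M * expR (- alpha * t) * (G \_ (segment tau)) s + cd * expR (k * s))%:E)%E.
    apply: H => s Ks; have hD := delayed_HH cU t0 Ks; have s0 := ts0 s Ks.
    have GT : 0 <= (G \_ (segment tau)) s by rewrite /patch; case: ifP.
    apply: le_trans (sg_bound HS (ts s Ks) hD) _; rewrite Etts /delayed; case: ltP => st.
      have -> : (G \_ (segment tau)) s = G s.
        by rewrite /patch mem_set//; apply/segmentP; rewrite s0 ltW.
      rewrite /G -!mulrA -[X in X <= _]addr0; apply: lerD => //.
      by rewrite !mulr_ge0// ?expR_ge0// ltW.
    apply: (@le_trans _ _ (cd * expR (k * s))); last first.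
      by rewrite lerDr !mulr_ge0// ?expR_ge0// ltW.
    have s't : 0 <= s - tau by rewrite subr_ge0.
    have hUst := cU.1 _ ((halflineP _).2 s't).
    (* The shift by tau costs e^((alpha - k) tau), bounded by the e^(alpha tau) that appears in
       k. *)
    have b1 : p (B (U (s - tau))) <= beta * (C1 * (expR (alpha * tau) * expR (- (alpha - k) * s))).
      apply: le_trans (B_le hUst) _; rewrite ler_wpM2l//.
      apply: le_trans (hUs _ s't) _; rewrite ler_wpM2l// -expRD ler_expR.
      have := mulr_ge0 (ltW k0) (ltW tau0); lra.
    have -> : cd * expR (k * s) = M * (expR (- alpha * t) * expR (alpha * s)) *
        (beta * (C1 * (expR (alpha * tau) * expR (- (alpha - k) * s)))).
      by rewrite -(Ek s) /cd; ring.
    by rewrite ler_wpM2l ?mulr_ge0// ?expR_ge0// ltW.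
  rewrite -lee_fin; apply: le_trans H _.
  have f0 s : segment t s -> (0 <= (M * expR (- alpha * t) * (G \_ (segment tau)) s)%:E)%E.
    by move=> _; rewrite lee_fin !mulr_ge0// ?expR_ge0 ?(ltW M0)// /patch; case: ifP.
  have g0 s : segment t s -> (0 <= (cd * expR (k * s))%:E)%E.
    by move=> _; rewrite lee_fin mulr_ge0// expR_ge0.
  under eq_integral do rewrite EFinD.
  have mGt' := (measurable_EFinP _ _).2 mGt.
  have mcd := (measurable_EFinP _ _).2 (@measurable_cexpR R (segment t) cd k).
  rewrite (ge0_integralD mu mK f0 mGt' g0 mcd) integral_cexpR ?gt_eqF// EFinD leeD2r//.
  have h0 s : setT s -> (0 <= (M * expR (- alpha * t) * (G \_ (segment tau)) s)%:E)%E.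
    by move=> _; rewrite lee_fin !mulr_ge0// ?expR_ge0 ?(ltW M0)// /patch; case: ifP.
  apply: le_trans (ge0_subset_integral mu mK measurableT _ h0 (@subsetT _ _)) _.
    by apply/measurable_EFinP; apply: measurable_funM.
  under eq_integral do rewrite EFinM.
  rewrite ge0_integralZl_EFin//; last 3 first.
  - by move=> s _; rewrite lee_fin /patch; case: ifP.
  - exact/measurable_EFinP.
  - by rewrite mulr_ge0// ?expR_ge0// ltW.
  rewrite [leRHS]EFinM lee_wpmul2l//; first by rewrite lee_fin mulr_ge0// ?expR_ge0// ltW.
  rewrite -history_sizeE [leRHS]integral_mkcond; apply: ge0_le_integral_nomeas => s _.
    by rewrite lee_fin /patch; case: ifP.
  by rewrite /patch; case: ifP.
have ds : p Is <= cs / k * (expR (k * t) - 1).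
  rewrite -lee_fin -integral_cexpR ?gt_eqF//.
  apply: (bint_norm_le Hp mK Koo hs (@measurable_cexpR R (segment t) cs k)) => s Ks.
  have s0 := ts0 s Ks; have hu := hcU.1 s Ks.
  apply: le_trans (sg_bound HS (ts s Ks) (HHF hu)) _; rewrite Etts.
  have b1 : p (F (U s)) <= L C * (C1 * expR (- (alpha - k) * s)).
    apply: le_trans (F_le C0 hu (Uball s s0)) _.
    by rewrite ler_wpM2l ?(ltW LC)//; exact: hUs.
  have -> : cs * expR (k * s) = M * (expR (- alpha * t) * expR (alpha * s)) *
      (L C * (C1 * expR (- (alpha - k) * s))).
    by rewrite -(Ek s) /cs; ring.
  by rewrite ler_wpM2l ?mulr_ge0// ?expR_ge0// ltW.
have hId : HH Id by case: hd.
have hIs : HH Is by case: hs.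
have hS := sg_HH HS t0 hU0.
have hSI := csn_sub Hp hS hId.
have hZ := csn_add Hp hSI hIs.
have hWt := cW.1 t ((halflineP t).2 t0).
have a1 := csn_le_add Hp hWt hZ; have a2 := csnD Hp hSI hIs.
have a3 := csnB Hp hS hId.
have a4 := sg_bound HS t0 hU0.
have tot : M * expR (- alpha * t) * p U0 +
    (M * expR (- alpha * t) * history_size + cd / k * (expR (k * t) - 1)) + cs / k * (expR (k * t) - 1)
    = C1 * expR (- (alpha - k) * t).
  have -> : cd / k * (expR (k * t) - 1) = M * expR (- alpha * t) * (beta * expR (alpha * tau) * C1) / k * (expR (k * t) - 1) by [].
  have e1 : expR (- (alpha - k) * t) = expR (- alpha * t) * expR (k * t).
    by rewrite -expRD; congr expR; ring.
  have e2 : M * beta * expR (alpha * tau) + M * L C = k by [].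
  rewrite e1 /cs.
  have -> : M * expR (- alpha * t) * (beta * expR (alpha * tau) * C1) / k * (expR (k * t) - 1) =
     (M * beta * expR (alpha * tau)) / k * (C1 * expR (- alpha * t) * (expR (k * t) - 1)) by ring.
  have -> : M * expR (- alpha * t) * (L C * C1) / k * (expR (k * t) - 1) =
     (M * L C) / k * (C1 * expR (- alpha * t) * (expR (k * t) - 1)) by ring.
  have e3 : M * beta * expR (alpha * tau) = k - M * L C by rewrite -e2 addrK.
  rewrite e3 mulrBl divff ?gt_eqF//.
  have e4 : M * history_size + M * p U0 = C1 by rewrite eC1 -mulrDr addrC.
  rewrite -[C1 in RHS]e4 -e4; move: (M * L C / k) => q; ring.
move: eW a1 a2 a3 a4 dd ds tot; move: (p _) (p _) (p _) (p _) (p _) (p _) => x1 x2 x3 x4 x5 x6.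
lra.
Qed.

Lemma iterate_bounds (C : R) : 0 < C -> initial_size <= C ->
  let k := M * beta * expR (alpha * tau) + M * L C in k <= alpha ->
  let good U := contp halfline U /\
    forall t, 0 <= t -> p (U t) <= initial_size * expR (- (alpha - k) * t) in
  good (fun=> 0) /\ forall U, good U -> exists2 W, good W & duhamel_step U W.
Proof.
move=> C0 C0C k ka good; split=> [|U [cU hU]].
  split=> [|t t0].
    split=> [s _|s _ e e0]; first exact: csn_0 Hp.
    by exists 1 => // s' _ _; rewrite subrr (csn_norm0 Hp) ltW.
  by rewrite (csn_norm0 Hp) mulr_ge0 ?expR_ge0// initial_size_ge0.
have [W cW sU] := step_exists cU.
by exists W => //; split=> //; exact: step_decay C0 C0C ka cU cW sU hU.
Qed.

(* No smallness is needed here: on each bounded interval both solutions are bounded. *)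
Lemma duhamel_unique U W : contp halfline U -> contp halfline W ->
  duhamel_step U U -> duhamel_step W W -> forall t, 0 <= t -> p (W t - U t) = 0.
Proof.
move=> cU cW sU sW t t0.
have [CU CU0 hCU] := contp_bounded Hp (contpW (@segment_halfline t) cU).
have [CW CW0 hCW] := contp_bounded Hp (contpW (@segment_halfline t) cW).
pose r := CU + CW + 1; pose l := 4 * (M * (beta + L r)).
have r0 : 0 < r by rewrite /r ltr_wpDl// addr_ge0.
have l0 : 0 <= l by rewrite /l !mulr_ge0 ?(ltW M0)// addr_ge0// ltW// L0.
have Ur s : segment t s -> p (U s) <= r.
  by move=> /hCU h; apply: le_trans h _; rewrite /r -addrA lerDl addr_ge0.
have Wr s : segment t s -> p (W s) <= r.
  by move=> /hCW h; apply: le_trans h _; rewrite /r addrAC lerDr addr_ge0.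
(* Both functions are fixed by a step, so the trivial bound 2r on their distance gains a factor 1/4
   each time the contraction is applied. *)
have H j : forall s, segment t s -> p (W s - U s) <= 2 * r * 4^-1 ^+ j * expR (l * s).
  elim: j => [|j IH] s Ks; have /andP[s0 st] := (segmentP t s).1 Ks.
    have hU := cU.1 s ((halflineP s).2 s0); have hW := cW.1 s ((halflineP s).2 s0).
    have e1 : 1 <= expR (l * s) by rewrite -expR0 ler_expR mulr_ge0.
    rewrite expr0 mulr1; apply: le_trans (csnB Hp hW hU) _; rewrite mulr_natl mulr2n mulrDl.
    by apply: lerD; [apply: le_trans (Wr s Ks) _|apply: le_trans (Ur s Ks) _];
      rewrite ler_peMr// ltW.
  have sub s' : segment s s' -> segment t s'.
    by move=> /segmentP/andP[h1 h2]; apply/segmentP; rewrite h1 (le_trans h2).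
  rewrite exprSr mulrA; apply: (step_contract (r := r) r0 s0 _ cW cU cW cU sW sU) => [|s' /sub/Wr|s' /sub/Ur|s' /sub/IH] //.
  by rewrite !mulr_ge0// ?exprn_ge0// ltW.
apply/le_anti; rewrite p0 andbT.
have Kt : segment t t by apply/segmentP; rewrite t0 lexx.
apply: (ler_cvg_to (cvg_cst _) (cvg4 (2 * r * expR (l * t)))); apply: nearW => j.
by apply: le_trans (H j t Kt) _; rewrite mulrAC.
Qed.

Lemma duhamel_solution (C : R) : 0 < C -> initial_size <= C ->
  let k := M * beta * expR (alpha * tau) + M * L C in k <= alpha ->
  exists U, [/\ contp halfline U, duhamel_step U U &
    forall t, 0 <= t -> p (U t) <= initial_size * expR (- (alpha - k) * t)].
Proof.
move=> C0 C0C k ka; have [good0 goodS] := iterate_bounds C0 C0C ka.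
pose good U := contp halfline U /\
  forall t, 0 <= t -> p (U t) <= initial_size * expR (- (alpha - k) * t).
(* [U] itself is a default value outside [good], so that choice yields a total map to iterate. *)
have ex U : exists W, good U -> good W /\ duhamel_step U W.
  have [gU|nU] := pselect (good U); last by exists U.
  by have [W gW sU] := goodS U gU; exists W.
have [f hf] := choice ex.
pose u j : R -> V := iter j f (fun=> 0).
have gu j : good (u j) by elim: j => [|j IH] //; exact: (hf _ IH).1.
have su j : duhamel_step (u j) (u j.+1) by exact: (hf _ (gu j)).2.
have I0 := initial_size_ge0.
have [c ec] : exists c : R, c = initial_size by exists initial_size.
rewrite -ec in C0C I0 *.
have bdc U t : good U -> 0 <= t -> p (U t) <= c.
  move=> [_ hU] t0; apply: le_trans (hU t t0) _; rewrite -ec.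
  by rewrite ler_piMr// expR_le1 mulNr oppr_le0 mulr_ge0// subr_ge0.
have bdC U t (gU : good U) (t0 : 0 <= t) := le_trans (bdc U t gU t0) C0C.
have pos s T : segment T s -> 0 <= s by move=> /segmentP/andP[].
pose l := 4 * (M * (beta + L C)).
have l0 : 0 <= l by rewrite /l !mulr_ge0 ?(ltW M0)// addr_ge0// ltW// L0.
have hu j t : 0 <= t -> HH (u j t) by move=> t0; exact: (gu j).1.1 t ((halflineP t).2 t0).
have du j : forall t, 0 <= t -> p (u j.+1 t - u j t) <= 2 * c * 4^-1 ^+ j * expR (l * t).
  elim: j => [|j IH] t t0.
    have e1 : 1 <= expR (l * t) by rewrite -expR0 ler_expR mulr_ge0.
    rewrite expr0 mulr1; apply: le_trans (csnB Hp (hu 1%N t t0) (hu 0%N t t0)) _; rewrite mulr_natl mulr2n mulrDl.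
    by apply: lerD; [apply: le_trans (bdc _ _ (gu 1%N) t0) _|apply: le_trans (bdc _ _ (gu 0%N) t0) _];
      rewrite ler_peMr.
  rewrite [4^-1 ^+ j.+1]exprSr mulrA.
  apply: (step_contract C0 t0 _ (gu j.+1).1 (gu j).1 (gu j.+2).1 (gu j.+1).1 (su j.+1) (su j)).
  - by rewrite !mulr_ge0// exprn_ge0.
  - by move=> s /pos s0; exact: bdC (gu j.+1) s0.
  - by move=> s /pos s0; exact: bdC (gu j) s0.
  - by move=> s /pos s0; exact: IH s s0.
have lim t : exists w, 0 <= t ->
    HH w /\ forall j, p (w - u j t) <= 2 * (2 * c * expR (l * t)) * 4^-1 ^+ j.
  have [t0|t0] := leP 0 t; last by exists 0.
  have [|||W hW1 hW2] := @csn_complete _ _ _ _ Hp (u^~ t) (2 * c * expR (l * t)).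
  - by rewrite !mulr_ge0// expR_ge0.
  - by move=> j; exact: hu.
  - by move=> j; apply: le_trans (du j t t0) _; rewrite mulrAC.
  by exists W.
have [U hU] := choice lim.
have Uu t j : 0 <= t -> p (U t - u j t) <= 4 * c * expR (l * t) * 4^-1 ^+ j.
  move=> t0; apply: le_trans ((hU t t0).2 j) _; rewrite le_eqVlt; apply/orP; left; apply/eqP; ring.
(* The convergence is uniform on [0, s+1], where the weight is at most its value at s + 1;
   continuity passes to the limit by the usual three-thirds argument. *)
have cU : contp halfline U.
  split=> [s /halflineP s0|s /halflineP s0 e e0]; first exact: (hU s s0).1.
  have e3 : 0 < e / 3 by rewrite divr_gt0.
  have [N _ hN] := near_small (cvg4 (4 * c * expR (l * (s + 1)))) e3.
  have {}hN := hN N (leqnn N).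
  have hN' s' : 0 <= s' -> s' <= s + 1 -> p (U s' - u N s') <= e / 3.
    move=> s'0 s's; apply: le_trans (Uu s' N s'0) _; apply: le_trans (ltW hN).
    rewrite ler_wpM2r ?exprn_ge0// ler_wpM2l ?mulr_ge0// ler_expR.
    by rewrite ler_wpM2l.
  have [d d0 hd] := (gu N).1.2 s ((halflineP s).2 s0) _ e3.
  exists (Num.min d 1); first by rewrite lt_min d0 ltr01.
  move=> s' /halflineP s'0; rewrite lt_min => /andP[h1 h2].
  have s's : s' <= s + 1 by have := le_lt_trans (ler_norm _) h2; rewrite ltrBlDl => /ltW.
  have ss : s <= s + 1 by rewrite lerDl.
  have [hUs _] := hU s s0; have [hUs' _] := hU s' s'0.
  have a1 := csn_triangle Hp hUs' (hu N s' s'0) hUs.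
  have a2 := csn_triangle Hp (hu N s' s'0) (hu N s s0) hUs.
  have a3 := hN' s' s'0 s's; have a4 := hN' s s0 ss; rewrite (csn_subC Hp hUs (hu N s s0)) in a4.
  have a5 := hd s' ((halflineP s').2 s'0) h1.
  move: a1 a2 a3 a4 a5; move: (p _) (p _) (p _) (p _) (p _) => x1 x2 x3 x4 x5; lra.
have bU t : 0 <= t -> p (U t) <= c * expR (- (alpha - k) * t).
  move=> t0; rewrite -subr_le0.
  apply: (ler_cvg_to (cvg_cst _) (cvg4 (4 * c * expR (l * t)))); apply: nearW => j.
  have a1 := csn_le_add Hp (hU t t0).1 (hu j t t0).
  have a2 := Uu t j t0; have a3 := (gu j).2 t t0; rewrite -ec in a3.
  move: a1 a2 a3; move: (p _) (p _) (p _) (c * _) (_ * 4^-1 ^+ j) => x1 x2 x3 y z; lra.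
have gU : good U by split=> // t t0; rewrite -ec; exact: bU.
exists U; split=> // t t0.
have [W gW sW] := goodS U gU.
have hW := gW.1.1 t ((halflineP t).2 t0); have [hUt _] := hU t t0.
(* A step [W] of the limit is compared with [u j.+1], a step of [u j]: the contraction sends both
   [W] and [U] to the limit of the same sequence. *)
have UW : p (U t - W t) = 0.
  apply/le_anti; rewrite p0 andbT.
  apply: (ler_cvg_to (cvg_cst _) (cvg4 (2 * c * expR (l * t)))); apply: nearW => j.
  have a1 := csn_triangle Hp hUt (hu j.+1 t t0) hW.
  have a2 := Uu t j.+1 t0.
  have a3 : p (W t - u j.+1 t) <= 4 * c * 4^-1 ^+ j * 4^-1 * expR (l * t).
    apply: (step_contract C0 t0 _ cU (gu j).1 gW.1 (gu j.+1).1 sW (su j)).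
    - by rewrite !mulr_ge0// exprn_ge0.
    - by move=> s /pos s0; exact: bdC gU s0.
    - by move=> s /pos s0; exact: bdC (gu j) s0.
    - by move=> s /pos s0; apply: le_trans (Uu s j s0) _; rewrite mulrAC.
  rewrite (csn_subC Hp hW (hu j.+1 t t0)) in a3.
  have e1 : 4 * c * expR (l * t) * 4^-1 ^+ j.+1 = c * expR (l * t) * 4^-1 ^+ j.
    by rewrite exprSr; field.
  have e2 : 4 * c * 4^-1 ^+ j * 4^-1 * expR (l * t) = c * expR (l * t) * 4^-1 ^+ j by field.
  have e3 : 2 * c * expR (l * t) * 4^-1 ^+ j = c * expR (l * t) * 4^-1 ^+ j + c * expR (l * t) * 4^-1 ^+ j by ring.
  rewrite e1 in a2; rewrite e2 in a3; rewrite e3.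
  by apply: le_trans a1 _; apply: lerD.
have [Id [Is [hd hs eW]]] := sW t t0; exists Id, Is; split=> //.
have a1 := csn_triangle Hp hUt hW (step_HH t0 hd hs); rewrite UW eW addr0 in a1.
by apply/le_anti; rewrite a1 p0.
Qed.

End delay_equation.

(** * The wave system *)

Section wave_system.
Context (R : realType) (n : nat).
Local Notation X := 'rV[R]_n.+1.
Local Notation leb := (@lebesgue_rV R n.+1).
Context (Omega : set X) (oOm : open Omega) (bOm : bounded_set Omega).
Local Notation HH := (energy_space Omega).
Local Notation hnorm := (energy_norm Omega).

Lemma energy_complete_seminorm : complete_seminorm HH hnorm.
Proof. by split; [exact: energy_seminorm|exact: HH_complete]. Qed.

Lemma energy_continuousP (D : set R) (U : R -> state R n) :
  energy_continuous Omega D U <-> contp HH hnorm D U.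
Proof.
split=> -[hU cU]; split=> //.
  move=> s Ds e e0; have /cvgrPdist_le/(_ e e0) := cU s Ds.
  rewrite near_withinE => /nbhs_ballP[d /= d0 hd]; exists d => // t Dt ts.
  have := hd t; rewrite /ball/= distrC => /(_ ts Dt); rewrite sub0r normrN.
  exact: le_trans (ler_norm _).
move=> s Ds; apply/cvgrPdist_le => e e0; have [d d0 hd] := cU s Ds e e0.
rewrite near_withinE; apply/nbhs_ballP; exists d => //= t st Dt.
rewrite sub0r normrN (ger0_norm (hnorm_ge0 _ _)).
by apply: hd => //; rewrite distrC.
Qed.

Lemma semigroup_bounded a1 b S (M alpha : R) : contraction_semigroup_of Omega a1 b S ->
  exponential_bound Omega S M alpha -> bounded_semigroup HH hnorm S M alpha.
Proof.
move=> [[SH _ Slin _] S0 Sadd Scont _] [M0 al bd]; split=> //.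
- move=> t U W t0 hU hW.
  have e (x y : state R n) : -1 *: x + y = y - x by rewrite scaleN1r addrC.
  have Hp := energy_seminorm oOm; have hUW := csn_sub Hp hU hW.
  have hS := csn_sub Hp (SH t U t0 hU) (SH t W t0 hW).
  have := Slin t (-1) W U t0 hW hU; rewrite !e => /(hnorm_state_eq oOm bOm (SH t _ t0 hUW) hS) <-.
  exact: (bd t (U - W) t0 hUW).
- move=> s t U s0 t0 hU.
  apply/(state_eqP oOm bOm (SH _ _ (addr_ge0 s0 t0) hU) (SH _ _ s0 (SH _ _ t0 hU))).
  exact: Sadd.
move=> U hU e e0; have /cvgrPdist_le/(_ e e0) := Scont U hU.
rewrite near_withinE => /nbhs_ballP[d /= d0 hd]; exists d => // h.
(* The right limit at 0 leaves out h = 0, where [S 0] is the identity up to a.e. equality. *)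
rewrite le_eqVlt => /predU1P[<- _|h0 hh].
  have /(state_eqP oOm bOm (SH 0 U (lexx 0) hU) hU) -> := S0 U hU; exact: ltW.
have := hd h; rewrite /ball/= sub0r normrN gtr0_norm// => /(_ hh h0); rewrite sub0r normrN.
exact: le_trans (ler_norm _).
Qed.

Context (a2 : X -> R) (a2L : Linfty Omega a2).
Local Notation beta := (Linftynorm Omega a2).

(** Pointwise a.e., |a2 v|^2 <= b |a2| v^2. The right-hand side may be infinite or non-measurable,
    hence the extended norm. *)
Lemma L2norm_sqrt_weight (b : R) (v : X -> R) : beta <= b -> 0 < b ->
  L2 Omega (fun x => a2 x * v x) ->
  ((b^-1 * L2norm Omega (fun x => a2 x * v x) ^+ 2)%:E
    <= L2norme Omega (fun x => Num.sqrt `|a2 x| * v x)%R ^+ 2)%E.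
Proof.
move=> bb b0 hv; pose w := (fun x => a2 x * v x) \_ Omega.
have wL : w \in Lfun leb 2%:E by exact: hv.
have mw := L2_mfun wL; have ma := a2_meas a2L.
pose A := [set x | `|(a2 \_ Omega) x| <= b].
have mA : measurable A.
  have ma' : measurable_fun setT (fun x => `|(a2 \_ Omega) x|).
    by apply: measurableT_comp ma; exact: normr_measurable.
  have -> : A = (fun x => `|(a2 \_ Omega) x|) @^-1` `]-oo, b]%classic.
    by apply/seteqP; split=> x /=; rewrite in_itv.
  by rewrite -[X in measurable X]setTI; apply: ma' => //; exact: measurable_itv.
pose q x := b^-1 * w x ^+ 2.
have q0 x : 0 <= q x by rewrite mulr_ge0 ?sqr_ge0// invr_ge0 ltW.
have mq : measurable_fun setT q.
  by apply: measurable_funM; [exact: measurable_cst|exact: measurable_funX].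
have -> : ((b^-1 * L2norm Omega (fun x => a2 x * v x) ^+ 2)%:E = \int[leb]_x (q x)%:E)%E.
  rewrite EFinM /L2norm /L2norme -/w -/(nrm2 leb w) (nrm2_sqrE wL).
  rewrite -ge0_integralZl_EFin//.
  - by move=> x _; rewrite lee_fin sqr_ge0.
  - by apply/measurable_EFinP; exact: measurable_funX.
  - by rewrite invr_ge0 ltW.
rewrite /L2norme Lnorm2_sqr.
(* Multiplying the measurable side by the indicator of [A] makes the inequality hold at every point,
   as monotonicity without measurability requires. *)
have -> : (\int[leb]_x (q x)%:E = \int[leb]_x (q x * \1_A x)%:E)%E.
  apply: ae_eq_integral => //.
  - exact/measurable_EFinP.
  - by apply/measurable_EFinP; apply: measurable_funM => //; exact: measurable_indic.
  apply: filterS (a2_ae a2L) => x ax _; rewrite indicE mem_set ?mulr1//.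
  exact: le_trans ax bb.
apply: ge0_le_integral_nomeas => x _; rewrite lee_fin; first by rewrite mulr_ge0.
rewrite indicE; case: (boolP (x \in A)) => [/set_mem xA|_]; last by rewrite mulr0 sqr_ge0.
rewrite mulr1 /q /w /patch; case: ifPn => xO; last by rewrite expr0n mulr0.
have {}xA : `|a2 x| <= b by move: xA; rewrite /A/= /patch xO.
rewrite !exprMn sqr_sqrtr// mulrA ler_wpM2r ?sqr_ge0//.
by rewrite mulrC ler_pdivrMr// -[_ ^+ 2]real_normK ?num_real// expr2 ler_wpM2l.
Qed.

(** Transfers mild solutions to the abstract setting; the content is that a.e. equality in the
    Duhamel formula means vanishing energy distance. *)
Lemma mild_solutionP S (M alpha : R) (f1 f2 : R -> R) tau U0 g U :
  bounded_semigroup HH hnorm S M alpha -> HH U0 ->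
  mild_solution Omega S a2 f1 f2 tau U0 g U <->
  contp HH hnorm (@halfline R) U /\
  duhamel_step HH hnorm S (opB a2) (opF f1 f2) tau (history a2 g) U0 U U.
Proof.
move=> HS hU0; have Hp := energy_complete_seminorm.
have E (t : R) Id Is : 0 <= t -> HH (U t) -> HH Id -> HH Is ->
    state_eq Omega (U t) (S t U0 - Id + Is) <-> hnorm (U t - (S t U0 - Id + Is)) = 0.
  move=> t0 hU hd hs; apply: (state_eqP oOm bOm hU).
  exact: (csn_add Hp (csn_sub Hp (sg_HH HS t0 hU0) hd) hs).
split=> [[cU sU]|[cU sU]].
  have {}cU := (energy_continuousP _ _).1 cU; split; first exact: cU.
  move=> t t0; have [Id [Is [hd hs e]]] := sU t t0; exists Id, Is.
  have hId : HH Id by case: hd. have hIs : HH Is by case: hs.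
  split; [exact: hd|exact: hs|exact: ((E t Id Is t0 (cU.1 t ((halflineP t).2 t0)) hId hIs).1 e)].
split; first exact: ((energy_continuousP _ _).2 cU).
move=> t t0; have [Id [Is [hd hs e]]] := sU t t0; exists Id, Is.
have hId : HH Id by case: hd. have hIs : HH Is by case: hs.
split; [exact: hd|exact: hs|exact: ((E t Id Is t0 (cU.1 t ((halflineP t).2 t0)) hId hIs).2 e)].
Qed.

Lemma hnorm_history (g : R -> X -> R) s :
  hnorm (history a2 g s) = L2norm Omega (fun x => a2 x * g s x).
Proof. exact: hnorm_velocity2. Qed.

End wave_system.
Theorem theorem2p2 (R : realType) (n : nat)
  (Omega omega omegab : set 'rV[R]_n.+1)
  (Omega_open : open Omega) (Omega_connected : connected Omega)
  (Omega_nonempty : Omega !=set0) (Omega_bounded : bounded_set Omega)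
  (Omega_C2 : C2_boundary Omega)
  (tau : R) (tau_gt0 : 0 < tau)
  (a1 b a2 : 'rV[R]_n.+1 -> R)
  (omega_open : open omega) (omega_sub : omega `<=` Omega)
  (a1_damping : damping_coefficient Omega omega a1)
  (omegab_open : open omegab) (omegab_nonempty : omegab !=set0)
  (b_coupling : coupling_coefficient Omega omegab b)
  (a2_Linfty : Linfty Omega a2)
  (S : R -> state R n -> state R n)
  (S_semigroup : contraction_semigroup_of Omega a1 b S)
  (geometric : condition_GCC Omega omega omegab \/
     exists2 bstar : R, stability_threshold Omega omega omegab bstar &
                        condition_PMGC Omega omega omegab b bstar)
  (f1 f2 L : R -> R) (f_N : hypothesis_N Omega f1 f2 L)
  (M alpha : R) (S_bound : exponential_bound Omega S M alpha)
  (a2_small : expR (alpha * tau) * Linftynorm Omega a2 < alpha / M) :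
  exists2 rho0 : R, 0 < rho0 & forall rho : R, 0 < rho < rho0 ->
  exists C : R,
    [/\ 0 < C,
        L C < (alpha - M * Linftynorm Omega a2 * expR (alpha * tau)) / M &
        forall (U0 : state R n) (g : R -> 'rV[R]_n.+1 -> R),
          energy_space Omega U0 ->
          energy_continuous Omega `[- tau, 0] (history a2 g) ->
          ((energy_norm Omega U0 ^+ 2)%:E +
             \int[lebesgue_measure]_(s in `[0%R, tau])
               L2norme Omega (fun x => Num.sqrt `|a2 x| * g (s - tau) x)%R ^+ 2
           < (rho ^+ 2)%:E)%E ->
          exists U : R -> state R n,
            [/\ mild_solution Omega S a2 f1 f2 tau U0 g U,
                forall V, mild_solution Omega S a2 f1 f2 tau U0 g V ->
                  forall t : R, 0 <= t -> state_eq Omega (V t) (U t) &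
                forall t : R, 0 <= t ->
                  energy_norm Omega (U t) <=
                  M * (energy_norm Omega U0 +
                       \int[lebesgue_measure]_(s in `[0, tau])
                         (expR (alpha * s) *
                          energy_norm Omega (history a2 g (s - tau))))
                    * expR (- (alpha - M * Linftynorm Omega a2 *
                                 expR (alpha * tau) - M * L C) * t)]].
Proof.
have [M0 al bd] := S_bound; have HS := semigroup_bounded Omega_open Omega_bounded S_semigroup S_bound.
have Hp := energy_complete_seminorm Omega_open Omega_bounded.
have be0 := Linftynorm_ge0 Omega a2.
have [beta eb] : exists beta : R, beta = Linftynorm Omega a2 by exists (Linftynorm Omega a2).
rewrite -eb in be0 a2_small *; have e0 := expR_gt0 (alpha * tau).
have [L0 L_to0] : (forall r, 0 < r -> 0 < L r) /\ L @ 0^'+ --> (0 : R) by case: f_N.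
have gap : 0 < (alpha - M * beta * expR (alpha * tau)) / M.
  rewrite divr_gt0// subr_gt0; rewrite ltr_pdivlMr// in a2_small.
  by have -> : M * beta * expR (alpha * tau) = expR (alpha * tau) * beta * M by ring.
(* [a2_small] makes the gap positive, and L tends to 0 at 0 from the right, so some small radius has
   its constant inside the gap. *)
have [C C0 LC] : exists2 C, 0 < C & L C < (alpha - M * beta * expR (alpha * tau)) / M.
  have /cvgrPdist_lt/(_ _ gap) := L_to0; rewrite near_withinE => /nbhs_ballP[d /= d0 hd].
  have d2 : 0 < d / 2 by rewrite divr_gt0.
  exists (d / 2) => //; have := hd (d / 2); rewrite /ball/= !sub0r !normrN gtr0_norm//.
  rewrite ltr_pdivrMr// ltr_pMr// ltr1n => /(_ isT d2).
  exact: le_lt_trans (ler_norm _).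
have ka : M * beta * expR (alpha * tau) + M * L C <= alpha.
  by rewrite ltr_pdivlMr// in LC; rewrite -lerBrDl [M * L C]mulrC ltW.
(* For data of size rho the sum of |U0| and the history size is at most K rho: the 1 accounts for
   [U0], the rest is the constant of [history_size_le]. *)
pose K := 1 + expR (alpha * tau) * ((tau + (beta + 1)) / 2).
have K0 : 0 < K by rewrite /K ltr_wpDr// mulr_ge0 ?(ltW e0)// divr_ge0// !addr_ge0// ltW.
(* Below this threshold M K rho < C, so the same radius [C] serves every rho. *)
exists (C / (M * K)) => [|rho /andP[rho0 rhoC]]; first by rewrite divr_gt0// mulr_gt0.
exists C; split=> //.
move=> U0 g hU0 /energy_continuousP cg ini.
(* [beta + 1] instead of [beta], which may vanish *)
have beta1 : 0 < beta + 1 by rewrite ltr_wpDl.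
pose J s : \bar R := (L2norme Omega (fun x => Num.sqrt `|a2 x| * g (s - tau) x)%R ^+ 2)%E.
have J0 s : (0 <= J s)%E by rewrite expe_ge0// Lnorm_ge0.
have intJ0 : (0 <= \int[lebesgue_measure]_(s in segment tau) J s)%E by apply: integral_ge0.
(* Both terms of the smallness condition are nonnegative, so each is at most rho^2 separately. *)
have U0rho : energy_norm Omega U0 <= rho.
  rewrite -(@ler_pXn2r _ 2)// ?nnegrE ?hnorm_ge0 ?(ltW rho0)//.
  rewrite -lee_fin; apply: le_trans (ltW ini); rewrite leeDl//.
have intJ : (\int[lebesgue_measure]_(s in segment tau) J s <= (rho ^+ 2)%:E)%E.
  apply: le_trans (ltW ini); rewrite leeDr// lee_fin sqr_ge0//.
have hsize : history_size (energy_norm Omega) alpha tau (history a2 g)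
    <= expR (alpha * tau) * ((tau + (beta + 1)) / 2) * rho.
  apply: (history_size_le Hp HS tau_gt0 cg beta1 rho0 _ intJ) => s /segmentP/andP[s0 st].
  have Is : `[- tau, 0]%classic (s - tau) by rewrite /= in_itv/= subr_le0 st andbT lerDr.
  have [_ _ _ hL] := cg.1 _ Is.
  have bb : Linftynorm Omega a2 <= beta + 1 by rewrite -eb lerDl.
  have h := L2norm_sqrt_weight a2_Linfty bb beta1 hL.
  rewrite (hnorm_history Omega_open); exact: h.
have init_le : initial_size (energy_norm Omega) M alpha tau (history a2 g) U0 <= C.
  move: rhoC; rewrite ltr_pdivlMr ?mulr_gt0// => /ltW; apply: le_trans.
  rewrite /initial_size mulrCA ler_wpM2l ?(ltW M0)// /K mulrDr mulr1 [rho * _]mulrC.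
  exact: lerD U0rho hsize.
have B_HH := HH_opB Omega_open a2_Linfty; have F_HH := HH_opF Omega_open f_N.
have B_le := hnorm_opB Omega_open a2_Linfty; rewrite -eb in B_le.
have B_lip U W : energy_space Omega U -> energy_space Omega W ->
    energy_norm Omega (opB a2 U - opB a2 W) <= beta * energy_norm Omega (U - W).
  by move=> hU hW; rewrite opB_sub; exact: (B_le _ (csn_sub Hp hU hW)).
have F_lip := hnorm_opF Omega_open f_N; have F_le := hnorm_opF_le Omega_open f_N.
have msP := @mild_solutionP R n Omega Omega_open Omega_bounded a2 S M alpha f1 f2 tau U0 g.
have [U [cU sU dU]] := duhamel_solution Hp HS be0 B_HH B_lip B_le F_HH L0 F_lip F_le tau_gt0 cg hU0
  C0 init_le ka.
exists U; split.
- by apply/(msP U HS hU0); split; [exact: cU|exact: sU].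
- move=> V /(msP V HS hU0)[cV sV] t t0.
  apply/(state_eqP Omega_open Omega_bounded (cV.1 t ((halflineP t).2 t0)) (cU.1 t ((halflineP t).2 t0))).
  exact: (duhamel_unique Hp HS be0 B_HH B_lip F_HH L0 F_lip tau_gt0 cg hU0 cU cV sU sV t0).
move=> t t0; have dUt := dU t t0; rewrite -addrA -opprD; exact: dUt.
Qed.
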